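(* Let $\mathcal{A}\subsetneq\mathbb{Z}_M^2$ be an alphabet such that the Cantor set $\mathbf{X}\subset\mathbb{T}^2$ generated by $\mathcal{A}$ does not contain a pair of orthogonal lines, i.e. there are no $\mathbf{v}\in\mathbb{R}^2\setminus\{0\}$ and $\mathbf{p},\mathbf{q}\in\mathbb{T}^2$ with $\mathbb{R}\mathbf{v}+\mathbf{p}\subset\mathbf{X}$ and $\mathbb{R}\mathbf{v}^\perp+\mathbf{q}\subset\mathbf{X}$. Then there is some $\beta=\beta(M,\mathcal{A})>0$ such that, for every cutoff $\chi\in C_0^\infty((0,1)^2;[0,1])$, the two dimensional quantum open baker's maps $B_N$ associated with $(M,\mathcal{A},\chi)$ satisfy $$\limsup_{N\to\infty}\ \max\{|\lambda|:\lambda\in\operatorname{Sp}(B_N)\}\le M^{-\beta},$$ where $N$ ranges over the powers $N=M^k$, $k\ge1$, and $\operatorname{Sp}(B_N)$ is the spectrum of $B_N$.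
   Context: $M$ is a positive integer, $\mathbb{Z}_N=\mathbb{Z}/N\mathbb{Z}$ is identified with $\{0,\dots,N-1\}$, and an alphabet is a proper subset $\mathcal{A}\subsetneq\mathbb{Z}_M^2$. Cantor set: $\mathbb{T}^2=\mathbb{R}^2/\mathbb{Z}^2$, identified as a set with $[0,1)^2$. $\mathbf{X}$ is the set of $(x,y)\in\mathbb{T}^2$ having some base-$M$ expansions $x=0.a_0a_1\dots$, $y=0.b_0b_1\dots$ with $(a_j,b_j)\in\mathcal{A}$ for all $j\ge0$ (if a coordinate has two expansions, either may be used). Equivalently $\mathbf{X}=\bigcap_{k\ge1}\mathbf{X}_k$, with $\mathbf{X}_k$ the closure of $\{(x,y)\in[0,1)^2:(\lfloor M^kx\rfloor,\lfloor M^ky\rfloor)\in\mathcal{X}_k\}$ and $\mathcal{X}_k=\{(\sum_{j<k}a_jM^j,\sum_{j<k}b_jM^j):(a_j,b_j)\in\mathcal{A}\}\subset\mathbb{Z}_{M^k}^2$. For $\mathbf{v}=(a,b)$, $\mathbf{v}^\perp=(-b,a)$; $\mathbb{R}\mathbf{v}+\mathbf{p}=\{t\mathbf{v}+\mathbf{p}\bmod\mathbb{Z}^2:t\in\mathbb{R}\}$. Baker's maps: $\chi\in C_0^\infty((0,1)^2;[0,1])$ is a smooth function compactly supported in $(0,1)^2$ with values in $[0,1]$; $\chi_N(\mathbf{j})=\chi(\mathbf{j}/N)$ for $\mathbf{j}\in\{0,\dots,N-1\}^2$, also regarded as a multiplication operator on $\ell^2(\mathbb{Z}_N^2)$. $\mathcal{F}_N$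 is the unitary Fourier transform on $\ell^2(\mathbb{Z}_N^2)$, $\mathcal{F}_Nf(\boldsymbol\xi)=\frac1N\sum_{\mathbf{x}\in\mathbb{Z}_N^2}f(\mathbf{x})e^{-\frac{2\pi i}{N}\mathbf{x}\cdot\boldsymbol\xi}$. For $N=M^k$ and $\mathbf{a}\in\mathbb{Z}_M^2=\{0,\dots,M-1\}^2$, define $\Pi_{\mathbf{a}}:\ell^2(\mathbb{Z}_N^2)\to\ell^2(\mathbb{Z}_{N/M}^2)$ by $\Pi_{\mathbf{a}}u(\mathbf{j})=u(\mathbf{j}+\mathbf{a}\frac NM)$ for $\mathbf{j}\in\{0,\dots,N/M-1\}^2$. The quantum open baker's map is the operator on $\ell^2(\mathbb{Z}_N^2)$ $$B_N=\sum_{\mathbf{a}\in\mathcal{A}}\mathcal{F}_N^*\,\Pi_{\mathbf{a}}^*\,\chi_{N/M}\,\mathcal{F}_{N/M}\,\chi_{N/M}\,\Pi_{\mathbf{a}}.$$ *)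

(* Defs.v *)
From HB Require Import structures.
From mathcomp Require Import all_boot all_order all_algebra.
From mathcomp Require Import all_classical all_reals all_analysis.
From mathcomp Require Import complex.
Import Order.TTheory GRing.Theory Num.Theory.
Import numFieldNormedType.Exports.

Set Implicit Arguments.
Unset Strict Implicit.
Unset Printing Implicit Defensive.

Local Open Scope classical_set_scope.
Local Open Scope ring_scope.
Local Open Scope complex_scope.

(* The torus R^2/Z^2 is identified with the fundamental domain [0,1)^2. *)
Definition torus2 (R : realType) : set (R * R) :=
  [set z | (0 <= z.1 < 1) && (0 <= z.2 < 1)].

Definition mod1 (R : realType) (x : R) : R := x - (Num.floor x)%:~R.

Definition mod_Z2 (R : realType) (z : R * R) : R * R := (mod1 z.1, mod1 z.2).

Definition torus_line (R : realType) (v p : R * R) : set (R * R) :=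
  [set mod_Z2 (t *: v + p) | t in [set: R]].

Definition perp (R : realType) (v : R * R) : R * R := (- v.2, v.1).

(* The number 0.a_0a_1a_2... in base M. *)
Definition expansion (R : realType) (M : nat) (a : nat -> 'I_M) : R :=
  limn [series (a j)%:R / M%:R ^+ j.+1 : R]_j.

(* The reduction modulo Z^2 matters only for the expansion in which every
   digit is M - 1, whose value 1 represents the point 0 of the circle. *)
Definition cantor_set (R : realType) (M : nat) (A : {set 'I_M * 'I_M}) :
    set (R * R) :=
  [set z | exists2 d : nat -> 'I_M * 'I_M,
     forall j, d j \in A &
     z = mod_Z2 (expansion R (fun j => (d j).1), expansion R (fun j => (d j).2))].

Arguments cantor_set R {M} A.

Definition has_orthogonal_lines (R : realType) (X : set (R * R)) : Prop :=
  exists v p q : R * R,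
    [/\ v != 0, torus2 p, torus2 q,
        torus_line v p `<=` X & torus_line (perp v) q `<=` X].

(* C^n, by continuity of all partial derivatives of order at most n. *)
Fixpoint Cn (R : realType) (n : nat) (f : R * R -> R) : Prop :=
  continuous f /\
  if n is n'.+1 then
    [/\ forall z, derivable f z (1, 0), forall z, derivable f z (0, 1),
        Cn n' (fun z => 'D_(1, 0) f z) & Cn n' (fun z => 'D_(0, 1) f z)]
  else True.

(* C_0^oo((0,1)^2; [0,1]), its elements being extended by zero to the plane. *)
Definition is_cutoff (R : realType) (chi : R * R -> R) : Prop :=
  [/\ forall n, Cn n chi,
      forall z, 0 <= chi z <= 1,
      compact (closure [set z | chi z != 0]) &
      closure [set z | chi z != 0] `<=`
        [set z : R * R | (0 < z.1 < 1) && (0 < z.2 < 1)]].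

(* l^2(Z_N^2), with Z_N = {0, .., N - 1} as index set. *)
Definition l2 (R : realType) (N : nat) := {ffun 'I_N * 'I_N -> R[i]^o}.

Definition inner (R : realType) (N : nat) (u v : l2 R N) : R[i] :=
  \sum_j u j * (v j)^*.

Definition l2_delta (R : realType) (N : nat) (i : 'I_N * 'I_N) : l2 R N :=
  [ffun j => (j == i)%:R].

(* The Hilbert space adjoint; see adjoint_opP. *)
Definition adjoint_op (R : realType) (N N' : nat)
    (T : 'Hom(l2 R N, l2 R N')) : 'Hom(l2 R N', l2 R N) :=
  linfun (fun v : l2 R N' => [ffun i => inner v (T (l2_delta R i))] : l2 R N).

Definition expi (R : realType) (t : R) : R[i] := cos t +i* sin t.

Definition fourier (R : realType) (N : nat) : 'End(l2 R N) :=
  linfun (fun f : l2 R N => [ffun xi : 'I_N * 'I_N =>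
    N%:R^-1 * \sum_x f x *
      expi (- (2 * pi / N%:R * (x.1 * xi.1 + x.2 * xi.2)%N%:R))] : l2 R N).

Definition cutoff_op (R : realType) (chi : R * R -> R) (N : nat) :
    'End(l2 R N) :=
  linfun (fun u : l2 R N =>
    [ffun j : 'I_N * 'I_N => (chi (j.1%:R / N%:R, j.2%:R / N%:R))%:C * u j] : l2 R N).

Fact block_index_subproof (M k : nat) (a : 'I_M) (j : 'I_(M ^ k)) :
  (j + a * M ^ k < M ^ k.+1)%N.
Proof.
rewrite expnS; apply: (@leq_trans (a.+1 * M ^ k)); last first.
  by rewrite leq_mul2r ltn_ord orbT.
by rewrite mulSn ltn_add2r.
Qed.

Definition block_index (M k : nat) (a : 'I_M) (j : 'I_(M ^ k)) : 'I_(M ^ k.+1) :=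
  Ordinal (block_index_subproof a j).

(* Pi_a : l^2(Z_N^2) -> l^2(Z_{N/M}^2), with N = M^(k+1). *)
Definition Pi_op (R : realType) (M k : nat) (a : 'I_M * 'I_M) :
    'Hom(l2 R (M ^ k.+1), l2 R (M ^ k)) :=
  linfun (fun u : l2 R (M ^ k.+1) =>
    [ffun j : 'I_(M ^ k) * 'I_(M ^ k) =>
     u (block_index a.1 j.1, block_index a.2 j.2)] : l2 R (M ^ k)).

(* B_N with N = M^(k+1), so that k : nat covers all the powers N = M^k, k >= 1. *)
Definition baker (R : realType) (M : nat) (A : {set 'I_M * 'I_M})
    (chi : R * R -> R) (k : nat) : 'End(l2 R (M ^ k.+1)) :=
  \sum_(a in A)
    (adjoint_op (fourier R (M ^ k.+1)) \o adjoint_op (Pi_op R k a) \o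
     cutoff_op chi (M ^ k) \o fourier R (M ^ k) \o cutoff_op chi (M ^ k) \o
     Pi_op R k a)%VF.

Definition spectrum (R : realType) (N : nat) (T : 'End(l2 R N)) : set R[i] :=
  [set l | passmx.leigenvalue T l].

(* The modulus `|l| has values in R[i], hence the real part.  The set is finite,
   and nonempty if N > 0, so that the supremum is a maximum. *)
Definition spectral_radius (R : realType) (N : nat) (T : 'End(l2 R N)) :
    \bar R :=
  ereal_sup [set (complex.Re `|l|)%:E | l in spectrum T].

Lemma linfunE (K : fieldType) (U V : vectType K) (f : U -> V) :
  linear f -> linfun f =1 f.
Proof.
move=> lf u.
pose m := GRing.isLinear.Build _ _ _ _ f lf.
pose g : {linear U -> V} := HB.pack f m.
exact: (lfunE g).
Qed.

Lemma fourierE (R : realType) (N : nat) (f : l2 R N) (xi : 'I_N * 'I_N) :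
  fourier R N f xi = N%:R^-1 * \sum_x f x *
    expi (- (2 * pi / N%:R * (x.1 * xi.1 + x.2 * xi.2)%N%:R)).
Proof.
rewrite linfunE ?ffunE // => c u v; apply/ffunP => j; rewrite !ffunE.
rewrite /GRing.scale /= mulrCA -mulrDr; congr (_ * _).
rewrite mulr_sumr -big_split; apply: eq_bigr => x _ /=.
by rewrite !ffunE mulrDl mulrA.
Qed.

Lemma cutoff_opE (R : realType) (chi : R * R -> R) (N : nat) (u : l2 R N)
    (j : 'I_N * 'I_N) :
  cutoff_op chi N u j = (chi (j.1%:R / N%:R, j.2%:R / N%:R))%:C * u j.
Proof.
rewrite linfunE ?ffunE // => c v w; apply/ffunP => i; rewrite !ffunE.
by rewrite /GRing.scale /= mulrDr mulrCA.
Qed.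

Lemma Pi_opE (R : realType) (M k : nat) (a : 'I_M * 'I_M)
    (u : l2 R (M ^ k.+1)) (j : 'I_(M ^ k) * 'I_(M ^ k)) :
  Pi_op R k a u j = u (block_index a.1 j.1, block_index a.2 j.2).
Proof.
by rewrite linfunE ?ffunE // => c v w; apply/ffunP => i; rewrite !ffunE.
Qed.

Lemma adjoint_opE (R : realType) (N N' : nat) (T : 'Hom(l2 R N, l2 R N'))
    (v : l2 R N') (i : 'I_N * 'I_N) :
  adjoint_op T v i = inner v (T (l2_delta R i)).
Proof.
rewrite linfunE ?ffunE // => c u w; apply/ffunP => j; rewrite !ffunE /inner.
rewrite /GRing.scale /= mulr_sumr -big_split; apply: eq_bigr => x _ /=.
by rewrite !ffunE mulrDl mulrA.
Qed.

Lemma adjoint_opP (R : realType) (N N' : nat) (T : 'Hom(l2 R N, l2 R N'))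
    (u : l2 R N) (v : l2 R N') :
  inner (T u) v = inner u (adjoint_op T v).
Proof.
have {1}-> : u = \sum_i u i *: l2_delta R i.
  apply/ffunP => j; rewrite sum_ffunE (bigD1 j) //= !ffunE eqxx big1.
    by rewrite addr0 /GRing.scale /= mulr1.
  by move=> i ij; rewrite !ffunE eq_sym (negPf ij) scaler0.
rewrite linear_sum /inner.
under [RHS]eq_bigr => i _ do rewrite adjoint_opE /inner rmorph_sum mulr_sumr.
rewrite [RHS]exchange_big /=; apply: eq_bigr => j _.
rewrite sum_ffunE mulr_suml; apply: eq_bigr => i _.
rewrite linearZ !ffunE /GRing.scale /= rmorphM -mulrA; congr (_ * _).
by rewrite mulrC; congr (_ * _); rewrite -[LHS]conjcK.
Qed.

(* Main.v *)
Require Import Defs.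
From HB Require Import structures.
From mathcomp Require Import all_boot all_order all_algebra all_field.
From mathcomp Require Import all_classical all_reals all_analysis.
From mathcomp Require Import complex.
From mathcomp Require Import zify ring lra.
Import Order.TTheory GRing.Theory Num.Theory.
Import numFieldNormedType.Exports.

(** Write [N = M ^ k] and let [X_k] be the set of the pairs of integers below [N]
    whose base [M] digits lie in [A].  An uncertainty principle for [X_k], obtained
    by algebra, is combined with the propagation of waves by the baker's map.

    Uncertainty principle.  Let [r_k] be the squared norm of the Fourier transform
    cut off to [X_k] on both sides.  Then [r_(k+l) <= r_k * r_l] ([FUP_mul]), so that
    [r_k] decays like a power of [N] as soon as a single [r_k] is less than 1
    ([FUP_base], [FUP_power]).  In finite dimension, [r_k < 1] says that no nonzero
    [u] has both [u] and its transform supported in [X_k].  This is the injectivity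
    of a matrix of powers of a root of unity [zeta], hence independent of the field
    that contains [zeta] ([injective_transfer]), and it may be studied over the
    algebraic numbers, where Galois automorphisms are available.

    Let such a [u] be given, placed on the points [(zeta ^ xi1, zeta ^ xi2)] of the
    torus.  Multiplying [u] by a polynomial of degree [D] combines translates of its
    transform by vectors of size [D], so that the new transform lives in a
    [D]-neighbourhood of [X_k].  Counting gives a curve of degree [o(N)] through the
    support of [u].  By [isolate_or_coset], after multiplication by a polynomial [h]
    with [h u <> 0] of degree [D = o(N)], one of the following holds.
    - A further multiplication of degree [O(D)] leaves a single point of the support.
      The transform then vanishes nowhere, although the neighbourhood of [X_k] misses
      a box of side about [N / M], given by a digit pair outside [A].
    - The support lies in a coset [a * xi1 + b * xi2 = s] with [a], [b] coprime.  The
      transform is then invariant up to phase along [(a, b)], so that the neighbourhood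
      of [X_k] contains a discrete line of direction [(a, b)].  If [a] or [b] is large,
      this line enters the box ([hit_hole]).  For the finitely many other directions
      the hypothesis on lines is used: a limit of discrete lines close to the sets [X_k]
      would be a line in the Cantor set ([no_line_escape]), so discrete lines leave
      [X_k] in the direction [(a, b)] or in the direction [(-b, a)].  The first case is
      contradictory; in the second one the coset meets [X_k] in [o(N)] points
      ([coset_sparse]) and a Vandermonde determinant forbids the transform to vanish
      along a progression inside the box ([escape_perp_excluded]).

    The dichotomy comes from an irreducible factor [f] of the curve.  The automorphism
    [zeta -> zeta ^ q] yields a second curve [f^sigma (x ^ q, y ^ q) = 0] through the
    same points.  If the exponents of [f] are not collinear, [f] does not divide it
    ([frob_ndvd]), and a point of the intersection of two curves without a common
    component is isolated by a polynomial of controlled degree ([interpolation]).  If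
    they are collinear, [f] is up to a monomial a product of binomials, whose zeros are
    cosets.

    Propagation.  Summation by parts makes the kernel of the baker's map decay rapidly
    away from the graph of the expanding map ([kern_bound]).  Iterating [n - w] times
    (with [N = M ^ n] and [W = M ^ w]) confines the output to the [O(W)]-neighbourhood
    [T] of [X_n] ([reach_near]), and the Fourier transform conjugates the baker's map to
    its transpose, so that an eigenfunction is concentrated on [T] in frequency as well
    as in position.  With [l] its eigenvalue, the uncertainty principle on [T]
    ([FUP_thick]) bounds [|l| ^ (4 * (n - w))] by [O(W ^ 4 * r_n)] up to a small
    error ([eigen_bound]); taking [w] proportional to [n] leaves a negative power of [N]. *)

Set Implicit Arguments.
Unset Strict Implicit.
Unset Printing Implicit Defensive.

Local Open Scope ring_scope.

(** * Factorization of bivariate polynomials over an algebraically closed field *)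

Section Gauss.
Variable K : closedFieldType.
Implicit Types (f g h p : {poly {poly K}}) (c r : {poly K}).

Lemma dvd_content (x : K) p :
  map_poly (horner_eval x) p = 0 -> exists p', p = ('X - x%:P) *: p'.
Proof.
move=> p0; exists (map_poly (fun u => u %/ ('X - x%:P)) p).
apply/polyP => i; rewrite coefZ coef_map_id0 ?div0p // mulrC divpK //.
rewrite dvdp_XsubCl; apply/rootP.
by have := congr1 (fun q : {poly K} => q`_i) p0; rewrite coef_map coef0.
Qed.

Lemma scale_polyI c : c != 0 -> injective (fun p => c *: p).
Proof.
move=> c0 p q; rewrite -!mul_polyC; apply: mulfI; by rewrite polyC_eq0.
Qed.

(** Gauss' lemma without unique factorization: the content [c] splits into linear
    factors, and each root of [c] makes one of the two factors vanish at that value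
    of the inner variable, so a linear factor can be moved over to it. *)
Lemma gauss_closed c f g h : c != 0 -> c *: f = g * h ->
  exists g' h' c1 c2, [/\ f = g' * h', g = c1 *: g' & h = c2 *: h'].
Proof.
move: {2}(size c) (leqnn (size c)) => n.
elim: n c g h => [|n IHn] c g h; first by rewrite leqn0 size_poly_eq0 => ->.
move=> szc c0 E.
have [/size1_polyC cE|sz1] := leqP (size c) 1.
  have c00 : c`_0 != 0 by move: c0; rewrite {1}cE polyC_eq0.
  exists (((c`_0)^-1)%:P *: g), h, c, 1; split; last by rewrite scale1r.
    rewrite -scalerAl -E scalerA {2}cE -polyCM mulVf // scale1r //.
  by rewrite scalerA {1}cE -polyCM mulfV // scale1r.
have /closed_rootP [x /factor_theorem[c' cE]] : size c != 1 by rewrite neq_ltn sz1 orbT.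
have c'0 : c' != 0 by apply: contra_neq c0 => c'0; rewrite cE c'0 mul0r.
have X0 : 'X - x%:P != 0 by rewrite polyXsubC_eq0.
have szc' : (size c' <= n)%N.
  by move: szc; rewrite cE size_Mmonic ?monicXsubC // size_XsubC addn2 /=.
have : map_poly (horner_eval x) (g * h) = 0.
  rewrite -E; apply/polyP => i; rewrite coef_map coefZ coef0 /= /horner_eval.
  by rewrite cE !hornerE subrr mulr0 mul0r.
rewrite rmorphM /= => /eqP; rewrite mulf_eq0 => /orP[] /eqP /dvd_content[p pE].
- have : c' *: f = p * h.
    apply: (scale_polyI X0); rewrite /= scalerA mulrC -cE E pE -scalerAl //.
  case/(IHn _ _ _ szc' c'0) => g' [h' [c1 [c2 [-> gE hE]]]].
  by exists g', h', (('X - x%:P) * c1), c2; split; rewrite // pE gE scalerA.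
- have : c' *: f = g * p.
    apply: (scale_polyI X0); rewrite /= scalerA mulrC -cE E pE -scalerAr //.
  case/(IHn _ _ _ szc' c'0) => g' [h' [c1 [c2 [-> gE hE]]]].
  by exists g', h', c1, (('X - x%:P) * c2); split; rewrite // pE hE scalerA.
Qed.

Definition degx p := (size p).-1.
Definition degy p := (sizeY p).-1.
(** The outer variable is [x] and the inner one is [y].  The sum of the two partial
    degrees is additive on products, which makes it a convenient measure of descent. *)
Definition wt p := (degx p + degy p)%N.

Lemma sizeY_gt0 p : p != 0 -> (0 < sizeY p)%N.
Proof. by rewrite lt0n sizeY_eq0. Qed.

Lemma degxM f g : f != 0 -> g != 0 -> degx (f * g) = (degx f + degx g)%N.
Proof.
move=> f0 g0; rewrite /degx size_mul //.
move: f0 g0; rewrite -!size_poly_gt0.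
by case: (size f) (size g) => [|a] // [|b] // _ _; rewrite addSn addnS.
Qed.

Lemma degyE f : degy f = degx (swapXY f).
Proof. by rewrite /degy sizeYE. Qed.

Lemma degyM f g : f != 0 -> g != 0 -> degy (f * g) = (degy f + degy g)%N.
Proof. by move=> f0 g0; rewrite !degyE rmorphM degxM // swapXY_eq0. Qed.

Lemma wtM f g : f != 0 -> g != 0 -> wt (f * g) = (wt f + wt g)%N.
Proof. by move=> f0 g0; rewrite /wt degxM // degyM //; lia. Qed.

Lemma wt_swapXY f : wt (swapXY f) = wt f.
Proof. by rewrite /wt !degyE swapXYK addnC. Qed.

Lemma degx0_const f : degx f = 0 -> f = (f`_0)%:P.
Proof. by move=> H; apply: size1_polyC; move: H; rewrite /degx; lia. Qed.

Lemma wt0_const f : wt f = 0 -> exists a : K, f = a%:P%:P.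
Proof.
rewrite /wt => /eqP; rewrite addn_eq0 => /andP[/eqP /degx0_const fE /eqP].
rewrite degyE fE swapXY_polyC => /degx0_const; rewrite coef_map /= => H.
exists (f`_0)`_0; congr (_ %:P); apply: (map_inj_poly polyC_inj) => //.
by rewrite H map_polyC.
Qed.

(** Irreducibility, a factor of weight 0 being a constant by [wt0_const]. *)
Definition birred f := f != 0 /\ forall g h, f = g * h -> wt g = 0 \/ wt h = 0.

Lemma birred_swapXY f : birred f -> birred (swapXY f).
Proof.
move=> [f0 fI]; split=> [|g h /(congr1 (@swapXY _))]; first by rewrite swapXY_eq0.
by rewrite swapXYK rmorphM /= => /fI; rewrite !wt_swapXY.
Qed.

(** Pseudo-division leaves a factor [c] free of [x]; it can be cancelled by Gauss'
    lemma because [f] really depends on [x]. *)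
Lemma birred_pseudo_dvd f c g h :
  birred f -> (0 < degx f)%N -> c != 0 -> c *: g = h * f -> exists k, g = k * f.
Proof.
move=> [f0 fI] df c0 /(gauss_closed c0) [h' [f' [c1 [c2 [gE hE fE]]]]].
have c20 : c2 != 0 by apply: contra_neq f0 => c20; rewrite fE c20 scale0r.
have f'0 : f' != 0 by apply: contra_neq f0 => f'0; rewrite fE f'0 scaler0.
have fM : f = c2%:P * f' by rewrite mul_polyC.
have [w0|w0] := fI _ _ fM; last first.
  move: df; rewrite fM degxM ?polyC_eq0 // {1}/degx size_polyC c20 /=.
  by move: w0; rewrite /wt; lia.
have [a aE] := wt0_const w0; move/polyC_inj: aE => aE.
have a0 : a != 0 by move: c20; rewrite aE polyC_eq0.
exists (h' * (a^-1)%:P%:P).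
by rewrite gE fM aE -mulrA; congr (_ * _); rewrite mulrA -!polyCM mulVf // mul1r.
Qed.

(** The gcd over the field of rational functions of [y] is 1 or [f] up to a scalar;
    clearing denominators leaves a relation with a polynomial [r] in [y] alone. *)
Lemma birred_dvd_or_bezout f g : birred f -> (0 < degx f)%N ->
  (exists k, g = k * f) \/ (exists a b r, r != 0 /\ a * f + b * g = r%:P).
Proof.
move=> fI df; have f0 := fI.1.
have d0 : gcdp f g != 0 by rewrite gcdp_eq0 (negPf f0).
have [d1|d1] := eqVneq (size (gcdp f g)) 1.
  right; have [[u v] /= /Pdiv.CommonIdomain.eqpP [[c1 c2] /= /andP[c10 c20] E]] :=
    Pdiv.CommonIdomain.Bezoutp f g.
  have /size1_polyC gE : (size (gcdp f g) <= 1)%N by rewrite d1.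
  exists (c1 *: u), (c1 *: v), (c2 * (gcdp f g)`_0); split.
    by rewrite mulf_neq0 //; move: d0; rewrite {1}gE polyC_eq0.
  by rewrite -!scalerAl -scalerDr E {1}gE -mul_polyC -polyCM.
left; set d := gcdp f g in d0 d1.
have /Pdiv.WeakIdomain.dvdpP [[c e] /= c0 E] : d %| f by apply: Pdiv.CommonIdomain.dvdp_gcdl.
have [e' [d' [c1 [c2 [fE eE dE]]]]] := gauss_closed c0 E.
have c20 : c2 != 0 by apply: contra_neq d0 => c20; rewrite dE c20 scale0r.
have szd : size d = size d' by rewrite dE size_scale.
have [w0|w0] := fI.2 _ _ fE; last first.
  move: w0 d1; rewrite -size_poly_gt0 szd in d0; rewrite /wt /degx szd; lia.
have [a aE] := wt0_const w0.
have a0 : a != 0 by apply: contra_neq f0 => a0; rewrite fE aE a0 mul0r.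
have /Pdiv.WeakIdomain.dvdpP [[c3 h] /= c30 E2] : d %| g by apply: Pdiv.CommonIdomain.dvdp_gcdr.
apply: (birred_pseudo_dvd fI df c30 (h := (a^-1)%:P *: (c2 *: h))).
have aa : (a^-1)%:P%:P * a%:P%:P = 1 :> {poly {poly K}} by rewrite -!polyCM mulVf.
by rewrite E2 fE aE dE -!mul_polyC -[LHS]mul1r -aa; ring.
Qed.

(** Over the fraction field, an irreducible polynomial not dividing [g] has a Bezout
    relation with it. *)
Lemma birred_prime f g h k : birred f -> (0 < degx f)%N ->
  g * h = k * f -> (exists k', g = k' * f) \/ (exists k', h = k' * f).
Proof.
move=> fI df E; have [|[a [b [r [r0 rE]]]]] := birred_dvd_or_bezout g fI df; first by left.
right; apply: (birred_pseudo_dvd fI df r0 (h := a * h + b * k)).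
by rewrite -mul_polyC -rE mulrDl mulrDl -!mulrA -E; ring.
Qed.

End Gauss.

(** * Isolating a point of the intersection of two curves *)

Section Interpolation.
Variable K : closedFieldType.
Implicit Types (f g h p : {poly {poly K}}) (c r : {poly K}).

Definition ev p (z : K * K) : K := p.[z.1%:P].[z.2].

Lemma evM p q z : ev (p * q) z = ev p z * ev q z.
Proof. by rewrite /ev !hornerM. Qed.
Lemma evD p q z : ev (p + q) z = ev p z + ev q z.
Proof. by rewrite /ev !hornerD. Qed.
Lemma evB p q z : ev (p - q) z = ev p z - ev q z.
Proof. by rewrite /ev !(hornerD, hornerN). Qed.
Lemma evC c z : ev c%:P z = c.[z.2].
Proof. by rewrite /ev hornerC. Qed.
Lemma evXn i z : ev ('X^i) z = z.1 ^+ i.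
Proof. by rewrite /ev hornerXn -polyC_exp hornerC. Qed.
Lemma ev_swap p z : ev (swapXY p) z = ev p (z.2, z.1).
Proof. exact: horner2_swapXY. Qed.
Lemma ev_prod (I : Type) (s : seq I) (P : pred I) (F : I -> {poly {poly K}}) z :
  ev (\prod_(i <- s | P i) F i) z = \prod_(i <- s | P i) ev (F i) z.
Proof. by rewrite /ev horner_prod horner_prod. Qed.

Lemma sizeYD p q n : (sizeY p <= n)%N -> (sizeY q <= n)%N -> (sizeY (p + q) <= n)%N.
Proof.
rewrite !sizeYE rmorphD /= => h1 h2.
by apply: leq_trans (size_polyD _ _) _; rewrite geq_max h1.
Qed.

Lemma sizeYN p : sizeY (- p) = sizeY p.
Proof. by rewrite !sizeYE rmorphN size_polyN. Qed.

Lemma sizeY_map_mul (a : {poly K}) p : (sizeY (a^:P * p) <= sizeY p)%N.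
Proof.
by rewrite !sizeYE rmorphM /= swapXY_map_polyC mul_polyC size_scale_leq.
Qed.

(** At a generic value [y = t], Bezout's relation writes [p(x, t)] as [al * f(x, t)
    + be * g(x, t)] with controlled degrees.  Subtracting [al * f + be * g] makes
    [p] divisible by [y - t], which lowers its degree in [y]. *)
Lemma reduce_y f g (a b : {poly {poly K}}) r (t : K) p d e m n : r != 0 -> a * f + b * g = r%:P ->
  ~~ root r t -> ~~ root (lead_coef f) t ->
  size f = d.+1 -> (size g <= e.+1)%N -> (d + e <= m.+1)%N -> (size p <= m.+1)%N ->
  (sizeY f <= n.+1)%N -> (sizeY g <= n.+1)%N -> (sizeY p <= n.+1)%N ->
  exists p1 u v, [/\ p = u * f + v * g + ('X - t%:P)%:P * p1,
    (size p1 <= m.+1)%N & (sizeY p1 <= n)%N].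
Proof.
move=> r0 E rt lt szf szg dem szp yf yg yp.
set et := map_poly (horner_eval t).
have etE q : et q = map_poly (horner_eval t) q by [].
have szfc : size (et f) = d.+1.
  by rewrite -szf size_poly_eq //.
have f0 : et f != 0 by rewrite -size_poly_gt0 szfc.
have szgc : (size (et g) <= e.+1)%N by apply: leq_trans (size_poly _ _) _.
have szpc : (size (et p) <= m.+1)%N by apply: leq_trans (size_poly _ _) _.
have Et : et a * et f + et b * et g = (r.[t])%:P.
  by rewrite /et -!rmorphM -rmorphD E /= map_polyC.
pose b0 := (r.[t])^-1 *: (et b * et p); pose be := b0 %% et f.
pose al := (r.[t])^-1 *: (et a * et p) + (b0 %/ et f) * et g.
have pE : et p = al * et f + be * et g.
  have b0E : b0 = b0 %/ et f * et f + be by exact: divp_eq.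
  have {1}-> : et p = (r.[t])^-1%:P * (r.[t])%:P * et p by rewrite -polyCM mulVf // mul1r.
  rewrite -Et.
  have -> : be = b0 - b0 %/ et f * et f by rewrite {1}b0E addrC addKr.
  by rewrite /al /b0 -!mul_polyC; ring.
have szbe : (size be <= d)%N by rewrite -ltnS -szfc ltn_modp.
have szbg : (size (be * et g)%R <= m.+1)%N.
  apply: leq_trans (size_polyMleq _ _) _; rewrite -subn1 leq_subLR.
  by apply: leq_trans (leq_add szbe szgc) _; lia.
have szal : al != 0 -> (size al + d <= m.+1)%N.
  move=> al0; have : (size (al * et f)%R <= m.+1)%N.
    have -> : al * et f = et p - be * et g by rewrite pE addrK.
    by apply: leq_trans (size_polyD _ _) _; rewrite size_polyN geq_max szpc.
  by rewrite size_mul // szfc addnS.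
pose p2 := p - (al^:P * f + be^:P * g).
have map0 q : et (q^:P) = q.
  by rewrite /et -map_poly_comp map_poly_id // => x _; rewrite /= /horner_eval hornerC.
have /dvd_content [p1 p1E] : et p2 = 0.
  by rewrite /et rmorphB rmorphD !rmorphM /= -!etE !map0 pE subrr.
exists p1, (al^:P), (be^:P); split.
- by rewrite mul_polyC -p1E /p2 addrC subrK.
- have -> : size p1 = size p2.
    by rewrite p1E -mul_polyC size_Cmul // polyXsubC_eq0.
  apply: leq_trans (size_polyD _ _) _; rewrite geq_max szp size_polyN /=.
  apply: leq_trans (size_polyD _ _) _; rewrite geq_max; apply/andP; split.
    have [->|al0] := eqVneq al 0; first by rewrite rmorph0 mul0r size_poly0.
    apply: leq_trans (size_polyMleq _ _) _; rewrite size_map_polyC szf addnS /=.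
    exact: szal.
  apply: leq_trans (size_polyMleq _ _) _; rewrite size_map_polyC.
  rewrite -subn1 leq_subLR; apply: leq_trans (leq_add szbe szg) _; lia.
- have y2 : (sizeY p2 <= n.+1)%N.
    apply: sizeYD => //; rewrite sizeYN; apply: sizeYD.
      exact: leq_trans (sizeY_map_mul _ _) _.
    exact: leq_trans (sizeY_map_mul _ _) _.
  have [p10|p10] := eqVneq p1 0; first by rewrite p10 /sizeY size_poly0 big_ord0.
  move: y2; rewrite p1E -mul_polyC !sizeYE rmorphM /= swapXY_polyC size_mul; first last.
  - by rewrite swapXY_eq0.
  - by rewrite map_polyC_eq0 polyXsubC_eq0.
  by rewrite size_map_polyC size_XsubC.
Qed.

(** On the common zeros of [f] and [g], the polynomials [p] and [p1] vanish at the
    same points. *)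
Definition iso_on f g p p1 := exists s : K * K -> K, forall z,
  ev f z = 0 -> ev g z = 0 -> s z != 0 /\ ev p z = s z * ev p1 z.

(** The common zeros avoid the line [y = t] because [r] vanishes on them, hence the
    factors [y - t] removed by [reduce_y] do not change the zeros. *)
Lemma reduce_y_iter f g (a b : {poly {poly K}}) r p d e m n0 : r != 0 -> a * f + b * g = r%:P ->
  size f = d.+1 -> (size g <= e.+1)%N -> (d + e <= m.+1)%N -> (size p <= m.+1)%N ->
  (sizeY f <= n0.+1)%N -> (sizeY g <= n0.+1)%N ->
  exists p1, [/\ iso_on f g p p1, (size p1 <= m.+1)%N & (sizeY p1 <= n0)%N].
Proof.
move=> r0 E szf szg dem szp yf yg.
have lf0 : lead_coef f != 0 by rewrite lead_coef_eq0 -size_poly_gt0 szf.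
have /closed_nonrootP[t] : r * lead_coef f != 0 by rewrite mulf_neq0.
rewrite rootM negb_or => /andP[rt lt].
suff H j (q : {poly {poly K}}) : (size q <= m.+1)%N -> (sizeY q <= n0 + j)%N ->
    exists p1, [/\ iso_on f g q p1, (size p1 <= m.+1)%N & (sizeY p1 <= n0)%N].
  by apply: (H (sizeY p)) => //; rewrite leq_addl.
elim: j q => [|j IHj] q szq yq.
  exists q; split=> //; last by rewrite addn0 in yq.
  by exists (fun=> 1) => z _ _; rewrite oner_eq0 mul1r.
have [||| p1 [u [v [qE szp1 yp1]]]] :=
    reduce_y r0 E rt lt szf szg dem szq (n := (n0 + j)%N).
- by apply: leq_trans yf _; rewrite ltnS leq_addr.
- by apply: leq_trans yg _; rewrite ltnS leq_addr.
- by rewrite -addnS.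
have [p2 [[s sP] szp2 yp2]] := IHj _ szp1 yp1.
exists p2; split=> //; exists (fun z => (z.2 - t) * s z) => z fz gz.
have [s0 p1z] := sP z fz gz; split; last first.
  rewrite qE !evD !evM fz gz !mulr0 !add0r evC p1z hornerXsubC mulrA //.
rewrite mulf_neq0 // subr_eq0; apply: contraNneq rt => zt.
have : ev (a * f + b * g) z = 0 by rewrite evD !evM fz gz !mulr0 addr0.
by rewrite E evC zt => /rootP.
Qed.

Lemma separating_poly (s : seq (K * K)) z0 : exists p, ev p z0 != 0 /\
  forall z, z \in s -> z != z0 -> ev p z = 0.
Proof.
exists (\prod_(z <- s | z != z0) (if z.1 != z0.1 then 'X - z.1%:P%:P else ('X - z.2%:P)%:P)).
have evE z w : ev (if z.1 != z0.1 then 'X - z.1%:P%:P else ('X - z.2%:P)%:P) w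
    = if z.1 != z0.1 then w.1 - z.1 else w.2 - z.2.
  by case: ifP => _; rewrite /ev !hornerE.
split=> [|z zs zz0]; rewrite ev_prod.
  rewrite prodf_seq_neq0; apply/allP => -[x y] _; apply/implyP => xy; rewrite evE; case: ifPn => /= [xz|].
    by rewrite subr_eq0 eq_sym.
  rewrite negbK subr_eq0 => /eqP xE; apply: contra_neq xy => /= yE.
  by rewrite xE -yE; case: (z0).
apply/eqP; rewrite prodf_seq_eq0; apply/hasP; exists z => //.
by rewrite zz0 evE; case: ifP => _; rewrite subrr eqxx.
Qed.

(** Any polynomial isolating [z0] in [s], whatever its degree, is reduced modulo [f]
    and [g], first in [y] and then in [x]. *)
Lemma interpolation f g (a b a' b' : {poly {poly K}}) r r' e e' (s : seq (K * K)) z0 :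
  r != 0 -> a * f + b * g = r%:P -> r' != 0 -> a' * f + b' * g = r'^:P ->
  f != 0 -> (degx g <= e)%N -> (degy g <= e')%N ->
  (forall z, z \in s -> ev f z = 0 /\ ev g z = 0) -> z0 \in s ->
  exists p, [/\ ev p z0 != 0, forall z, z \in s -> z != z0 -> ev p z = 0,
   (degx p <= degx f + e)%N & (degy p <= degy f + e')%N].
Proof.
move=> r0 E r'0 E' f0 dg dg' Z z0s.
have szf : size f = (degx f).+1 by rewrite /degx prednK // size_poly_gt0.
have szf' : size (swapXY f) = (degy f).+1 by rewrite -sizeYE /degy prednK // sizeY_gt0.
have [p [pz0 pz]] := separating_poly s z0.
pose m := (size p + degx f + e)%N.
have [||||| p1 [[s1 iso1] sz1 y1]] := reduce_y_iter (p := p) (e := e) (m := m)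
    (n0 := (degy f + e').+1) r0 E szf.
- by move: dg; rewrite /degx; lia.
- rewrite /m; lia.
- rewrite /m; lia.
- by rewrite sizeYE szf'; lia.
- by move: dg'; rewrite /degy; lia.
have E'' : swapXY a' * swapXY f + swapXY b' * swapXY g = r'%:P.
  by rewrite -!rmorphM -rmorphD E' /= swapXY_map_polyC.
have [||||| p2 [[s2 iso2] sz2 y2]] := reduce_y_iter (p := swapXY p1) (e := e')
    (m := (degy f + e')%N) (n0 := (degx f + e).+1) r'0 E'' szf'.
- by rewrite -sizeYE; move: dg'; rewrite /degy; lia.
- lia.
- by rewrite -sizeYE.
- by rewrite sizeYE swapXYK szf; lia.
- rewrite sizeYE swapXYK; apply: leq_trans (leqSpred _) _; rewrite ltnS.
  by apply: leq_trans dg _; lia.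
have pE z : z \in s -> exists k, k != 0 /\ ev p z = k * ev (swapXY p2) z.
  move=> zs; have [fz gz] := Z z zs; have [k1 ->] := iso1 z fz gz.
  have [||k2] := iso2 (z.2, z.1); first by rewrite ev_swap; case: (z) fz.
    by rewrite ev_swap; case: (z) gz.
  rewrite ev_swap -surjective_pairing => ->; exists (s1 z * s2 (z.2, z.1)).
  by rewrite mulf_neq0 // mulrA ev_swap.
exists (swapXY p2); split.
- by have [k [k0 kE]] := pE _ z0s; apply: contra_neq pz0 => e0; rewrite kE e0 mulr0.
- move=> z zs zz0; have [k [k0 kE]] := pE _ zs; move: (pz z zs zz0); rewrite kE => /eqP.
  by rewrite mulf_eq0 (negPf k0) => /eqP.
- by rewrite {1}/degx -sizeYE -subn1 leq_subLR add1n.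
- by rewrite {1}/degy sizeYE swapXYK -subn1 leq_subLR add1n.
Qed.

End Interpolation.

(** * Torus translates of an irreducible polynomial *)

Section Coefficients.
Variable K : closedFieldType.
Implicit Types (f g h p : {poly {poly K}}).

Lemma degx_leP p n :
  reflect (forall i j, (n < i)%N -> p`_i`_j = 0) (degx p <= n)%N.
Proof.
rewrite /degx -subn1 leq_subLR add1n; apply: (iffP (leq_sizeP _ _)) => H i.
  by move=> j ni; rewrite H // coef0.
by move=> ni; apply/polyP => j; rewrite H // coef0.
Qed.

Lemma degy_leP p n :
  reflect (forall i j, (n < j)%N -> p`_i`_j = 0) (degy p <= n)%N.
Proof.
rewrite degyE; apply: (iffP (degx_leP _ _)) => H i j nj.
  by rewrite -coef_swapXY H.
by rewrite coef_swapXY H.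
Qed.

Lemma ev_coef p z : ev p z =
  \sum_(i < (degx p).+1) \sum_(j < (degy p).+1) p`_i`_j * z.1 ^+ i * z.2 ^+ j.
Proof.
rewrite /ev (@horner_coef_wide _ (degx p).+1 p); last exact: leqSpred.
rewrite horner_sum; apply: eq_bigr => i _.
rewrite hornerM -polyC_exp hornerC (@horner_coef_wide _ (degy p).+1 p`_i); last first.
  by apply: leq_trans (max_size_coefXY _ _) (leqSpred _).
by rewrite mulr_suml; apply: eq_bigr => j _; rewrite mulrAC.
Qed.

Lemma dvd_prod (I : eqType) (F : I -> {poly {poly K}}) f (s : seq I) :
  birred f -> (0 < degx f)%N -> (exists k, \prod_(i <- s) F i = k * f) ->
  exists2 i, i \in s & exists k, F i = k * f.
Proof.
move=> fI df; elim: s => [|i s IHs] [k].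
  rewrite big_nil => E; have f0 := fI.1.
  have k0 : k != 0 by apply: contra_eq_neq E => ->; rewrite mul0r oner_eq0.
  have : degx (k * f) = 0 by rewrite -E /degx size_poly1.
  by rewrite degxM //; lia.
rewrite big_cons => /(birred_prime fI df) [H|[k' H]].
  by exists i; rewrite ?mem_head.
have [|j js H'] := IHs; first by exists k'.
by exists j; rewrite ?inE ?js ?orbT.
Qed.

(** Distinct irreducible divisors multiply to a divisor, since irreducible elements
    are prime. *)
Lemma prod_coprime_dvd (I : eqType) (F : I -> {poly {poly K}}) g (s : seq I) :
  uniq s -> (forall i, i \in s -> birred (F i) /\ (0 < degx (F i))%N) ->
  (forall i, i \in s -> exists k, g = k * F i) ->
  (forall i j, i \in s -> j \in s -> i != j -> ~ exists k, F i = k * F j) ->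
  exists k, g = k * \prod_(i <- s) F i.
Proof.
elim: s => [|i s IHs] /=; first by exists g; rewrite big_nil mulr1.
move=> /andP[ins us] HI Hd Hn.
have [|||k gE] := IHs us.
- by move=> j js; apply: HI; rewrite inE js orbT.
- by move=> j js; apply: Hd; rewrite inE js orbT.
- by move=> j j' js js'; apply: Hn; rewrite inE ?js ?js' orbT.
have [fI df] := HI i (mem_head _ _).
have [k' gE'] := Hd i (mem_head _ _).
have := gE; rewrite gE' => /esym /(birred_prime fI df) [[k2 kE]|/(dvd_prod fI df) [j js]].
  by exists k2; rewrite big_cons -gE' gE kE mulrA.
case/Hn => //; rewrite ?inE ?js ?eqxx ?orbT //.
by apply: contraNneq ins => <-.
Qed.

(** The polynomial [p (a x, b y)]. *)
Definition tau (a b : K) p : {poly {poly K}} :=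
  (map_poly (comp_poly (b *: 'X)) p) \Po (a%:P *: 'X).

Lemma coef_comp_scaleX (R : comNzRingType) (a : R) (p : {poly R}) i :
  (p \Po (a *: 'X))`_i = a ^+ i * p`_i.
Proof.
have [ltip|leip] := ltnP i (size p); last first.
  rewrite [p`_i]nth_default // mulr0 nth_default //.
  rewrite comp_polyE; apply: leq_trans (size_sum _ _ _) _; apply/bigmax_leqP => j _.
  apply: leq_trans (size_scale_leq _ _) _; rewrite exprZn.
  apply: leq_trans (size_scale_leq _ _) _; rewrite size_polyXn.
  exact: leq_trans (ltn_ord j) leip.
rewrite comp_polyE coef_sum (bigD1 (Ordinal ltip)) //= big1 => [|j ji].
  by rewrite addr0 exprZn !coefZ coefXn eqxx mulr1 mulrC.
rewrite exprZn !coefZ coefXn eq_sym; case: eqP => [e|_]; last by rewrite !mulr0.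
by case/eqP: ji; apply: val_inj.
Qed.

Lemma coef_tau a b p i j : (tau a b p)`_i`_j = a ^+ i * b ^+ j * p`_i`_j.
Proof.
rewrite /tau coef_comp_scaleX -polyC_exp coefCM.
by rewrite coef_map /= coef_comp_scaleX mulrA.
Qed.

Lemma tauM a b p q : tau a b (p * q) = tau a b p * tau a b q.
Proof. by rewrite /tau rmorphM comp_polyM. Qed.

Lemma tauK a b p : a != 0 -> b != 0 -> tau a^-1 b^-1 (tau a b p) = p.
Proof.
move=> a0 b0; apply/polyP => i; apply/polyP => j; rewrite !coef_tau.
by rewrite mulrA mulrACA -!exprMn !mulVf // !expr1n !mul1r.
Qed.

Lemma wt_tau a b p : a != 0 -> b != 0 -> degx (tau a b p) = degx p /\ wt (tau a b p) = wt p.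
Proof.
move=> a0 b0.
have lex c d q : (degx (tau c d q) <= degx q)%N.
  apply/degx_leP => i j H; rewrite coef_tau; have /degx_leP := leqnn (degx q).
  by move=> /(_ i j H) ->; rewrite mulr0.
have ley c d q : (degy (tau c d q) <= degy q)%N.
  apply/degy_leP => i j H; rewrite coef_tau; have /degy_leP := leqnn (degy q).
  by move=> /(_ i j H) ->; rewrite mulr0.
have ex : degx (tau a b p) = degx p.
  by apply/eqP; rewrite eqn_leq lex /= -{1}(tauK p a0 b0) lex.
have ey : degy (tau a b p) = degy p.
  by apply/eqP; rewrite eqn_leq ley /= -{1}(tauK p a0 b0) ley.
by rewrite /wt ex ey.
Qed.

Lemma birred_tau a b f : a != 0 -> b != 0 -> birred f -> birred (tau a b f).
Proof.
move=> a0 b0 [f0 fI]; split.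
  apply: contra_neq f0 => H; rewrite -(tauK f a0 b0) H.
  by apply/polyP => i; apply/polyP => j; rewrite coef_tau !coef0 mulr0.
move=> g h /(congr1 (tau a^-1 b^-1)); rewrite tauK // tauM => /fI.
by rewrite !(wt_tau _ _ _).2 ?invr_eq0.
Qed.

(** The exponents of [f] are not all on one line. *)
Definition planar f := exists i0 j0 i1 j1 i2 j2 : nat,
  [/\ f`_i0`_j0 != 0, f`_i1`_j1 != 0, f`_i2`_j2 != 0 &
   (i1%:Z - i0%:Z) * (j2%:Z - j0%:Z) - (i2%:Z - i0%:Z) * (j1%:Z - j0%:Z) != 0].

Lemma planar_degx f : planar f -> (0 < degx f)%N.
Proof.
case=> i0 [j0 [i1 [j1 [i2 [j2 [h0 h1 h2 D]]]]]]; rewrite lt0n; apply: contra_neq D => d0.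
have Z i j : f`_i`_j != 0 -> i = 0%N.
  apply: contraNeq; rewrite -lt0n => i0'; have /degx_leP := leqnn (degx f).
  by rewrite d0 => /(_ i j i0') ->.
by rewrite (Z _ _ h0) (Z _ _ h1) (Z _ _ h2) !subrr !mul0r.
Qed.

(** If two translates of [f] are proportional, then the ratio [(al, be)] of the
    translations satisfies [al ^ i * be ^ j = c] for each exponent [(i, j)] of [f];
    three affinely independent exponents make [al] and [be] roots of unity of order
    dividing a determinant. *)
Lemma tau_dvd f : birred f -> planar f -> exists2 m : nat, (0 < m)%N &
  forall a b a' b' : K, a != 0 -> b != 0 -> a' != 0 -> b' != 0 ->
  (exists k, tau a' b' f = k * tau a b f) -> a' ^+ m = a ^+ m /\ b' ^+ m = b ^+ m.
Proof.
move=> fI; case=> i0 [j0 [i1 [j1 [i2 [j2 [h0 h1 h2 D]]]]]].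
set D1 := i1%:Z - i0%:Z in D; set E1 := j1%:Z - j0%:Z in D.
set D2 := i2%:Z - i0%:Z in D; set E2 := j2%:Z - j0%:Z in D.
exists (absz (D1 * E2 - D2 * E1)%R); first by rewrite absz_gt0.
move=> a b a' b' a0 b0 a'0 b'0 [k E].
have t0 := (birred_tau a0 b0 fI).1; have t'0 := (birred_tau a'0 b'0 fI).1.
have k0 : k != 0 by apply: contra_neq t'0 => k0; rewrite E k0 mul0r.
have : wt k = 0.
  have := congr1 (@wt K) E; rewrite wtM // !(wt_tau _ _ _).2 //; lia.
case/wt0_const => c kE.
have cE i j : f`_i`_j != 0 -> (a' / a) ^+ i * (b' / b) ^+ j = c.
  move=> fij; have := congr1 (fun p : {poly {poly K}} => p`_i`_j) E.
  rewrite kE mul_polyC coefZ coefCM !coef_tau mulrA => /(mulIf fij) H.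
  have ab0 : a ^+ i * b ^+ j != 0 by rewrite mulf_neq0 // expf_neq0.
  by apply: (mulIf ab0); rewrite -H mulrACA -!exprMn !divfK.
have al0 : a' / a != 0 by rewrite mulf_neq0 ?invr_eq0.
have be0 : b' / b != 0 by rewrite mulf_neq0 ?invr_eq0.
set al := a' / a in cE al0; set be := b' / b in cE be0.
have alE : al = a' / a by [].
have beE : be = b' / b by [].
clearbody al be.
have e0 := cE _ _ h0; have e1 := cE _ _ h1; have e2 := cE _ _ h2.
have c0 : c != 0 by rewrite -e0 mulf_neq0 // expf_neq0.
have diffE i j : al ^+ i * be ^+ j = c -> al ^ (i%:Z - i0%:Z) * be ^ (j%:Z - j0%:Z) = 1.
  move=> e; rewrite !expfzDr // -!invr_expz -!exprnP mulrACA e -invfM e0 divff //.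
have d1 := diffE _ _ e1; have d2 := diffE _ _ e2.
rewrite -/D1 -/E1 in d1; rewrite -/D2 -/E2 in d2.
have zsub (x : K) (m n : int) : x != 0 -> x ^ (m - n) = x ^ m / x ^ n.
  by move=> x0; rewrite expfzDr // invr_expz.
have aD : al ^ (D1 * E2 - D2 * E1) = 1.
  have : (al ^ D1 * be ^ E1) ^ E2 * ((al ^ D2 * be ^ E2) ^ E1)^-1 = 1.
    by rewrite d1 d2 !exp1rz invr1 mulr1.
  rewrite !expfzMl !exprz_exp invfM mulrACA -!zsub //.
  by rewrite [E2 * E1]mulrC subrr expr0z mulr1.
have bD : be ^ (D1 * E2 - D2 * E1) = 1.
  have : (al ^ D2 * be ^ E2) ^ D1 * ((al ^ D1 * be ^ E1) ^ D2)^-1 = 1.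
    by rewrite d1 d2 !exp1rz invr1 mulr1.
  rewrite !expfzMl !exprz_exp invfM mulrACA -!zsub //.
  by rewrite [D2 * D1]mulrC subrr expr0z mul1r [E2 * _]mulrC [E1 * _]mulrC.
have abs1 (x : K) : x ^ (D1 * E2 - D2 * E1) = 1 -> x ^+ (absz (D1 * E2 - D2 * E1)%R) = 1.
  case: (intP (D1 * E2 - D2 * E1)) => [|n|n] //; rewrite ?abszN //=.
  by rewrite -invr_expz -exprnP => /eqP; rewrite invr_eq1 => /eqP.
by have := abs1 _ aD; have := abs1 _ bD; rewrite alE beE !expr_div_n => /divr1_eq -> /divr1_eq ->.
Qed.

End Coefficients.

(** * The lift of an irreducible polynomial by a q-th power map *)

Section Frobenius.
Variable K : closedFieldType.
Implicit Types (f g h p : {poly {poly K}}).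
Variables (sigma : {rmorphism K -> K}) (q : nat).
Hypothesis q_gt1 : (1 < q)%N.

(** The polynomial [f^sigma (x ^ q, y ^ q)].  If [sigma] raises the coordinates of a
    zero of [f] to the power [q], then it vanishes there as well, by [ev_frob]. *)
Definition frob p : {poly {poly K}} :=
  (map_poly (comp_poly 'X^q \o map_poly sigma) p) \Po 'X^q.

Lemma coef_frob p i j : (frob p)`_i`_j =
  if (q %| i)%N && (q %| j)%N then sigma p`_(i %/ q)`_(j %/ q) else 0.
Proof.
have q0 : (0 < q)%N by apply: ltnW.
rewrite /frob coef_comp_poly_Xn //; case: ifP => _ /=; last by rewrite coef0.
by rewrite coef_map /= coef_comp_poly_Xn // coef_map.
Qed.

Lemma frobM p r : frob (p * r) = frob p * frob r.
Proof. by rewrite /frob rmorphM comp_polyM. Qed.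

Lemma frob_neq0 p : p != 0 -> frob p != 0.
Proof.
have q0 : (0 < q)%N by apply: ltnW.
apply: contra_neq => fp0; apply/polyP => i; apply/polyP => j; rewrite !coef0.
have := coef_frob p (i * q) (j * q); rewrite fp0 !coef0 !dvdn_mull // !mulnK //.
by move/esym/eqP; rewrite fmorph_eq0 => /eqP.
Qed.

Lemma degx_frob p : (degx (frob p) <= q * degx p)%N.
Proof.
have q0 : (0 < q)%N by apply: ltnW.
apply/degx_leP => i j H; rewrite coef_frob; case: ifP => // /andP[/dvdnP[k kE] _].
have /degx_leP := leqnn (degx p) => ->; first by rewrite rmorph0.
by move: H; rewrite kE mulnK // mulnC ltn_pmul2r.
Qed.

Lemma degy_frob p : (degy (frob p) <= q * degy p)%N.
Proof.
have q0 : (0 < q)%N by apply: ltnW.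
apply/degy_leP => i j H; rewrite coef_frob; case: ifP => // /andP[_ /dvdnP[k kE]].
have /degy_leP := leqnn (degy p) => ->; first by rewrite rmorph0.
by move: H; rewrite kE mulnK // mulnC ltn_pmul2r.
Qed.

Lemma ev_frob p z : sigma z.1 = z.1 ^+ q -> sigma z.2 = z.2 ^+ q ->
  ev (frob p) z = sigma (ev p z).
Proof.
move=> s1 s2; rewrite /ev /frob horner_comp hornerXn -polyC_exp -s1.
have -> : (sigma z.1)%:P = (comp_poly 'X^q \o map_poly sigma) z.1%:P.
  by rewrite /= map_polyC comp_polyC.
by rewrite horner_map /= horner_comp hornerXn -s2 horner_map.
Qed.

Lemma frob_iter_dvd f n : (exists k, frob f = k * f) ->
  exists k, iter n frob f = k * f.
Proof.
move=> [k kE]; elim: n => [|n [k' IHn]]; first by exists 1; rewrite mul1r.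
by exists (frob k' * k); rewrite iterS IHn frobM kE mulrA.
Qed.

Lemma frob_iter f n : f != 0 ->
  [/\ iter n frob f != 0, (degx (iter n frob f) <= q ^ n * degx f)%N &
   forall i j, (iter n frob f)`_i`_j != 0 -> (q ^ n %| i)%N && (q ^ n %| j)%N].
Proof.
move=> f0; elim: n => [|n [n0 dn dvn]].
  by split=> //; rewrite ?mul1n // => i j _; rewrite !dvd1n.
split; rewrite ?iterS ?frob_neq0 //.
  by apply: leq_trans (degx_frob _) _; rewrite expnS -mulnA leq_mul2l dn orbT.
move=> i j; rewrite coef_frob; case: ifP => [/andP[qi qj]|]; last by rewrite eqxx.
rewrite fmorph_eq0 => /dvn; rewrite !expnS.
by rewrite !dvdn_divRL // ![(_ * q)%N]mulnC.
Qed.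

(** If [f] divides its lift, it divides every iterated lift [g], a polynomial in [x
    ^ Q] and [y ^ Q].  As [g] is invariant under multiplication of the variables by
    [Q]-th roots of unity, all the translates of [f] by such roots divide [g].  More
    than [Q] of them are pairwise not proportional by [tau_dvd], so their product
    has a larger degree in [x] than [g]. *)
Theorem frob_ndvd (wexists : forall n, (0 < n)%N -> exists w : K, n.-primitive_root w) f :
  birred f -> planar f -> ~ exists k, frob f = k * f.
Proof.
move=> fI pf /frob_iter_dvd Hd; have f0 := fI.1; have df := planar_degx pf.
have [m m0 mP] := tau_dvd fI pf.
(* L slightly above the square root of Q: more than Q translates, but all the
   exponents i * m with i < L stay below Q. *)
pose t := (2 * m)%N; pose Q := (q ^ (t + t))%N; pose L := (q ^ t).+1.
have qt : (2 * m <= q ^ t)%N by apply: ltnW; apply: ltn_expl.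
have LmQ : (L * m <= Q)%N by rewrite /L /Q expnD; nia.
have LLQ : (Q < L * L)%N by rewrite /L /Q expnD; nia.
have Q0 : (0 < Q)%N by rewrite expn_gt0 ltnW.
have [w prw] := wexists Q Q0.
have w0 : w != 0.
  by apply: contra_eq_neq (prim_expr_order prw) => ->; rewrite expr0n gtn_eqF // eq_sym oner_eq0.
have [g0 dg dvg] := frob_iter (t + t) f0.
set g := iter (t + t) frob f in g0 dg dvg *.
pose T (s : 'I_L * 'I_L) := tau (w ^+ s.1) (w ^+ s.2) f.
have wi0 i : w ^+ i != 0 by rewrite expf_neq0.
have inj (i j : 'I_L) : (w ^+ i) ^+ m = (w ^+ j) ^+ m -> i = j.
  rewrite -!exprM => /eqP; rewrite (eq_prim_root_expr prw) => /eqP.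
  have lt (l : 'I_L) : (l * m < Q)%N.
    by apply: leq_trans LmQ; rewrite ltn_mul2r m0 ltn_ord.
  by rewrite !modn_small // => /eqP; rewrite eqn_mul2r gtn_eqF //= => /eqP /val_inj.
have [||||k gE] := @prod_coprime_dvd _ _ T g (enum {: 'I_L * 'I_L}).
- exact: enum_uniq.
- by move=> s _; split; [exact: birred_tau | rewrite (wt_tau _ _ _).1].
- move=> s _; have [k kE] := Hd (t + t)%N.
  exists (tau (w ^+ s.1) (w ^+ s.2) k); rewrite -tauM -kE -/g.
  apply/polyP => i; apply/polyP => j; rewrite coef_tau.
  have [->|nz] := eqVneq (g`_i`_j) 0; first by rewrite mulr0.
  have /andP[/dvdnP[i' ->] /dvdnP[j' ->]] := dvg _ _ nz.
  by rewrite -!exprM ![(_ * (_ * _))%N]mulnA ![(_ * q ^ _)%N]mulnC !exprM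
    (prim_expr_order prw) !expr1n !mul1r.
- move=> s s' _ _ /eqP ss' H; case: ss'.
  have [||||e1 e2] := mP _ _ _ _ _ _ _ _ H => //.
  by case: s s' e1 e2 H => a b [c d] /= /inj -> /inj ->.
have P0 : \prod_(i <- enum {: 'I_L * 'I_L}) T i != 0.
  by apply: contra_neq g0 => P0; rewrite gE P0 mulr0.
have k0 : k != 0 by apply: contra_neq g0 => P0'; rewrite gE P0' mul0r.
have dP : degx (\prod_(i <- enum {: 'I_L * 'I_L}) T i) = (L * L * degx f)%N.
  have -> : (L * L)%N = size (enum {: 'I_L * 'I_L}) by rewrite -cardE card_prod card_ord.
  elim: (enum _) => [|s e IHe]; first by rewrite big_nil /degx size_poly1.
  have Ts : T s != 0 by apply: (birred_tau _ _ fI).1.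
  rewrite big_cons degxM // ?IHe ?(wt_tau _ _ _).1 //=.
  by rewrite prodf_seq_neq0; apply/allP => s' _ /=; apply: (birred_tau _ _ fI).1.
have : (L * L * degx f <= Q * degx f)%N.
  by apply: leq_trans dg; rewrite gE degxM // dP leq_addl.
by rewrite leq_pmul2r // leqNgt LLQ.
Qed.

End Frobenius.

(** * Polynomials with collinear exponents *)

Section Collinear.
Variable K : closedFieldType.
Implicit Types (f g h p : {poly {poly K}}).

Lemma coef_deg f i j : f`_i`_j != 0 -> (i <= degx f)%N /\ (j <= degy f)%N.
Proof.
move=> fij; split; rewrite leqNgt; apply: contraNN fij => H.
  by have /degx_leP := leqnn (degx f) => ->.
by have /degy_leP := leqnn (degy f) => ->.
Qed.

Lemma lex_min_coef f : f != 0 -> exists i0 j0, f`_i0`_j0 != 0 /\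
  forall i j, f`_i`_j != 0 -> (i0 < i)%N \/ i = i0 /\ (j0 <= j)%N.
Proof.
move=> f0.
have [i0 f0i mini] : exists2 i0, f`_i0 != 0 & forall i, f`_i != 0 -> (i0 <= i)%N.
  have ex : exists i, f`_i != 0 by exists (size f).-1; rewrite -lead_coefE lead_coef_eq0.
  by exists (ex_minn ex); case: ex_minnP.
have [j0 fij minj] : exists2 j0, f`_i0`_j0 != 0 & forall j, f`_i0`_j != 0 -> (j0 <= j)%N.
  have ex : exists j, f`_i0`_j != 0.
    by exists (size f`_i0).-1; rewrite -lead_coefE lead_coef_eq0.
  by exists (ex_minn ex); case: ex_minnP.
exists i0, j0; split=> // i j nz.
have : (i0 <= i)%N by apply: mini; apply: contra_neq nz => ->; rewrite coef0.
rewrite leq_eqVlt => /orP[/eqP e|]; [right|by left].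
by split=> //; apply: minj; rewrite e.
Qed.

(** Up to a monomial, [f] is a polynomial in the single monomial [x ^ a * y ^ b],
    where [(a, b)] is the primitive direction of the line of exponents. *)
Lemma collinear_poly f : f != 0 -> ~ planar f ->
  exists (a b : int) (P : {poly K}), [/\ P != 0, 0 <= a & coprimez a b] /\
    [/\ (`|a| * (size P).-1 <= degx f)%N, (`|b| * (size P).-1 <= degy f)%N &
    forall z : K * K, z.1 != 0 -> z.2 != 0 -> ev f z = 0 -> P.[z.1 ^ a * z.2 ^ b] = 0].
Proof.
move=> f0 np; have [i0 [j0 [nz0 lex0]]] := lex_min_coef f0.
have [single|] := pselect (forall i j, f`_i`_j != 0 -> i = i0 /\ j = j0).
  exists 1, 0, 1; rewrite oner_eq0 size_poly1 !muln0; do 2!split=> //; move=> z z1 z2.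
  have [di dj] := coef_deg nz0.
  rewrite ev_coef (bigD1 (Ordinal (n := (degx f).+1) di)) //= [X in _ + X]big1 => [|i ii0].
    rewrite (bigD1 (Ordinal (n := (degy f).+1) dj)) //= [X in _ + X + _]big1 => [|j jj0].
      move/eqP; rewrite !addr0 !mulf_eq0 (negPf nz0) !expf_eq0 (negPf z1) (negPf z2) /=.
      by rewrite !andbF.
    have [->|/single [_ e]] := eqVneq f`_i0`_j 0; first by rewrite !mul0r.
    by case/eqP: jj0; apply: val_inj.
  apply: big1 => j _; have [->|/single [e _]] := eqVneq f`_i`_j 0; first by rewrite !mul0r.
  by case/eqP: ii0; apply: val_inj.
case/existsNP => i1 /existsNP[j1 /not_implyP[nz1 ne1]].
pose g := gcdz (i1%:Z - i0%:Z) (j1%:Z - j0%:Z).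
have g0 : g != 0.
  rewrite gcdz_eq0 !subr_eq0 !eqz_nat; apply/negP => /andP[/eqP e1 /eqP e2].
  exact: ne1.
have gg0 : 0 < g by rewrite lt_neqAle eq_sym g0 le0z_nat.
have /dvdzP[a aE] : (g %| i1%:Z - i0%:Z)%Z by apply: dvdz_gcdl.
have /dvdzP[b bE] : (g %| j1%:Z - j0%:Z)%Z by apply: dvdz_gcdr.
have cab : coprimez a b.
  rewrite /coprimez; have : gcdz (a * g) (b * g) = g by rewrite -aE -bE.
  rewrite -mulz_gcdl gtz0_abs // -{2}[g]mul1r => /(mulIf g0) -> //.
have par i j : f`_i`_j != 0 -> exists s : nat, i%:Z - i0%:Z = s%:Z * a /\ j%:Z - j0%:Z = s%:Z * b.
  move=> nz.
  have D0 : (i1%:Z - i0%:Z) * (j%:Z - j0%:Z) - (i%:Z - i0%:Z) * (j1%:Z - j0%:Z) = 0.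
    by apply/eqP; apply: contra_notT np => D; exists i0, j0, i1, j1, i, j.
  have E : a * (j%:Z - j0%:Z) = (i%:Z - i0%:Z) * b.
    by apply: (mulIf g0); move: D0; rewrite aE bE; lia.
  have /dvdzP[s sE] : (a %| i%:Z - i0%:Z)%Z.
    by rewrite -(Gauss_dvdzl _ cab) -E dvdz_mulr.
  have [a0|a0] := eqVneq a 0.
    exists `|j%:Z - j0%:Z|%N.
    have b1 : b = 1.
      move: cab; rewrite a0 /coprimez gcd0z => /eqP b1.
      have : 0 <= b * g by rewrite -bE; have := lex0 _ _ nz1; move: aE; rewrite a0; lia.
      by rewrite pmulr_lge0 // => /gez0_abs <-.
    have E0 : i%:Z - i0%:Z = 0 by move: E; rewrite a0 b1 mul0r mulr1.
    rewrite E0 a0 b1 mulr0 mulr1; split=> //.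
    by rewrite gez0_abs //; have := lex0 _ _ nz; lia.
  have ag0 : 0 < a.
    have : 0 <= a * g by rewrite -aE; have := lex0 _ _ nz1; lia.
    by rewrite pmulr_lge0 // le_eqVlt eq_sym (negPf a0).
  have E' : j%:Z - j0%:Z = s * b by apply: (mulfI a0); rewrite E sE; ring.
  have s0 : 0 <= s.
    have : 0 <= s * a by rewrite -sE; have := lex0 _ _ nz; lia.
    by rewrite pmulr_lge0.
  by exists `|s|%N; rewrite gez0_abs.
have a0 : 0 <= a.
  have : 0 <= a * g by rewrite -aE; have := lex0 _ _ nz1; lia.
  by rewrite pmulr_lge0.
have /choice [S SE] : forall ij : nat * nat, exists s : nat, f`_ij.1`_ij.2 != 0 ->
    ij.1%:Z - i0%:Z = s%:Z * a /\ ij.2%:Z - j0%:Z = s%:Z * b.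
  move=> [i j]; have [nz|nz] := eqVneq f`_i`_j 0; first by exists 0%N => /negP[]; exact/eqP.
  by have [s sE] := par _ _ nz; exists s.
pose P : {poly K} := \sum_(i < (degx f).+1) \sum_(j < (degy f).+1) f`_i`_j *: 'X^(S (val i, val j)).
have PE s : P`_s = \sum_(i < (degx f).+1) \sum_(j < (degy f).+1) f`_i`_j * (s == S (val i, val j))%:R.
  rewrite coef_sum; apply: eq_bigr => i _; rewrite coef_sum; apply: eq_bigr => j _.
  by rewrite coefZ coefXn.
have ab0 : (a, b) != (0, 0).
  by apply: contraTneq cab => -[-> ->]; rewrite /coprimez gcdz0.
have P0 : P != 0.
  suff : P`_0 != 0 by apply: contra_neq => ->; rewrite coef0.
  have [di dj] := coef_deg nz0.
  have zero i j : f`_i`_j * (0%N == S (i, j))%:R != 0 -> i = i0 /\ j = j0.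
    have [->|nz] := eqVneq f`_i`_j 0; first by rewrite mul0r eqxx.
    case: (0%N =P S (i, j)) => [e|_]; last by rewrite mulr0n mulr0 eqxx.
    by have := SE (i, j) nz; rewrite -e !mul0r /=; lia.
  have S0 : S (i0, j0) = 0%N.
    have := SE (i0, j0) nz0; rewrite /= !subrr => -[/esym /eqP + /esym /eqP].
    rewrite !mulf_eq0 => /orP[/eqP [] //|/eqP ea] /orP[/eqP [] //|/eqP eb].
    by case/eqP: ab0; rewrite ea eb.
  rewrite PE (bigD1 (Ordinal (n := (degx f).+1) di)) //= [X in _ + X]big1 => [|i ii0].
    rewrite (bigD1 (Ordinal (n := (degy f).+1) dj)) //= [X in _ + X + _]big1 => [|j jj0].
      by rewrite S0 eqxx mulr1 !addr0.
    apply/eqP; apply: contraTT isT => /zero[_ e]; case/eqP: jj0; exact: val_inj.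
  apply: big1 => j _.
  apply/eqP; apply: contraTT isT => /zero[e _]; case/eqP: ii0; exact: val_inj.
have [i1' [j1' [nzl Sl]]] : exists i j, f`_i`_j != 0 /\ S (i, j) = (size P).-1.
  have : P`_(size P).-1 != 0 by rewrite -lead_coefE lead_coef_eq0.
  apply: contra_neqP => H; rewrite PE; apply: big1 => i _; apply: big1 => j _.
  have [->|nz] := eqVneq f`_i`_j 0; first by rewrite mul0r.
  case: ((size P).-1 =P S (val i, val j)) => [e|_]; last by rewrite mulr0n mulr0.
  by case: H; exists i, j.
have [SE1 SE2] := SE (i1', j1') nzl; rewrite /= Sl in SE1 SE2.
have [di dj] := coef_deg nzl; have [di0 dj0] := coef_deg nz0.
exists a, b, P; split=> //; split.
- have -> : (`|a| * (size P).-1)%N = `|(i1'%:Z - i0%:Z)%R|%N by rewrite SE1 abszM mulnC.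
  lia.
- have -> : (`|b| * (size P).-1)%N = `|(j1'%:Z - j0%:Z)%R|%N by rewrite SE2 abszM mulnC.
  lia.
move=> z z1 z2 fz.
have : z.1 ^+ i0 * z.2 ^+ j0 * P.[z.1 ^ a * z.2 ^ b] = 0.
  rewrite -fz ev_coef horner_sum mulr_sumr; apply: eq_bigr => i _.
  rewrite horner_sum mulr_sumr; apply: eq_bigr => j _.
  have [->|nz] := eqVneq f`_i`_j 0; first by rewrite scale0r horner0 !(mul0r, mulr0).
  have [e1 e2] := SE (val i, val j) nz; rewrite /= in e1 e2.
  rewrite hornerZ hornerXn mulrCA -!mulrA; congr (_ * _).
  rewrite !exprnP expfzMl !exprz_exp [a * _]mulrC [b * _]mulrC -e1 -e2.
  rewrite [z.2 ^ _ * (_ * _)]mulrCA mulrA -!expfzDr //.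
  by congr (_ ^ _ * _ ^ _); lia.
by move/eqP; rewrite !mulf_eq0 !expf_eq0 (negPf z1) (negPf z2) !andbF /= => /eqP.
Qed.
End Collinear.

(** * Isolated points or cosets *)

Section Dichotomy.
Variable K : closedFieldType.
Implicit Types (f g h p : {poly {poly K}}).

Lemma ev1 z : ev (1 : {poly {poly K}}) z = 1.
Proof. by rewrite /ev !hornerE. Qed.

Section Peel.
Variables (I : finType) (pt : I -> K * K) (F : I -> K).
Hypothesis pt_torus : forall i, (pt i).1 != 0 /\ (pt i).2 != 0.

(** The equation [x ^ a * y ^ b = r], multiplied by a power of [y] when [b < 0]. *)
Definition binomial_poly (a b : int) (r : K) : {poly {poly K}} :=
  if 0 <= b then 'X^(`|a|%N) * ('X^(`|b|%N))%:P - r%:P%:P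
  else 'X^(`|a|%N) - (r *: 'X^(`|b|%N))%:P.

Lemma ev_binomial_poly a b r z : 0 <= a -> z.1 != 0 -> z.2 != 0 ->
  (ev (binomial_poly a b r) z == 0) = (z.1 ^ a * z.2 ^ b == r).
Proof.
move=> a0 z1 z2; rewrite /binomial_poly; case: ifPn => b0.
  rewrite evB evM evXn !evC hornerXn hornerC subr_eq0 !exprnP !gez0_abs //.
rewrite -ltNge in b0; rewrite evB evXn evC hornerZ hornerXn subr_eq0 !exprnP.
rewrite gez0_abs // ltz0_abs // -invr_expz.
have zb : z.2 ^ b != 0 by apply: expfz_neq0.
apply/eqP/eqP => [->|<-]; last by rewrite mulfK.
by rewrite mulfVK.
Qed.

Lemma wt_binomial_poly a b r : (wt (binomial_poly a b r) <= `|a| + `|b|)%N.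
Proof.
have cX (n i j : nat) : ('X^n : {poly {poly K}})`_i`_j = ((i == n) && (j == 0%N))%:R.
  by rewrite coefXn; case: (i == n); rewrite ?coef0 // coef1.
have cXM (n m i j : nat) : ('X^n * ('X^m)%:P : {poly {poly K}})`_i`_j =
    ((i == n) && (j == m))%:R.
  by rewrite coefMC coefXn; case: (i == n); rewrite ?mul0r ?coef0 // mul1r coefXn.
have cC (c : {poly K}) i j : (c%:P : {poly {poly K}})`_i`_j = if i == 0%N then c`_j else 0.
  by rewrite coefC; case: ifP => //; rewrite coef0.
rewrite /wt; apply: leq_add.
  apply/degx_leP => i j H; rewrite /binomial_poly.
  have i0 : (i == 0%N) = false by case: (i) H.
  have ia : (i == `|a|%N) = false by rewrite gtn_eqF.
  by case: ifP => _; rewrite !coefB ?cX ?cXM cC i0 ia subr0.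
apply/degy_leP => i j H; rewrite /binomial_poly.
have j0 : (j == 0%N) = false by case: (j) H.
have jb : (j == `|b|%N) = false by rewrite gtn_eqF.
case: ifP => _; rewrite !coefB ?cX ?cXM cC ?coefC ?coefZ ?coefXn j0 jb ?andbF ?mulr0.
  by case: ifP; rewrite subr0.
by case: ifP; rewrite subr0.
Qed.

(** The support of [h * F] lies on finitely many cosets.  Multiplying by one
    binomial after the other, as long as the function does not vanish, leaves a
    single coset. *)
Lemma peel_roots (a b : int) (rs : seq K) h : 0 <= a ->
  (exists i, ev h (pt i) * F i != 0) ->
  (forall i, ev h (pt i) * F i != 0 ->
     \prod_(r <- rs) ((pt i).1 ^ a * (pt i).2 ^ b - r) = 0) ->
  exists h' c, [/\ (wt h' <= wt h + size rs * (`|a| + `|b|))%N,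
    exists i, ev h' (pt i) * F i != 0 &
    forall i, ev h' (pt i) * F i != 0 -> (pt i).1 ^ a * (pt i).2 ^ b = c].
Proof.
move=> a0; elim: rs h => [|r rs IHrs] h ex H.
  have [i hi] := ex; have := H i hi.
  by rewrite big_nil => /eqP; rewrite oner_eq0.
have [ex'|nex] := pselect (exists i, ev (binomial_poly a b r * h) (pt i) * F i != 0); last first.
  exists h, r; split=> //; first by rewrite leq_addr.
  move=> i hi; have [z1 z2] := pt_torus i.
  apply/eqP; rewrite -ev_binomial_poly //.
  apply: contra_notT nex => nz; exists i.
  by rewrite evM -mulrA mulf_neq0.
have h0 : h != 0.
  case: ex => i; apply: contra_neq => ->.
  by rewrite /ev !horner0 mul0r.
have b0 : binomial_poly a b r != 0.
  case: ex' => i; apply: contra_neq => ->.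
  by rewrite mul0r /ev !horner0 mul0r.
have [i|h' [c [wh' e' H']]] := IHrs _ ex'.
  rewrite evM -mulrA mulf_eq0 negb_or => /andP[nb nh]; have := H i nh.
  have [z1 z2] := pt_torus i; rewrite ev_binomial_poly // in nb.
  rewrite big_cons => /eqP; rewrite mulf_eq0 subr_eq0 (negPf nb) /= => /eqP //.
exists h', c; split=> //; apply: leq_trans wh' _.
by rewrite wtM //= mulSn; have := wt_binomial_poly a b r; lia.
Qed.
End Peel.

Variables (sigma : {rmorphism K -> K}) (q N : nat) (zeta : K).
Hypothesis q_gt1 : (1 < q)%N.
Hypothesis prim_exists : forall n, (0 < n)%N -> exists w : K, n.-primitive_root w.
Hypothesis zetaP : N.-primitive_root zeta.
Hypothesis sigma_zeta : sigma zeta = zeta ^+ q.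

Definition pt (xi : 'I_N * 'I_N) : K * K := (zeta ^+ xi.1, zeta ^+ xi.2).

Lemma zeta_neq0 : zeta != 0.
Proof.
apply: contra_eq_neq (prim_expr_order zetaP) => ->.
by rewrite expr0n gtn_eqF ?(prim_order_gt0 zetaP) // eq_sym oner_eq0.
Qed.

Lemma pt_torus i : (pt i).1 != 0 /\ (pt i).2 != 0.
Proof. by rewrite !expf_neq0 // zeta_neq0. Qed.

Lemma pt_inj : injective pt.
Proof.
move=> [i j] [k l] [/eqP + /eqP]; rewrite !(eq_prim_root_expr zetaP) !eqE /=.
by rewrite !modn_small // => /eqP/val_inj -> /eqP/val_inj ->.
Qed.

(** Among the pairs [(f, h)] with [f * h * F = 0], [h * F <> 0] and total weight at
    most [D], one with [f] of least weight has [f] irreducible: otherwise a factor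
    of [f] could be moved to [h], or dropped.  If the exponents of [f] are not
    collinear, the support of [h * F] lies on [f] and on its lift, and
    [interpolation] isolates a point.  If they are collinear, the support lies on
    cosets, and [peel_roots] keeps one. *)
Theorem isolate_or_coset (F : 'I_N * 'I_N -> K) (G : {poly {poly K}}) D :
  (exists i, F i != 0) -> G != 0 -> (forall i, ev G (pt i) * F i = 0) -> (wt G <= D)%N ->
  exists h, [/\ (wt h <= D)%N, exists i, ev h (pt i) * F i != 0 &
   (exists p i0, [/\ (degx p <= q.+1 * D)%N, (degy p <= q.+1 * D)%N,
      ev p (pt i0) * (ev h (pt i0) * F i0) != 0 &
      forall i, i != i0 -> ev p (pt i) * (ev h (pt i) * F i) = 0]) \/
   (exists (a b : int) (c : K), [/\ coprimez a b, (`|a| <= D)%N, (`|b| <= D)%N &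
      forall i, ev h (pt i) * F i != 0 -> (pt i).1 ^ a * (pt i).2 ^ b = c])].
Proof.
move=> F0 G0 GF wG.
suff main n f h : (wt f <= n)%N -> f != 0 -> (wt h + wt f <= D)%N ->
    (exists i, ev h (pt i) * F i != 0) ->
    (forall i, ev f (pt i) * (ev h (pt i) * F i) = 0) ->
    exists h, [/\ (wt h <= D)%N, exists i, ev h (pt i) * F i != 0 &
   (exists p i0, [/\ (degx p <= q.+1 * D)%N, (degy p <= q.+1 * D)%N,
      ev p (pt i0) * (ev h (pt i0) * F i0) != 0 &
      forall i, i != i0 -> ev p (pt i) * (ev h (pt i) * F i) = 0]) \/
   (exists (a b : int) (c : K), [/\ coprimez a b, (`|a| <= D)%N, (`|b| <= D)%N &
      forall i, ev h (pt i) * F i != 0 -> (pt i).1 ^ a * (pt i).2 ^ b = c])].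
  apply: (main (wt G) G 1) => //.
  - by rewrite (_ : wt 1 = 0)%N // /wt /degx /degy size_poly1 sizeYE rmorph1 size_poly1.
  - by case: F0 => i Fi; exists i; rewrite ev1 mul1r.
  - by move=> i; rewrite ev1 mul1r.
elim: n f h => [|n IHn] f h wf f0 whf ex Z.
  (* A nonzero constant f does not kill h * F. *)
  have wf0 : wt f = 0 by lia.
  have [c fE] := wt0_const wf0.
  have c0 : c != 0 by move: f0; rewrite fE !polyC_eq0.
  case: ex => i hi; have := Z i; rewrite fE evC hornerC => /eqP.
  by rewrite mulf_eq0 (negPf c0) (negPf hi).
have h0 : h != 0.
  by case: ex => i; apply: contra_neq => ->; rewrite /ev !horner0 mul0r.
have [fI|nfI] := pselect (birred f); last first.
  have [g1 [g2 [fE w1 w2]]] : exists g1 g2, [/\ f = g1 * g2, wt g1 <> 0 & wt g2 <> 0].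
    apply: contra_notP nfI => H; split=> // g1 g2 fE.
    have [e|e] := eqVneq (wt g1) 0%N; first by left.
    by right; apply: contra_notP H => e2; exists g1, g2; split=> //; apply/eqP.
  have g10 : g1 != 0 by apply: contra_neq f0 => e; rewrite fE e mul0r.
  have g20 : g2 != 0 by apply: contra_neq f0 => e; rewrite fE e mulr0.
  move: wf whf; rewrite fE wtM // => wf whf.
  have [ex'|nex] := pselect (exists i, ev (g2 * h) (pt i) * F i != 0).
    apply: (IHn g1 (g2 * h)) => //; first by lia.
      by rewrite wtM //; lia.
    by move=> i; rewrite evM -mulrA mulrA -evM -fE.
  apply: (IHn g2 h) => //; [lia|lia|] => i.
  apply/eqP; apply: contra_notT nex => nz; exists i; rewrite evM -mulrA //.
have [pf|npf] := pselect (planar f).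
  have df := planar_degx pf; pose g := frob sigma q f.
  have ndv := frob_ndvd (sigma := sigma) q_gt1 prim_exists fI pf.
  have [|[a [b [r [r0 rE]]]]] := birred_dvd_or_bezout g fI df; first by move/ndv.
  have df' : (0 < degx (swapXY f))%N.
    rewrite -degyE lt0n; apply/eqP => dy0; case: pf => i0 [j0 [i1 [j1 [i2 [j2 [n0 n1 n2]]]]]].
    have Zj i j : f`_i`_j != 0 -> j = 0%N.
      by move=> /coef_deg[_]; rewrite dy0; lia.
    by rewrite (Zj _ _ n0) (Zj _ _ n1) (Zj _ _ n2) !subrr !mulr0 subr0 eqxx.
  have [[k kE]|[a' [b' [r' [r'0 r'E]]]]] :=
      birred_dvd_or_bezout (swapXY g) (birred_swapXY fI) df'.
    case: ndv; exists (swapXY k).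
    by rewrite -[LHS]swapXYK -/g kE rmorphM /= swapXYK.
  have r'E2 : swapXY a' * f + swapXY b' * g = r'^:P.
    by rewrite -swapXY_polyC -r'E rmorphD !rmorphM /= !swapXYK.
  have [i0 hi0] := ex.
  pose s := [seq pt i | i <- enum {: 'I_N * 'I_N} & ev h (pt i) * F i != 0].
  have ins i : (pt i \in s) = (ev h (pt i) * F i != 0).
    apply/mapP/idP => [[j + /pt_inj ->]|hi]; first by rewrite mem_filter => /andP[].
    by exists i; rewrite // mem_filter hi mem_enum.
  have [||p [p0 pz dpx dpy]] := interpolation r0 rE r'0 r'E2 f0
    (degx_frob sigma q_gt1 f) (degy_frob sigma q_gt1 f) (s := s) (z0 := pt i0).
  - move=> z /mapP[ i]; rewrite mem_filter => /andP[hi _] ->.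
    have fi : ev f (pt i) = 0 by move/eqP: (Z i); rewrite mulf_eq0 (negPf hi) orbF => /eqP.
    split=> //; rewrite ev_frob ?fi ?rmorph0 //= rmorphXn /= sigma_zeta -!exprM mulnC //.
  - by rewrite ins.
  exists h; split=> //; [lia|left; exists p, i0; split].
  - by apply: leq_trans dpx _; rewrite mulSn /wt in whf *; nia.
  - by apply: leq_trans dpy _; rewrite mulSn /wt in whf *; nia.
  - by rewrite mulf_neq0.
  - move=> i ii0; have [->|nz] := eqVneq (ev h (pt i) * F i) 0; first by rewrite mulr0.
    rewrite pz ?mul0r ?ins //; by apply: contra_neq ii0 => /pt_inj.
have [a [b [P [[P0 a0 cab] [da db PZ]]]]] := collinear_poly f0 npf.
have [rs PE] := closed_field_poly_normal P.
have szP : (size P).-1 = size rs.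
  by rewrite PE size_scale ?lead_coef_eq0 // size_prod_XsubC.
have [|h' [c [wh' ex' H']]] := peel_roots pt_torus (F := F) (b := b) (rs := rs) (h := h) a0 ex.
  move=> i hi; have [z1 z2] := pt_torus i.
  have fi : ev f (pt i) = 0 by move/eqP: (Z i); rewrite mulf_eq0 (negPf hi) orbF => /eqP.
  have := PZ (pt i) z1 z2 fi; rewrite PE hornerZ horner_prod => /eqP.
  rewrite mulf_eq0 lead_coef_eq0 (negPf P0) /= => /eqP <-.
  by apply: eq_bigr => r _; rewrite !hornerE.
have sz0 : (0 < size rs)%N.
  rewrite lt0n; apply/eqP => /size0nil rs0; move: PZ; rewrite PE rs0 big_nil.
  have [i hi] := ex; have [z1 z2] := pt_torus i.
  have fi : ev f (pt i) = 0 by move/eqP: (Z i); rewrite mulf_eq0 (negPf hi) orbF => /eqP.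
  move=> /(_ _ z1 z2 fi); rewrite hornerZ hornerC mulr1 => /eqP.
  by rewrite lead_coef_eq0 (negPf P0).
rewrite szP in da db; rewrite /wt in whf.
exists h'; split=> //; first by apply: leq_trans wh' _; rewrite /wt; nia.
right; exists a, b, c; split=> //; nia.
Qed.

End Dichotomy.

(** * Discrete Cantor sets *)

Section Digits.
Variables (M : nat) (A : {set 'I_M * 'I_M}).
Hypothesis M_gt1 : (1 < M)%N.

Definition digit_ok (a b : nat) : bool :=
  [exists d in A, (d.1 == a :> nat) && (d.2 == b :> nat)].

Definition cantor_digits k (x : nat * nat) : bool :=
  [forall i : 'I_k, digit_ok (x.1 %/ M ^ i %% M) (x.2 %/ M ^ i %% M)].

Lemma cantor_digitsP k x : reflect
  (forall i, (i < k)%N -> digit_ok (x.1 %/ M ^ i %% M) (x.2 %/ M ^ i %% M))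
  (cantor_digits k x).
Proof.
apply: (iffP forallP) => H i; last exact: H.
by move=> ik; exact: (H (Ordinal ik)).
Qed.

(** Integers stand for their residues modulo [M ^ k]. *)
Definition cantor_int k (z : int * int) : bool :=
  cantor_digits k (`|(z.1 %% (M ^ k)%N%:Z)%Z|%N, `|(z.2 %% (M ^ k)%N%:Z)%Z|%N).

Lemma M_gt0 : (0 < M)%N. Proof. exact: ltnW. Qed.
Lemma expM_gt0 k : (0 < M ^ k)%N. Proof. by rewrite expn_gt0 M_gt0. Qed.
Hint Resolve M_gt0 expM_gt0 : core.

Lemma divn_modM x l i : (i < l)%N -> (x %% M ^ l %/ M ^ i %% M = x %/ M ^ i %% M)%N.
Proof.
move=> il; rewrite {2}(divn_eq x (M ^ l)).
have -> : (M ^ l = M ^ (l - i).-1 * M * M ^ i)%N.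
  by rewrite -expnSr -expnD; congr (_ ^ _)%N; lia.
rewrite mulnA divnMDl // mulnA.
by rewrite modnMDl.
Qed.

Lemma cantor_digits_cat l k x : cantor_digits (l + k) x =
  cantor_digits l ((x.1 %% M ^ l)%N, (x.2 %% M ^ l)%N) &&
  cantor_digits k ((x.1 %/ M ^ l)%N, (x.2 %/ M ^ l)%N).
Proof.
apply/cantor_digitsP/andP => [H|[/cantor_digitsP H1 /cantor_digitsP H2] i ilk].
  split; apply/cantor_digitsP => i ik /=.
    by rewrite !divn_modM //; apply: H; lia.
  by rewrite -!divnMA -!expnD; apply: H; lia.
have [il|li] := ltnP i l.
  by have := H1 i il; rewrite /= !divn_modM.
have := H2 (i - l)%N; rewrite /= -!divnMA -!expnD subnKC //; apply; lia.
Qed.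

Section Hole.
Variables (al be : nat).
Hypotheses (alM : (al < M)%N) (beM : (be < M)%N) (hole : ~~ digit_ok al be).

Lemma modz_shift (x n N : int) : 0 <= x - N * n -> x - N * n < N -> (x %% N)%Z = x - N * n.
Proof.
move=> h1 h2; rewrite {1}(_ : x = n * N + (x - N * n)); last by ring.
by rewrite modzMDl modz_small // h1 h2.
Qed.

(** A pair [(al, be)] outside [A], read as leading digits, excludes a whole box of
    side [M ^ k]. *)
Lemma hole_notin k (z : int * int) (n1 n2 : int) :
  let L := (M ^ k)%N%:Z in let N := (M ^ k.+1)%N%:Z in
  al%:Z * L <= z.1 - N * n1 < (al%:Z + 1) * L ->
  be%:Z * L <= z.2 - N * n2 < (be%:Z + 1) * L -> ~~ cantor_int k.+1 z.
Proof.
move=> L N /andP[l1 u1] /andP[l2 u2].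
have L0 : 0 < L by rewrite ltz_nat.
have NE : N = M%:Z * L by rewrite /N expnS PoszM.
have top (c : nat) (x n : int) : (c < M)%N -> c%:Z * L <= x - N * n -> x - N * n < (c%:Z + 1) * L ->
    (`|(x %% N)%Z| %/ M ^ k %% M = c)%N.
  move=> cM lx ux; have cl : c%:Z + 1 <= M%:Z by lia.
  rewrite (@modz_shift x n); first last.
  - by apply: lt_le_trans ux _; rewrite NE ler_wpM2r // ltW.
  - by apply: le_trans lx; rewrite mulr_ge0 // ltW.
  have y0 : 0 <= x - N * n by apply: le_trans lx; rewrite mulr_ge0 // ltW.
  move: lx ux y0; set y := x - N * n; clearbody y => lx ux y0.
  case: y y0 lx ux => // y _; rewrite /L -PoszD -!PoszM ltz_nat lez_nat absz_nat => lx ux.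
  have -> : (y %/ M ^ k = c)%N.
    apply/eqP; rewrite eqn_leq leq_divRL // lx andbT -ltnS ltn_divLR //.
    by rewrite -[c.+1]addn1.
  by rewrite modn_small.
apply/negP => /cantor_digitsP/(_ k (ltnSn k)) /=.
by rewrite (top _ _ _ alM l1 u1) (top _ _ _ beM l2 u2); apply/negP.
Qed.

End Hole.

Definition ord_pair k := ('I_(M ^ k) * 'I_(M ^ k))%type.
Definition val2 k (x : ord_pair k) : nat * nat := (val x.1, val x.2).

Definition lo_ord l (x : nat) : 'I_(M ^ l) := Ordinal (ltn_pmod x (expM_gt0 l)).
Definition lo l (x : nat * nat) : ord_pair l := (lo_ord l x.1, lo_ord l x.2).

Lemma div_expM_lt l k x : (x < M ^ (l + k))%N -> (x %/ M ^ l < M ^ k)%N.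
Proof. by move=> H; rewrite ltn_divLR // -expnD addnC. Qed.

Lemma card_split l k (P : pred (ord_pair (l + k))) (Q : pred (ord_pair l)) (c : nat) :
  (forall x, P x -> Q (lo l (val2 x))) ->
  (forall y, (#|[set x | P x & lo l (val2 x) == y]| <= c)%N) -> (#|P| <= #|Q| * c)%N.
Proof.
move=> PQ H.
rewrite -sum1_card (partition_big (fun x => lo l (val2 x)) Q) //=.
rewrite -sum_nat_const; apply: leq_sum => y _.
by rewrite sum1_card; apply: leq_trans (H y); rewrite cardsE.
Qed.

(** Fibres over the low digits, described by the high digits. *)
Lemma card_split_hi l k (P : pred (ord_pair (l + k))) (Q : pred (ord_pair l))
   (R : ord_pair l -> pred (ord_pair k)) (c : nat) :
  (forall x, P x -> Q (lo l (val2 x))) ->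
  (forall x, P x -> R (lo l (val2 x)) (lo k (x.1 %/ M ^ l, x.2 %/ M ^ l)%N)) ->
  (forall y, Q y -> (#|R y| <= c)%N) -> (#|P| <= #|Q| * c)%N.
Proof.
move=> PQ PR H; apply: card_split => // y.
have [Qy|nQy] := boolP (Q y); last first.
  rewrite (_ : [set _ | _ & _] = finset.set0) ?cards0 //; apply/setP => x; rewrite !inE.
  by apply/negP => /andP[/PQ + /eqP E]; rewrite E (negPf nQy).
apply: leq_trans (H y Qy).
have hlt (z : 'I_(M ^ (l + k))) : (z %/ M ^ l %% M ^ k = z %/ M ^ l)%N.
  by rewrite modn_small // div_expM_lt.
rewrite -(card_in_imset (f := fun x : ord_pair (l + k) => lo k (x.1 %/ M ^ l, x.2 %/ M ^ l)%N)).
  apply: subset_leq_card; apply/fintype.subsetP => z /imsetP[x]; rewrite !inE => /andP[Px /eqP <-] ->.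
  exact: PR.
move=> [x1 x2] [x1' x2']; rewrite !inE => /andP[_ /eqP <-] /andP[_ /eqP [e1 e2]].
case; rewrite !hlt => e3 e4; congr (_, _); apply: val_inj.
  by rewrite /= (divn_eq x1 (M ^ l)) (divn_eq x1' (M ^ l)) e3 e1.
by rewrite /= (divn_eq x2 (M ^ l)) (divn_eq x2' (M ^ l)) e4 e2.
Qed.

Lemma card_cantor_le m : A \proper [set: 'I_M * 'I_M] -> (m.+1 = M ^ 2)%N -> forall k,
  (#|[pred x : ord_pair k | cantor_digits k (val2 x)]| <= m ^ k)%N.
Proof.
move=> Ap mM; elim=> [|k IHk].
  by apply: leq_trans (max_card _) _; rewrite card_prod card_ord.
have -> : (m ^ k.+1 = m ^ 1 * m ^ k)%N by rewrite expnS expn1.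
have Am : (#|A| <= m)%N.
  by have := proper_card Ap; rewrite cardsT card_prod card_ord mulnn -mM ltnS.
apply: leq_trans (_ : #|[pred x : ord_pair 1 | cantor_digits 1 (val2 x)]| * m ^ k <= _)%N.
  apply: (@card_split_hi 1 k _ _ (fun _ => [pred x : ord_pair k | cantor_digits k (val2 x)])) => //.
    by move=> x; rewrite inE -[k.+1]/(1 + k)%N cantor_digits_cat => /andP[].
  move=> x; rewrite inE -[k.+1]/(1 + k)%N cantor_digits_cat => /andP[_]; rewrite inE /val2 /=.
  by rewrite !modn_small // div_expM_lt.
rewrite leq_mul2r; apply/orP; right; rewrite [(m ^ 1)%N]expn1; apply: leq_trans Am.
apply: (@leq_trans #|[pred x : 'I_M * 'I_M | cantor_digits 1 (val x.1, val x.2)]|); first exact: leqnn.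
apply: subset_leq_card; apply/fintype.subsetP => -[x y]; rewrite inE => /cantor_digitsP/(_ 0%N isT) /=.
rewrite expn0 !divn1 !modn_small // => /exists_inP[[d e] dA /= /andP[/eqP h1 /eqP h2]].
by rewrite -(val_inj h1) -(val_inj h2).
Qed.

End Digits.

(** * Discrete lines and cosets *)

(** The linear forms [a x + b y] and [u y - v x] are coordinates modulo [N]. *)
Lemma unimodular_dvd (N a b u v x y : int) : a * u + b * v = 1 ->
  (N %| a * x + b * y)%Z -> (N %| u * y - v * x)%Z -> (N %| x)%Z /\ (N %| y)%Z.
Proof.
move=> E h1 h2; split.
  have -> : x = u * (a * x + b * y) - b * (u * y - v * x).
    by rewrite -[LHS]mul1r -E; ring.
  by rewrite rpredB ?dvdz_mull.
have -> : y = v * (a * x + b * y) + a * (u * y - v * x).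
  by rewrite -[LHS]mul1r -E; ring.
by rewrite rpredD ?dvdz_mull.
Qed.

Lemma eq_of_dvdz (N x y : nat) : (x < N)%N -> (y < N)%N ->
  (N%:Z %| x%:Z - y%:Z)%Z -> x = y.
Proof.
move=> xN yN; rewrite -eqz_mod_dvd => /eqP; rewrite !modz_small; first by move=> [].
  by rewrite /= ltz_nat.
by rewrite /= ltz_nat.
Qed.

(** The line [p + Z (a, b)] modulo [N] consists of parallel segments; as [a] and [b]
    are coprime, consecutive segments are at vertical distance [N / a], less than
    the side of the box. *)
Lemma hit_box (N L u1 u2 a b D p1 p2 : int) : 0 < N -> 0 < a -> `|b| <= a -> a <= D ->
  coprimez a b -> N + 3 * (a * D) <= a * L -> 2 * D < L ->
  exists s n1 n2, [/\ u1 <= p1 + s * a - N * n1, p1 + s * a - N * n1 + D < u1 + L,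
    u2 <= p2 + s * b - N * n2 & p2 + s * b - N * n2 + D < u2 + L].
Proof.
move=> N0 a0 ba aD cab H1 H2.
have [[u v] /= uv] := coprimezP _ _ cab.
(* The integer m chooses the segment of the line, through the value a * n2 - b * k
   of the translation (k, n2), and s then moves along this segment. *)
pose C := u1 + a - p1.
pose W := a * u2 + a * D.
pose m := - ((a * p2 + b * C - W) %/ N)%Z.
have mP : W <= a * p2 + b * C + N * m < W + N.
  have := divz_eq (a * p2 + b * C - W) N; have := modz_ge0 (a * p2 + b * C - W) (lt0r_neq0 N0).
  have := ltz_pmod (a * p2 + b * C - W) N0.
  rewrite /m; set q := (_ %/ _)%Z; set r := (_ %% _)%Z => h1 h2 h3.
  have -> : a * p2 + b * C + N * - q = W + r by rewrite -(subrK W (a * p2 + b * C)) addrAC {1}h3; ring.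
  by rewrite lerDl ltrD2l h1 h2.
pose k := v * m; pose n2 := - (u * m).
have km : b * k - a * n2 = m.
  by rewrite /k /n2 -[RHS]mul1r -uv; ring.
pose s := ((C + N * k) %/ a)%Z.
have sE := divz_eq (C + N * k) a; have r0 := modz_ge0 (C + N * k) (lt0r_neq0 a0).
have ra := ltz_pmod (C + N * k) a0.
rewrite -/s in sE; set r := (_ %% _)%Z in sE r0 ra.
have sa : s * a = C + N * k - r by rewrite sE addrK.
exists s, k, n2; have -> : p1 + s * a - N * k = u1 + a - r by rewrite sa /C; ring.
have E2 : a * (p2 + s * b - N * n2) = a * p2 + b * C + N * m - b * r.
  have -> : a * (p2 + s * b - N * n2) = a * p2 + b * (s * a) - N * (a * n2) by ring.
  by rewrite sa -km; ring.
have br : `|b * r| <= a * D.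
  rewrite normrM (ger0_norm r0); apply: le_trans (_ : a * r <= _).
    by rewrite ler_wpM2r.
  by rewrite ler_pM2l //; lia.
have /andP[br1 br2] : - (a * D) <= b * r <= a * D by rewrite -ler_norml.
move: mP => /andP[mP1 mP2].
split; [lia|lia| |].
  by rewrite -(ler_pM2l a0) E2; rewrite /W in mP1; lia.
rewrite -(ltr_pM2l a0) mulrDr E2 mulrDr; rewrite /W in mP2; lia.
Qed.

Section Cosets.
Variables (M : nat) (A : {set 'I_M * 'I_M}).
Hypothesis M_gt1 : (1 < M)%N.

Let M0 : (0 < M)%N. Proof. exact: ltnW. Qed.
Let expM0 k : (0 < M ^ k)%N. Proof. by rewrite expn_gt0 M0. Qed.

Lemma exists_hole : A \proper [set: 'I_M * 'I_M] -> exists al be : nat, [/\ (al < M)%N, (be < M)%N & ~~ digit_ok A al be].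
Proof.
case/andP=> _ /subsetPn [[x y] _ xyA].
exists (val x), (val y); split; [exact: ltn_ord|exact: ltn_ord|]; apply/negP => /existsP[[x1 y1] /= /and3P[dA /eqP e1 /eqP e2]].
by case/negP: xyA; rewrite -(val_inj e1) -(val_inj e2).
Qed.

(** A discrete line whose direction has a large coordinate is so dense that it
    enters the box missed by the Cantor set, with a margin of [D]. *)
Lemma hit_hole k (a b : int) (D : nat) : A \proper [set: 'I_M * 'I_M] -> coprimez a b -> (`|a| <= D)%N -> (`|b| <= D)%N ->
  (4 * M <= `|a|)%N || (4 * M <= `|b|)%N -> (100 * M * D <= M ^ k.+1)%N ->
  forall p : int * int, exists s : int, forall i j : nat, (i <= D)%N -> (j <= D)%N ->
    ~~ cantor_int A k.+1 (p.1 + s * a + i%:Z, p.2 + s * b + j%:Z).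
Proof.
move=> A_proper cab aD bD big DM [p1 p2].
have [al [be [alM beM hole]]] := exists_hole A_proper.
pose N := (M ^ k.+1)%N%:Z; pose L := (M ^ k)%N%:Z.
have NE : N = M%:Z * L by rewrite /N expnS PoszM.
have L0 : 0 < L by rewrite ltz_nat.
have N0 : 0 < N by rewrite ltz_nat.
have M0' : 0 < M%:Z by rewrite ltz_nat.
have DL : 100 * D%:Z <= L.
  by rewrite -(ler_pM2l M0') -NE /N; move: DM; lia.
have size (c : int) : 4 * M%:Z <= c -> N + 3 * (c * D%:Z) <= c * L.
  move=> cM.
  have h1 : 2 * N <= c * L by rewrite NE; nia.
  have h2 : 6 * (c * D%:Z) <= c * L by nia.
  lia.
suff [s [n1 [n2 [h1 h2 h3 h4]]]] : exists s n1 n2, [/\ al%:Z * L <= p1 + s * a - N * n1,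
    p1 + s * a - N * n1 + D%:Z < al%:Z * L + L,
    be%:Z * L <= p2 + s * b - N * n2 & p2 + s * b - N * n2 + D%:Z < be%:Z * L + L].
  exists s => i j iD jD; apply: (hole_notin M_gt1 alM beM hole (n1 := n1) (n2 := n2)).
    by rewrite -/N -/L /= mulrDl mul1r; apply/andP; split; lia.
  by rewrite -/N -/L /= mulrDl mul1r; apply/andP; split; lia.
have cba : coprimez b a by rewrite coprimez_sym.
have [ba|ab] := leP `|b| `|a|.
  have aM : 4 * M%:Z <= `|a| by lia.
  have a0 : 0 < `|a| by lia.
  have [ap|an] := leP 0 a.
    apply: hit_box => //; rewrite ?(ger0_norm ap) // in ba aM a0 *; try lia.
    exact: size.
  have [||||||s [n1 [n2 H]]] := @hit_box N L (al%:Z * L) (be%:Z * L) (- a) (- b) D p1 p2 N0; try lia.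
  - by rewrite /coprimez gcdzN gcdNz.
  - by apply: size; lia.
  by exists (- s), n1, n2; move: H; rewrite !mulrN !mulNr.
have bM : 4 * M%:Z <= `|b| by lia.
have b0 : 0 < `|b| by lia.
have [bp|bn] := leP 0 b.
  have [||||||s [n1 [n2 [? ? ? ?]]]] := @hit_box N L (be%:Z * L) (al%:Z * L) b a D p2 p1 N0; try lia; rewrite ?(ger0_norm bp) // in bM *; try lia.
    exact: size.
  by exists s, n2, n1.
have [||||||s [n1 [n2 [? ? ? ?]]]] := @hit_box N L (be%:Z * L) (al%:Z * L) (- b) (- a) D p2 p1 N0; try lia.
- by rewrite /coprimez gcdzN gcdNz.
- by apply: size; lia.
by exists (- s), n2, n1; rewrite !mulNr -![- (s * _)]mulrN.
Qed.

(** Every discrete line of direction [v] has a point whose [D]-neighbourhood misses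
    the discrete Cantor set of level [k].  The integers [E] and [k0] do not depend
    on [D], which may thus grow like a small multiple of [M ^ k]. *)
Definition escape (v : int * int) := exists k0 E : nat, forall k D : nat,
  (k0 <= k)%N -> (D * E <= M ^ k)%N -> forall p : int * int, exists s : int,
  forall i j : nat, (i <= D)%N -> (j <= D)%N ->
    ~~ cantor_int A k (p.1 + s * v.1 + i%:Z, p.2 + s * v.2 + j%:Z).

Definition coset k (a b s : int) : pred (ord_pair M k) :=
  [pred x | ((M ^ k)%N%:Z %| a * (val x.1)%:Z + b * (val x.2)%:Z - s)%Z].

Definition cantor_coset k (a b s : int) : pred (ord_pair M k) :=
  [pred x | cantor_digits A k (val2 x) && coset a b s x].

Lemma lo_ordz (k : nat) (z : int) : exists2 x : 'I_(M ^ k),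
  `|(z %% (M ^ k)%N%:Z)%Z|%N = val x & ((M ^ k)%N%:Z %| (val x)%:Z - z)%Z.
Proof.
have N0 : 0 < (M ^ k)%N%:Z by rewrite ltz_nat.
have h : (`|(z %% (M ^ k)%N%:Z)%Z| < M ^ k)%N.
  by rewrite -ltz_nat gez0_abs ?modz_ge0 ?ltz_pmod // gt_eqF.
exists (Ordinal h) => //=.
by rewrite gez0_abs ?modz_ge0 ?gt_eqF // -eqz_mod_dvd modz_mod.
Qed.

(** The coset is parametrized by the complementary coordinate [u * x2 - v * x1]. *)
Lemma card_coset k a b s : coprimez a b -> (#|@coset k a b s| <= M ^ k)%N.
Proof.
move=> /coprimezP [[u v] /= uv].
have uv' : a * u + b * v = 1 by rewrite mulrC [b * _]mulrC.
pose N := (M ^ k)%N.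
have /choice [f fP] : forall x : ord_pair M k, exists y : 'I_(M ^ k),
    (N%:Z %| (val y)%:Z - (u * (val x.2)%:Z - v * (val x.1)%:Z))%Z.
  by move=> x; have [y _ yP] := lo_ordz k (u * (val x.2)%:Z - v * (val x.1)%:Z); exists y.
rewrite -[X in (_ <= X)%N]card_ord -(card_in_imset (f := f)); first exact: max_card.
move=> [x1 x2] [y1 y2]; rewrite !inE /= => Cx Cy fxy.
have := fP (x1, x2); have := fP (y1, y2); rewrite fxy /= => h1 h2.
have [|||d1 d2] := @unimodular_dvd N%:Z a b u v ((val x1)%:Z - (val y1)%:Z) ((val x2)%:Z - (val y2)%:Z) => //.
- have -> : a * ((val x1)%:Z - (val y1)%:Z) + b * ((val x2)%:Z - (val y2)%:Z) =
    (a * (val x1)%:Z + b * (val x2)%:Z - s) - (a * (val y1)%:Z + b * (val y2)%:Z - s) by ring.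
  by rewrite rpredB.
- set fy := (val (f (y1, y2)))%:Z in h1 h2.
  have -> : u * ((val x2)%:Z - (val y2)%:Z) - v * ((val x1)%:Z - (val y1)%:Z) =
    (fy - (u * (val y2)%:Z - v * (val y1)%:Z)) - (fy - (u * (val x2)%:Z - v * (val x1)%:Z)) by ring.
  by rewrite rpredB.
by congr (_, _); apply: val_inj; apply: (@eq_of_dvdz N) => //; apply: ltn_ord.
Qed.

(** The coset is a discrete line of direction [(-b, a)], which leaves the Cantor
    set. *)
Lemma coset_gap a b : coprimez a b -> escape (- b, a) ->
  exists2 l : nat, (0 < l)%N & forall s, (#|@cantor_coset l a b s| < M ^ l)%N.
Proof.
move=> cab [k0 [E esc]]; exists (maxn k0 1); first by rewrite leq_max orbT.
set l := maxn k0 1 => s.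
have [c0|] := posnP #|@cantor_coset l a b s|; first by rewrite c0.
case/card_gt0P => x; rewrite !inE => /andP[_ Cx].
have [|t] := esc l 0%N (leq_maxl _ _) _ ((val x.1)%:Z, (val x.2)%:Z); first by rewrite mul0n.
move=> /(_ 0%N 0%N isT isT) /=; rewrite !addr0 => nX.
have [y1 y1E d1] := lo_ordz l ((val x.1)%:Z + t * - b).
have [y2 y2E d2] := lo_ordz l ((val x.2)%:Z + t * a).
apply: leq_trans (card_coset l s cab); apply: proper_card; apply/properP; split.
  by apply/fintype.subsetP => z; rewrite !inE => /andP[].
exists (y1, y2); rewrite !inE /=; last first.
  by move: nX; rewrite /cantor_int /= y1E y2E => /negPf ->.
have -> : a * (val y1)%:Z + b * (val y2)%:Z - s =
   a * ((val y1)%:Z - ((val x.1)%:Z + t * - b)) + b * ((val y2)%:Z - ((val x.2)%:Z + t * a))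
   + (a * (val x.1)%:Z + b * (val x.2)%:Z - s) by ring.
by apply: rpredD; [apply: rpredD; apply: dvdz_mull|].
Qed.

(** For fixed low digits, the high digits of the points of a coset form a coset of
    the same direction. *)
Lemma coset_step l k a b c1 c :
  (forall s, (#|@cantor_coset l a b s| <= c1)%N) ->
  (forall s, (#|@cantor_coset k a b s| <= c)%N) ->
  forall s, (#|@cantor_coset (l + k) a b s| <= c1 * c)%N.
Proof.
move=> H1 H2 s; apply: leq_trans (_ : #|@cantor_coset l a b s| * c <= _)%N; last first.
  by rewrite leq_mul2r H1 orbT.
have Ml0 : (M ^ l)%N%:Z != 0 by rewrite eqz_nat -lt0n.
have dec (x : nat) : x%:Z = (x %/ M ^ l)%N%:Z * (M ^ l)%N%:Z + (x %% M ^ l)%N%:Z.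
  by rewrite {1}(divn_eq x (M ^ l)) PoszD PoszM.
pose R (y : ord_pair M l) := @cantor_coset k a b
   ((s - a * (val y.1)%:Z - b * (val y.2)%:Z) %/ (M ^ l)%N%:Z)%Z.
have dMl : ((M ^ l)%N%:Z %| (M ^ (l + k))%N%:Z)%Z by rewrite expnD PoszM dvdz_mulr.
have low (x : ord_pair M (l + k)) : coset a b s x -> coset a b s (lo M_gt1 l (val2 x)).
  rewrite /coset /= => /(dvdz_trans dMl) H.
  set y1 := (_ %% _)%N; set y2 := (_ %% _)%N.
  have -> : a * y1%:Z + b * y2%:Z - s = (a * (val x.1)%:Z + b * (val x.2)%:Z - s) -
     (a * (val x.1 %/ M ^ l)%N%:Z + b * (val x.2 %/ M ^ l)%N%:Z) * (M ^ l)%N%:Z.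
    by rewrite (dec (val x.1)) (dec (val x.2)) -/y1 -/y2; ring.
  by rewrite rpredB // dvdz_mull.
have hlt (z : 'I_(M ^ (l + k))) : (z %/ M ^ l %% M ^ k = z %/ M ^ l)%N.
  by rewrite modn_small // div_expM_lt.
apply: (@card_split_hi M M_gt1 l k (cantor_coset a b s) (cantor_coset a b s) R c) => [x|x|y _].
- case/andP=> dx Cx; rewrite /cantor_coset /= low // andbT.
  by move: dx; rewrite cantor_digits_cat // => /andP[].
- case/andP=> dx Cx; have Clo := low _ Cx.
  rewrite /R /cantor_coset /=; apply/andP; split.
    move: dx; rewrite cantor_digits_cat // => /andP[_]; rewrite /val2 /=.
    by rewrite /= !hlt.
  move: Clo Cx; rewrite /coset /= !hlt; set y1 := (_ %% _)%N; set y2 := (_ %% _)%N => Clo Cx.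
  have /dvdzP[s' s'E] : ((M ^ l)%N%:Z %| s - a * y1%:Z - b * y2%:Z)%Z.
    have -> : s - a * y1%:Z - b * y2%:Z = - (a * y1%:Z + b * y2%:Z - s) by ring.
    by rewrite rpredN.
  rewrite s'E mulzK //.
  rewrite -(dvdz_mul2r Ml0) -PoszM mulnC -expnD.
  have sE : s = s' * (M ^ l)%N%:Z + a * y1%:Z + b * y2%:Z by rewrite -s'E; ring.
  rewrite [X in (_ %| X)%Z](_ : _ = a * (val x.1)%:Z + b * (val x.2)%:Z - s) //.
  by rewrite (dec (val x.1)) (dec (val x.2)) -/y1 -/y2 sE; ring.
- exact: H2.
Qed.

Lemma bernoulli_nat (m n : nat) : ((m ^ n) * (m + n) <= m.+1 ^ n * m)%N.
Proof.
elim: n => [|n IHn]; first by rewrite !expn0 addn0.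
rewrite !expnS; apply: leq_trans (_ : m.+1 * (m ^ n * (m + n)) <= _)%N; last first.
  by rewrite -mulnA leq_mul2l IHn orbT.
have -> : (m * m ^ n * (m + n.+1) = m ^ n * (m * (m + n.+1)))%N by lia.
rewrite [X in (_ <= X)%N]mulnCA leq_mul2l; apply/orP; right; lia.
Qed.

(** Bernoulli's inequality in the form [(1 + 1/m) ^ n >= 1 + n/m]. *)
Lemma exp_beats (m c : nat) n : (0 < m)%N -> (m * c <= n)%N -> (c * m ^ n <= m.+1 ^ n)%N.
Proof.
move=> m0 H; rewrite -(leq_pmul2r m0); apply: leq_trans (bernoulli_nat m n).
rewrite mulnAC mulnC leq_mul2l; apply/orP; right; lia.
Qed.

(** One level at which a coset is not contained in the Cantor set gives, by
    [coset_step], an exponential gain over [M ^ k]. *)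
Lemma coset_sparse a b : coprimez a b -> escape (- b, a) ->
  forall E : nat, exists k0 : nat, forall k s, (k0 <= k)%N ->
  (#|@cantor_coset k a b s| * E <= M ^ k)%N.
Proof.
move=> cab /(coset_gap cab) [l l0 gap] E.
pose c := (M ^ l).-1; have cE : c.+1 = (M ^ l)%N by rewrite prednK.
have iter n r s : (#|@cantor_coset (n * l + r) a b s| <= c ^ n * M ^ r)%N.
  elim: n s => [|n IHn] s.
    rewrite mul1n; apply: leq_trans (card_coset _ s cab).
    by apply: subset_leq_card; apply/fintype.subsetP => z; rewrite !inE => /andP[].
  rewrite mulSn expnS -mulnA -addnA.
  apply: (@coset_step l) => // s'; by rewrite -ltnS cE gap.
exists (c * E * l)%N => k s kE.
apply: leq_trans (_ : c ^ (k %/ l) * M ^ (k %% l) * E <= _)%N.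
  by rewrite leq_mul2r; have := iter (k %/ l)%N (k %% l)%N s; rewrite -divn_eq => ->; rewrite orbT.
rewrite [X in (_ <= M ^ X)%N](divn_eq k l) expnD mulnAC leq_mul2r; apply/orP; right.
rewrite mulnC [(k %/ l * l)%N]mulnC expnM -cE; apply: exp_beats; last by rewrite leq_divRL.
by rewrite -ltnS cE -(expn0 M) ltn_exp2l.
Qed.

End Cosets.

(** * Fourier series of functions on the points of the discrete torus *)

Lemma vandermonde_vanish (K : fieldType) (I : finType) (w om : I -> K) (m : nat) :
  {in [pred i | w i != 0] &, injective om} -> (#|[pred i | w i != 0%R]| <= m)%N ->
  (forall j, (j < m)%N -> \sum_i w i * om i ^+ j = 0) -> forall i, w i = 0.
Proof.
move=> inj Sm Z i0; apply/eqP; apply: contraT => w0.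
pose S := [pred i | w i != 0]; pose p := \prod_(i in [pred i | S i & i != i0]) ('X - (om i)%:P).
have szp : (size p <= m)%N.
  rewrite /p -big_enum size_prod_XsubC -cardE; apply: leq_trans Sm.
  rewrite (cardD1 i0 [pred i | w i != 0]) inE w0 add1n ltnS.
  by apply: subset_leq_card; apply/fintype.subsetP => i; rewrite !inE => /andP[-> ->].
have : \sum_i w i * p.[om i] = 0.
  under eq_bigr => i _ do rewrite (horner_coef_wide _ szp) mulr_sumr.
  rewrite exchange_big big1 //= => j _.
  under eq_bigr => i _ do rewrite mulrCA.
  by rewrite -mulr_sumr Z ?mulr0.
rewrite (bigD1 i0) //= big1 => [/eqP|i ii0].
  rewrite addr0 mulf_eq0 (negPf w0) /= horner_prod => /prodf_eq0[ i].
  rewrite !inE => /andP[wi ii0]; rewrite hornerXsubC subr_eq0 => /eqP e.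
  by case/eqP: ii0; apply: inj; rewrite ?inE.
have [->|wi] := eqVneq (w i) 0; first by rewrite mul0r.
rewrite horner_prod (bigD1 i) ?inE ?wi //=.
by rewrite hornerXsubC subrr mul0r mulr0.
Qed.

(** A polynomial with partial degrees at most [D] has [(D + 1) ^ 2] coefficients,
    more than the number of conditions. *)
Lemma vanishing_poly (K : closedFieldType) (I : finType) (S : {set I}) (pts : I -> K * K) D :
  (#|S| < D.+1 ^ 2)%N -> exists G, [/\ G != 0, (degx G <= D)%N, (degy G <= D)%N &
    forall i, i \in S -> ev G (pts i) = 0].
Proof.
move=> SD; pose J := ('I_D.+1 * 'I_D.+1)%type.
pose X : 'M[K]_(#|{: J}|, #|S|) := \matrix_(r < #|{: J}|, c < #|S|)
  ((pts (enum_val c)).1 ^+ (enum_val r).1 * (pts (enum_val c)).2 ^+ (enum_val r).2).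
have cJ : #|{: J}| = (D.+1 ^ 2)%N by rewrite card_prod card_ord mulnn.
have /rowV0Pn[v /sub_kermxP vX v0] : kermx X != 0.
  rewrite -mxrank_eq0 mxrank_ker subn_eq0 -ltnNge.
  by apply: leq_ltn_trans (rank_leq_col _) _; rewrite cJ.
pose cf (i j : nat) : K := if insub i is Some i' then if insub j is Some j' then
   v 0 (enum_rank ((i', j') : J)) else 0 else 0.
have cfE (i j : 'I_D.+1) : cf i j = v 0 (enum_rank ((i, j) : J)).
  by rewrite /cf !valK.
pose G : {poly {poly K}} := \poly_(i < D.+1) \poly_(j < D.+1) cf i j.
have GE i j : G`_i`_j = if (i < D.+1)%N && (j < D.+1)%N then cf i j else 0.
  by rewrite coef_poly; case: ifP => _; rewrite ?coef0 // coef_poly.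
have dx : (degx G <= D)%N by apply/degx_leP => i j Di; rewrite GE ltnS leqNgt Di.
have dy : (degy G <= D)%N by apply/degy_leP => i j Di; rewrite GE !ltnS andbC leqNgt Di.
exists G; split=> //.
  apply: contra_neq v0 => G0; apply/rowP => r; rewrite mxE.
  have [[i j] ->] : exists ij, r = enum_rank (ij : J) by exists (enum_val r); rewrite enum_valK.
  by rewrite -cfE; have := GE i j; rewrite !ltn_ord G0 !coef0.
move=> i iS; have /rowP/(_ (enum_rank_in iS i)) := vX.
rewrite !mxE => e; rewrite -[RHS]e /ev.
rewrite (@horner_coef_wide _ D.+1 G); last by move: dx; rewrite /degx -subn1 leq_subLR add1n.
rewrite horner_sum.
have ycoef (l : 'I_D.+1) : (G`_l * (pts i).1%:P ^+ l).[(pts i).2] =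
    \sum_(j < D.+1) cf l j * (pts i).1 ^+ l * (pts i).2 ^+ j.
  rewrite hornerM -polyC_exp hornerC (@horner_coef_wide _ D.+1 G`_l); last first.
    by apply/leq_sizeP => j Dj; rewrite GE ltn_ord /= ltnNge Dj.
  rewrite mulr_suml; apply: eq_bigr => j _.
  by rewrite GE !ltn_ord /= mulrAC.
under eq_bigr do rewrite ycoef.
rewrite pair_bigA /= (reindex (@enum_val _ {: J})) /=; last first.
  by exists enum_rank => x _; rewrite ?enum_valK ?enum_rankK.
apply: eq_bigr => r _; rewrite !mxE enum_rankK_in // cfE -surjective_pairing enum_valK.
by rewrite mulrA.
Qed.

Lemma expz_mod (K : fieldType) (u : K) (N : nat) (m n : int) : u != 0 -> u ^+ N = 1 ->
  (N%:Z %| m - n)%Z -> u ^ m = u ^ n.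
Proof.
move=> u0 uN /dvdzP[q qE]; have -> : m = N%:Z * q + n by rewrite mulrC -qE subrK.
by rewrite expfzDr // -exprz_exp -exprnP uN exp1rz mul1r.
Qed.

Section Fhat.
Variables (M : nat) (A : {set 'I_M * 'I_M}).
Hypothesis M_gt1 : (1 < M)%N.
Variable K : closedFieldType.

Let M0 : (0 < M)%N. Proof. exact: ltnW. Qed.
Let expM0 k : (0 < M ^ k)%N. Proof. by rewrite expn_gt0 M0. Qed.

Section Fixed.
Variables (k : nat) (zeta : K).
Hypothesis zetaP : (M ^ k)%N.-primitive_root zeta.
Local Notation I := (ord_pair M k).
Local Notation pt := (@pt K (M ^ k)%N zeta).
Implicit Types (F H : I -> K) (z : int * int).

Let tor (i : I) : (pt i).1 != 0 /\ (pt i).2 != 0.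
Proof. exact: (pt_torus zetaP). Qed.

(** The transform is indexed by all integers so that translations need no reduction
    modulo [M ^ k]. *)
Definition fhat H z := \sum_i H i * ((pt i).1 ^ z.1 * (pt i).2 ^ z.2).

(** Multiplication by a polynomial is a combination of translations on the Fourier
    side. *)
Lemma fhat_poly H (p : {poly {poly K}}) z : fhat (fun i => ev p (pt i) * H i) z =
  \sum_(a < (degx p).+1) \sum_(b < (degy p).+1) p`_a`_b * fhat H (z.1 + a%:Z, z.2 + b%:Z).
Proof.
rewrite /fhat.
under eq_bigr => i _ do rewrite ev_coef mulr_suml mulr_suml.
rewrite exchange_big; apply: eq_bigr => a _.
under eq_bigr => i _ do rewrite mulr_suml mulr_suml.
rewrite exchange_big; apply: eq_bigr => b _.
rewrite mulr_sumr; apply: eq_bigr => i _.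
by have [z1 z2] := tor i; rewrite !expfzDr // -!exprnP; ring.
Qed.

Lemma fhat_inj H : (forall z, fhat H z = 0) -> forall i, H i = 0.
Proof.
move=> Z i; have [p [p0 pz]] := separating_poly [seq pt j | j <- enum {: I}] (pt i).
have : fhat (fun i => ev p (pt i) * H i) (0, 0) = 0.
  by rewrite fhat_poly big1 // => a _; rewrite big1 // => b _; rewrite Z mulr0.
rewrite /fhat (bigD1 i) //= big1 => [|j ji].
  by rewrite !expr0z !mulr1 addr0 => /eqP; rewrite mulf_eq0 (negPf p0) => /eqP.
rewrite pz ?mul0r //; first by apply: map_f; rewrite mem_enum.
by apply: contra_neq ji => /(pt_inj zetaP).
Qed.

Lemma fhat_mod H z w : ((M ^ k)%N%:Z %| z.1 - w.1)%Z -> ((M ^ k)%N%:Z %| z.2 - w.2)%Z ->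
  fhat H z = fhat H w.
Proof.
move=> d1 d2; apply: eq_bigr => i _; have [z1 z2] := tor i; congr (_ * (_ * _)).
  by apply: (@expz_mod _ _ (M ^ k)%N) => //; rewrite exprAC (prim_expr_order zetaP) expr1n.
by apply: (@expz_mod _ _ (M ^ k)%N) => //; rewrite exprAC (prim_expr_order zetaP) expr1n.
Qed.

Lemma fhat_supp F : (forall x : I, fhat F ((val x.1)%:Z, (val x.2)%:Z) != 0 ->
  cantor_digits A k (val2 x)) -> forall z, fhat F z != 0 -> cantor_int A k z.
Proof.
move=> FX z; have [x1 e1 d1] := lo_ordz M_gt1 k z.1; have [x2 e2 d2] := lo_ordz M_gt1 k z.2.
rewrite /cantor_int e1 e2 -(@fhat_mod F ((val x1)%:Z, (val x2)%:Z)) // => /(FX (x1, x2)) //.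
Qed.

Variable F : I -> K.
Hypothesis F_hat : forall x : I, fhat F ((val x.1)%:Z, (val x.2)%:Z) != 0 ->
  cantor_digits A k (val2 x).

Lemma fhat_poly_supp (h : {poly {poly K}}) z : fhat (fun i => ev h (pt i) * F i) z != 0 ->
  exists a b : nat, [/\ (a <= degx h)%N, (b <= degy h)%N & cantor_int A k (z.1 + a%:Z, z.2 + b%:Z)].
Proof.
rewrite fhat_poly; apply: contra_neqP => nex; apply: big1 => a _; apply: big1 => b _.
have [->|nz] := eqVneq (fhat F (z.1 + (val a)%:Z, z.2 + (val b)%:Z)) 0; first by rewrite mulr0.
case: nex; exists (val a), (val b); split; [exact: (ltn_ord a)|exact: (ltn_ord b)|].
exact: fhat_supp nz.
Qed.

(** On the support of [H], the character of exponent [(a, b)] is the constant [c]. *)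
Lemma fhat_shift H (a b s : int) (c : K) z : c != 0 ->
  (forall i, H i != 0 -> (pt i).1 ^ a * (pt i).2 ^ b = c) ->
  fhat H (z.1 + s * a, z.2 + s * b) = c ^ s * fhat H z.
Proof.
move=> c0 Hc; rewrite /fhat mulr_sumr; apply: eq_bigr => i _.
have [->|nz] := eqVneq (H i) 0; first by rewrite !mul0r mulr0.
have [z1 z2] := tor i.
rewrite /= !expfzDr // -(Hc i nz) expfzMl !exprz_exp [a * s]mulrC [b * s]mulrC; ring.
Qed.

(** A function supported on a coset has a transform whose zero set is invariant
    under [(a, b)], so the nonzero values of the transform give a whole line near
    the Cantor set. *)
Lemma coset_line (h : {poly {poly K}}) (a b : int) c D : (wt h <= D)%N ->
  (exists i, ev h (pt i) * F i != 0) ->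
  (forall i, ev h (pt i) * F i != 0 -> (pt i).1 ^ a * (pt i).2 ^ b = c) ->
  c != 0 /\ exists p : int * int, forall s : int,
    exists i j : nat, [/\ (i <= D)%N, (j <= D)%N &
      cantor_int A k (p.1 + s * a + i%:Z, p.2 + s * b + j%:Z)].
Proof.
move=> wh [i0 hi0] Hc.
have c0 : c != 0.
  by rewrite -(Hc i0 hi0); have [z1 z2] := tor i0; rewrite mulf_neq0 // expfz_neq0.
split=> //.
have [p hp] : exists p, fhat (fun i => ev h (pt i) * F i) p != 0.
  apply/not_existsP => Z; move/eqP: hi0; apply.
  by apply: (@fhat_inj (fun i => ev h (pt i) * F i)) => z; apply/eqP; rewrite -[_ == _]negbK; apply/negP/Z.
exists p => s.
have /fhat_poly_supp [i [j [hi hj H]]] : fhat (fun i => ev h (pt i) * F i) (p.1 + s * a, p.2 + s * b) != 0.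
  by rewrite (@fhat_shift _ a b s c) // mulf_neq0 // expfz_neq0.
by exists i, j; split=> //; move: wh; rewrite /wt; lia.
Qed.

Lemma prim_dvdz (z : int) : zeta ^ z = 1 -> ((M ^ k)%N%:Z %| z)%Z.
Proof.
case: (intP z) => [|n|n]; first by rewrite dvdz0.
  by rewrite -exprnP => e; rewrite dvdzE /= (prim_order_dvd zetaP) e.
rewrite -invr_expz -exprnP => /eqP; rewrite invr_eq1 => e.
by rewrite rpredN dvdzE /= (prim_order_dvd zetaP).
Qed.

Lemma pt_exp (i : I) (u v : int) : (pt i).1 ^ u * (pt i).2 ^ v =
  zeta ^ (u * (val i.1)%:Z + v * (val i.2)%:Z).
Proof.
have z0 := zeta_neq0 zetaP.
by rewrite /pt /= !exprnP !exprz_exp -expfzDr // mulrC [u * _]mulrC [v * _]mulrC mulrC.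
Qed.

Lemma pt_exp_eq (i j : I) (u v : int) :
  (pt i).1 ^ u * (pt i).2 ^ v = (pt j).1 ^ u * (pt j).2 ^ v ->
  ((M ^ k)%N%:Z %| u * ((val i.1)%:Z - (val j.1)%:Z) + v * ((val i.2)%:Z - (val j.2)%:Z))%Z.
Proof.
have z0 := zeta_neq0 zetaP.
rewrite !pt_exp => E; apply: prim_dvdz.
have -> : u * ((val i.1)%:Z - (val j.1)%:Z) + v * ((val i.2)%:Z - (val j.2)%:Z) =
  (u * (val i.1)%:Z + v * (val i.2)%:Z) + - (u * (val j.1)%:Z + v * (val j.2)%:Z) by ring.
by rewrite expfzDr // -invr_expz E divff // expfz_neq0.
Qed.

End Fixed.
End Fhat.

(** * Functions localized in position and in frequency *)

Section Qualitative.
Variables (M : nat) (A : {set 'I_M * 'I_M}).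
Hypothesis M_gt1 : (1 < M)%N.
Hypothesis A_proper : A \proper [set: 'I_M * 'I_M].
Variable K : closedFieldType.

Let M0 : (0 < M)%N. Proof. exact: ltnW. Qed.
Let expM0 k : (0 < M ^ k)%N. Proof. by rewrite expn_gt0 M0. Qed.

Definition phase_localized k (zeta : K) (F : ord_pair M k -> K) :=
  [/\ forall x, F x != 0 -> cantor_digits A k (val2 x) &
      forall x : ord_pair M k, fhat zeta F ((val x.1)%:Z, (val x.2)%:Z) != 0 ->
        cantor_digits A k (val2 x)].

(** For the direction [(a, b)], the support of a nonzero [h * F] cannot lie on a
    coset [a * xi1 + b * xi2 = s] as soon as [k] and [M ^ k / D] are at least [n]. *)
Definition excluded n (a b : int) := forall k D, (n <= k)%N -> (D * n <= M ^ k)%N ->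
  forall (zeta : K), (M ^ k)%N.-primitive_root zeta -> forall F : ord_pair M k -> K, phase_localized zeta F ->
  forall (h : {poly {poly K}}) c, (wt h <= D)%N ->
  (forall i, ev h (pt zeta i) * F i != 0 -> (pt zeta i).1 ^ a * (pt zeta i).2 ^ b = c) ->
  forall i, ev h (pt zeta i) * F i = 0.

Lemma excluded_mono n n' a b : (n <= n')%N -> excluded n a b -> excluded n' a b.
Proof.
move=> nn' H k D nk Dn; apply: H; first exact: leq_trans nn' nk.
by apply: leq_trans Dn; rewrite leq_mul2l nn' orbT.
Qed.

Lemma escape_excluded a b : escape A (a, b) -> exists n, excluded n a b.
Proof.
move=> [k0 [E esc]]; exists (maxn k0 E) => k D nk Dn zeta zP F [FX FhX] h c wh Hc i.
apply/eqP; apply: contraT => hi.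
have [_ [p pP]] := coset_line M_gt1 zP FhX wh (ex_intro _ i hi) Hc.
have [||s sP] := esc k D _ _ p.
- by apply: leq_trans nk; rewrite leq_maxl.
- by apply: leq_trans Dn; rewrite leq_mul2l leq_maxr orbT.
by have [a' [b' [h1 h2]]] := pP s; rewrite (negPf (sP _ _ h1 h2)).
Qed.

(** The coset meets the Cantor set in few points, on which the character along [(-v,
    u)] is injective when [a * u + b * v = 1].  The transform along the progression
    of step [(-v, u)] is thus a Vandermonde system in the values of [h * F], and
    cannot vanish as many times as there are points. *)
Lemma escape_perp_excluded a b : coprimez a b -> escape A (- b, a) -> exists n, excluded n a b.
Proof.
move=> cab esc; have [[u v] /= uv0] := coprimezP _ _ cab.
have uv : a * u + b * v = 1 by rewrite mulrC [b * _]mulrC.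
have [al [be [alM beM hole]]] := exists_hole A_proper.
(* The progression of step (-v, u), with as many terms as there are points in the
   coset, must fit in the box. *)
pose C := (100 * M * (`|u| + `|v| + 1))%N.
have [k0 sparse] := coset_sparse M_gt1 cab esc C.
exists (maxn k0 (100 * M)) => -[|k] D nk Dn zeta zP F [FX FhX] h c wh Hc.
  by move: nk; rewrite leqn0; lia.
pose H i := ev h (pt zeta i) * F i.
have zeta0 := zeta_neq0 zP.
have [[i0 Hi0]|] := pselect (exists i, H i != 0); last first.
  by move=> nex i; apply/eqP; apply: contra_notT nex => hi; exists i.
have [c0 _] := coset_line M_gt1 zP FhX wh (ex_intro _ i0 Hi0) Hc.
pose s := a * (val i0.1)%:Z + b * (val i0.2)%:Z.
pose S := [pred i | H i != 0].
have cosetS i : H i != 0 -> ((M ^ k.+1)%N%:Z %| a * (val i.1)%:Z + b * (val i.2)%:Z - s)%Z.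
  move=> hi; have := @pt_exp_eq _ _ _ _ zP i i0 a b; rewrite Hc // Hc // => /(_ erefl).
  by congr (_ %| _)%Z; rewrite /s; ring.
have SC : (#|S| * C <= M ^ k.+1)%N.
  apply: leq_trans (sparse k.+1 s _); last by apply: leq_trans nk; rewrite leq_maxl.
  rewrite leq_mul2r; apply/orP; right; apply: subset_leq_card; apply/fintype.subsetP => i.
  rewrite !inE => hi; apply/andP; split; last exact: cosetS; apply: FX.
  by apply: contra_neq hi => e; rewrite /H e mulr0.
pose L := (M ^ k)%N.
have SL : (#|S| * (100 * (`|u| + `|v| + 1)) <= L)%N.
  rewrite -(leq_pmul2l M0) -expnS; apply: leq_trans SC.
  by rewrite /C; apply/eq_leq; lia.
have DL : (100 * D <= L)%N.
  rewrite -(leq_pmul2l M0) -expnS; apply: leq_trans Dn.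
  apply: leq_trans (_ : D * (100 * M) <= _)%N; first by apply/eq_leq; lia.
  by rewrite leq_mul2l leq_maxr orbT.
have S1 : (0 < #|S|)%N by apply/card_gt0P; exists i0; rewrite inE.
(* The middle of the box. *)
pose x0 := (al%:Z * L%:Z + (L %/ 2)%N%:Z, be%:Z * L%:Z + (L %/ 2)%N%:Z).
have Z j : (j < #|S|)%N -> fhat zeta H (x0.1 + j%:Z * - v, x0.2 + j%:Z * u) = 0.
  move=> jS; apply/eqP; apply: contraT => /(fhat_poly_supp M_gt1 zP FhX) [i1 [i2 [d1 d2]]].
  apply: contraLR => _.
  have [w1 w2] : (i1 <= D)%N /\ (i2 <= D)%N by move: wh; rewrite /wt; lia.
  have ju : (j * `|u| * 100 <= L)%N by nia.
  have jv : (j * `|v| * 100 <= L)%N by nia.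
  have L100 : (100 <= L)%N by nia.
  have ju' : `|j%:Z * u| * 100 <= L%:Z by rewrite normrM; lia.
  have jv' : `|j%:Z * - v| * 100 <= L%:Z by rewrite normrM normrN; lia.
  apply: (hole_notin M_gt1 alM beM hole (n1 := 0) (n2 := 0)) => /=.
    rewrite mulr0 subr0 mulrDl mul1r -/L; move: jv'; set t := _ * - v; clearbody t => jv'.
    apply/andP; split; lia.
  rewrite mulr0 subr0 mulrDl mul1r -/L; move: ju'; set t := _ * u; clearbody t => ju'.
  apply/andP; split; lia.
pose w i := H i * ((pt zeta i).1 ^ x0.1 * (pt zeta i).2 ^ x0.2).
pose om (i : ord_pair M k.+1) := (pt zeta i).1 ^ (- v) * (pt zeta i).2 ^ u.
have wH i : (w i == 0) = (H i == 0).
  have [z1 z2] := pt_torus zP i.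
  by rewrite /w !mulf_eq0 (negPf (expfz_neq0 _ z1)) (negPf (expfz_neq0 _ z2)) !orbF.
suff w0 : forall i, w i = 0 by move=> i; apply/eqP; rewrite -wH w0.
apply: (@vandermonde_vanish K (ord_pair M k.+1) w om #|S|).
- move=> i j; rewrite !inE !wH => hi hj /(pt_exp_eq zP) /= E1.
  have E2 : ((M ^ k.+1)%N%:Z %| a * ((val i.1)%:Z - (val j.1)%:Z) + b * ((val i.2)%:Z - (val j.2)%:Z))%Z.
    by apply: (pt_exp_eq zP); rewrite !Hc.
  have [|d1 d2] := unimodular_dvd uv E2; first by move: E1; rewrite mulNr addrC.
  case: i j d1 d2 {hi hj E1 E2} => [i1 i2] [j1 j2] /= d1 d2.
  by congr (_, _); apply: val_inj; [apply: (eq_of_dvdz _ _ d1)|apply: (eq_of_dvdz _ _ d2)]; apply: ltn_ord.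
- apply: subset_leq_card; apply/fintype.subsetP => i; by rewrite !inE wH.
- move=> j jS; rewrite -[RHS](Z j jS); apply: eq_bigr => i _.
  have [z1 z2] := pt_torus zP i.
  rewrite /w /om -mulrA; congr (_ * _); rewrite exprnP expfzMl !exprz_exp mulrACA.
  by rewrite -!expfzDr // [- v * _]mulrC [u * _]mulrC.
Qed.

Lemma excluded_uniform (B : nat) :
  (forall a b, coprimez a b -> escape A (a, b) \/ escape A (- b, a)) ->
  exists n, forall a b, coprimez a b -> (`|a| < B)%N -> (`|b| < B)%N -> excluded n a b.
Proof.
move=> esc.
have /choice [f fP] : forall ab : int * int, exists n, coprimez ab.1 ab.2 -> excluded n ab.1 ab.2.
  move=> [a b] /=; have [cab|ncab] := pselect (coprimez a b); last by exists 0%N.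
  have [/escape_excluded[n nP]|/(escape_perp_excluded cab)[n nP]] := esc a b cab; by exists n.
pose g (i j : nat) := f (i%:Z - B%:Z, j%:Z - B%:Z).
exists (\max_(i < 2 * B) \max_(j < 2 * B) g i j)%N => a b cab aB bB.
apply: excluded_mono (fP (a, b) cab).
have [i iE] : exists i : nat, a = i%:Z - B%:Z by exists `|(a + B%:Z)%R|%N; lia.
have [j jE] : exists i : nat, b = i%:Z - B%:Z by exists `|(b + B%:Z)%R|%N; lia.
have iB : (i < 2 * B)%N by lia.
have jB : (j < 2 * B)%N by lia.
have -> : f (a, b) = g i j by rewrite /g -iE -jE.
apply: leq_trans (leq_bigmax (Ordinal iB)) => /=.
by apply: leq_trans (leq_bigmax (Ordinal jB)).
Qed.

End Qualitative.

Lemma box_corner (a L i : nat) : (i < L)%N ->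
  a%:Z * L%:Z <= a%:Z * L%:Z + i%:Z < (a%:Z + 1) * L%:Z.
Proof. by move=> iL; rewrite mulrDl mul1r lerDl ltrD2l ltz_nat iL. Qed.

(** For large [k], [isolate_or_coset] is applied to a curve of degree at most [D]
    through the discrete Cantor set; each of its outcomes contradicts the absence of
    the transform from a neighbourhood of a box or of a line. *)
Theorem no_phase_localized (M : nat) (A : {set 'I_M * 'I_M}) : (1 < M)%N ->
  A \proper [set: 'I_M * 'I_M] ->
  (forall a b, coprimez a b -> escape A (a, b) \/ escape A (- b, a)) ->
  exists2 k : nat, (0 < k)%N & forall zeta : algC, (M ^ k)%N.-primitive_root zeta ->
    forall F : ord_pair M k -> algC, phase_localized A zeta F -> forall x, F x = 0.
Proof.
move=> M_gt1 A_proper esc.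
have M0 : (0 < M)%N by apply: ltnW.
have [n nP] := excluded_uniform M_gt1 A_proper algC (4 * M) esc.
have [al [be [alM beM hole]]] := exists_hole A_proper.
(* E bounds M ^ k / D from below: D must be small compared with the box, and
   admissible for excluded.  The level k is then so large that the Cantor set has
   less than (M ^ k / (2 E)) ^ 2 points. *)
pose E := (n + 100 * M * (M + 5))%N.
pose m := (M ^ 2).-1; have mE : m.+1 = (M ^ 2)%N by rewrite prednK // expn_gt0 M0.
have m0 : (0 < m)%N by rewrite -ltnS mE -[1%N](expn0 M) ltn_exp2l.
pose k := (n + m * (2 * E) ^ 2).-1.+1.
have E0 : (0 < E)%N by rewrite /E; nia.
have kE : k = (n + m * (2 * E) ^ 2)%N by rewrite /k prednK // addn_gt0 muln_gt0 m0 expn_gt0 muln_gt0 E0 orbT.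
exists k => // zeta zP F FL x; apply/eqP; apply: contraT => Fx.
have [FX FhX] := FL.
pose D0 := (M ^ k %/ (2 * E))%N; pose D := (2 * D0)%N.
have DE : (D * E <= M ^ k)%N.
  by rewrite /D mulnAC mulnC leq_divM.
have [G [G0 dGx dGy Gv]] : exists G, [/\ G != 0, (degx G <= D0)%N, (degy G <= D0)%N &
    forall i, i \in [set x : ord_pair M k | cantor_digits A k (val2 x)] -> ev G (pt zeta i) = 0].
  apply: vanishing_poly; rewrite cardsE.
  apply: leq_ltn_trans (card_cantor_le M_gt1 A_proper mE k) _.
  have h1 : ((2 * E) ^ 2 * m ^ k <= (M ^ k) ^ 2)%N.
    by rewrite -expnM mulnC [(k * 2)%N]mulnC expnM -mE mulnC; apply: exp_beats => //; rewrite kE leq_addl.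
  have h2 : (M ^ k < D0.+1 * (2 * E))%N by rewrite ltn_ceil // muln_gt0 E0.
  have h3 : ((M ^ k) ^ 2 < (D0.+1 * (2 * E)) ^ 2)%N by rewrite ltn_sqr.
  have E20 : (0 < (2 * E) ^ 2)%N by rewrite expn_gt0 muln_gt0 E0.
  rewrite -(ltn_pmul2l E20); apply: leq_ltn_trans h1 _.
  by rewrite mulnC -expnMn.
have wG : (wt G <= D)%N by rewrite /wt /D mul2n -addnn leq_add.
have GF i : ev G (pt zeta i) * F i = 0.
  have [->|Fi] := eqVneq (F i) 0; first by rewrite mulr0.
  by rewrite Gv ?mul0r // inE; apply: FX.
have [sigma sigmaP] : {u : {rmorphism algC -> algC} | forall z, z ^+ (M ^ k) = 1 -> u z = z ^+ M.+1}.
  by apply: Qn_aut_exists; rewrite coprimeXr // coprimeSn.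
have prim n' : (0 < n')%N -> exists w : algC, n'.-primitive_root w.
  by move=> /C_prim_root_exists[w wP]; exists w.
have q1 : (1 < M.+1)%N by rewrite ltnS.
have [h [wh [i0 hi0] [[p [i1 [dpx dpy pi1 piz]]]|[a [b [c [cab aD bD Hc]]]]]]] :=
  isolate_or_coset q1 prim zP (sigmaP _ (prim_expr_order zP)) (ex_intro _ x Fx) G0 GF wG.
- pose L := (M ^ k.-1)%N.
  have NL : (M ^ k = M * L)%N by rewrite -expnS.
  have L0 : (0 < L)%N by rewrite expn_gt0 M0.
  have DL : ((M + 3) * D < L)%N.
    have [->|D00] := posnP D; first by rewrite muln0.
    rewrite -(ltn_pmul2l M0) -NL; apply: leq_trans DE.
    rewrite mulnA mulnC ltn_pmul2l // /E; clear -M0; nia.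
  pose x0 := (al%:Z * L%:Z, be%:Z * L%:Z).
  have : fhat zeta (fun i => ev (p * h) (pt zeta i) * F i) x0 != 0.
    rewrite /fhat (bigD1 i1) //= big1 => [|i ii1]; last first.
      by rewrite evM -(mulrA (ev p _)) piz // mul0r.
    have [z1 z2] := pt_torus zP i1.
    by rewrite addr0 evM -(mulrA (ev p _)) mulf_neq0 // mulf_neq0 // expfz_neq0.
  case/(fhat_poly_supp M_gt1 zP FhX) => i [j [hi hj]].
  have p0 : p != 0 by apply: contra_neq pi1 => ->; rewrite /ev !horner0 mul0r.
  have h0 : h != 0 by apply: contra_neq hi0 => ->; rewrite /ev !horner0 mul0r.
  rewrite degxM // in hi; rewrite degyM // in hj.
  have bound d e : (d <= M.+2 * D)%N -> (e <= wt h)%N -> (d + e < L)%N.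
    move=> d1 e1; apply: leq_ltn_trans DL; rewrite addn3 mulSnr.
    by apply: leq_add => //; apply: leq_trans wh.
  have iL := leq_ltn_trans hi (bound _ _ dpx (leq_addr _ _)).
  have jL := leq_ltn_trans hj (bound _ _ dpy (leq_addl _ _)).
  apply: contraLR => _; apply: (hole_notin M_gt1 alM beM hole (n1 := 0) (n2 := 0)) => /=.
    by rewrite mulr0 subr0 box_corner.
  by rewrite mulr0 subr0 box_corner.
have ex := coset_line M_gt1 zP FhX wh (ex_intro _ i0 hi0) Hc.
have [_ [p pP]] := ex.
have [big|small] := boolP ((4 * M <= `|a|) || (4 * M <= `|b|))%N; last first.
  move: small; rewrite negb_or -!ltnNge => /andP[aB bB].
  case/negP: hi0; apply/eqP; apply: (nP a b cab aB bB k D) => //.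
  - by rewrite kE leq_addr.
  - by apply: leq_trans DE; rewrite leq_mul2l /E leq_addr orbT.
  - exact: Hc.
have [|s sP] := hit_hole M_gt1 (k := k.-1) A_proper cab aD bD big _ p.
  apply: leq_trans DE; rewrite mulnC leq_mul2l /E; apply/orP; right; clear; nia.
by have [i [j [h1 h2]]] := pP s; rewrite (negPf (sP _ _ h1 h2)).
Qed.

(** * Base M expansions *)

Local Open Scope classical_set_scope.
Local Open Scope ring_scope.

(** Finitely many fibres cover the indices, so the ultrafilter contains one of them. *)
Lemma ultra_finType (T : finType) (f : nat -> T) (G : set_system nat) :
  UltraFilter G -> exists a, G [set n | f n = a].
Proof.
move=> GU; apply: contrapT => /forallNP H.
have Hc a : G (~` [set n | f n = a]).
  by have [/H|] := in_ultra_setVsetC [set n | f n = a] GU.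
suff : forall s : seq T, G [set n | f n \notin s].
  move=> /(_ (enum T)) Gs; have [n] := filter_ex Gs.
  by rewrite /= mem_enum.
elim=> [|a s IHs]; first by apply: filterS filterT => n _.
apply: filterS2 (Hc a) IHs => n /= na ns; rewrite inE negb_or ns andbT.
exact/eqP.
Qed.

Section Expansion.
Variables (R : realType) (M : nat).
Hypothesis M_gt1 : (1 < M)%N.
Local Notation m := (M%:R : R).

Lemma Mr_gt0 : 0 < m. Proof. by rewrite ltr0n ltnW. Qed.

Definition expsum (a : nat -> 'I_M) (n : nat) : R := \sum_(0 <= j < n) (a j)%:R / m ^+ j.+1.

Lemma expsumS a n : expsum a n.+1 = expsum a n + (a n)%:R / m ^+ n.+1.
Proof. by rewrite /expsum big_nat_recr. Qed.

Lemma expsum_incr a : nondecreasing_seq (expsum a).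
Proof.
apply/nondecreasing_seqP => n; rewrite /expsum big_nat_recr //= lerDl.
by rewrite mulr_ge0 // invr_ge0 exprn_ge0 // ltW // Mr_gt0.
Qed.

Lemma expsum_tail a n k : expsum a (n + k) + (m ^+ (n + k))^-1 <= expsum a n + (m ^+ n)^-1.
Proof.
elim: k => [|k IHk]; first by rewrite addn0.
apply: le_trans IHk; rewrite addnS /expsum big_nat_recr //= -addrA lerD2l.
have m0 := Mr_gt0.
rewrite -[X in _ + X]mul1r -mulrDl exprS invfM mulrA; apply: ler_piMl.
  by rewrite invr_ge0 exprn_ge0 // ltW.
by rewrite ler_pdivrMr // mul1r natr1 ler_nat; exact: ltn_ord.
Qed.

Lemma expansion_bound a n : `|expansion R a - expsum a n| <= (m ^+ n)^-1.
Proof.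
have m0 := Mr_gt0.
have inv0 j : 0 < (m ^+ j)^-1 by rewrite invr_gt0 exprn_gt0.
have ub k : expsum a k <= expsum a n + (m ^+ n)^-1.
  have [nk|kn] := leqP n k.
    have := expsum_tail a n (k - n); rewrite subnKC //; apply: le_trans.
    by rewrite lerDl ltW.
  by apply: (le_trans (expsum_incr a (ltnW kn))); rewrite lerDl ltW.
have cv : cvgn (expsum a).
  apply: nondecreasing_is_cvgn; first exact: expsum_incr.
  by exists (expsum a n + (m ^+ n)^-1) => _ [k _ <-].
have -> : expansion R a = limn (expsum a) by [].
have h1 : expsum a n <= limn (expsum a) by apply: nondecreasing_cvgn_le; [exact: expsum_incr|exact: cv].
have h2 : limn (expsum a) <= expsum a n + (m ^+ n)^-1.
  by apply: limr_le => //; apply: nearW.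
by rewrite ger0_norm ?subr_ge0 // lerBlDl.
Qed.

(** The digits of [x < M ^ k], the most significant one coming first. *)
Definition topdig (k : nat) (x : nat) (j : nat) : 'I_M :=
  Ordinal (ltn_pmod (x %/ M ^ (k - j.+1)) (ltnW M_gt1)).

Lemma topdig_sum k x n : (x < M ^ k)%N -> (n <= k)%N ->
  expsum (topdig k x) n = (x %/ M ^ (k - n))%:R / m ^+ n.
Proof.
move=> xk; elim: n => [|n IHn] nk.
  by rewrite /expsum big_geq // subn0 divn_small // mul0r.
rewrite expsumS IHn ?(ltnW nk) //.
have m0 := gt_eqF Mr_gt0.
have -> : (k - n = (k - n.+1).+1)%N by rewrite subnSK.
rewrite expnSr divnMA; set y := (x %/ _)%N.
rewrite {2}(divn_eq y M) natrD natrM exprSr mulrDl; congr (_ + _).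
by rewrite -mulf_div divff ?mulr1 // gt_eqF // Mr_gt0.
Qed.

Lemma topdig_bound k x n (d : nat -> 'I_M) : (x < M ^ k)%N -> (n <= k)%N ->
  (forall j, (j < n)%N -> topdig k x j = d j) ->
  `|x%:R / m ^+ k - expansion R d| <= 2 * (m ^+ n)^-1.
Proof.
move=> xk nk H.
have m0 := Mr_gt0.
have E : expsum d n = (x %/ M ^ (k - n))%:R / m ^+ n.
  by rewrite -topdig_sum // /expsum; apply: eq_big_nat => j /andP[_ jn]; rewrite H.
have h1 := expansion_bound d n.
have h2 : `|x%:R / m ^+ k - expsum d n| <= (m ^+ n)^-1.
  have kn : m ^+ k = m ^+ n * m ^+ (k - n) by rewrite -exprD subnKC.
  rewrite E {1}(divn_eq x (M ^ (k - n))) natrD natrM natrX kn mulrDl -mulf_div divff ?expf_neq0 ?gt_eqF //.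
  rewrite mulr1 addrC addKr ger0_norm; last by rewrite divr_ge0 // mulr_ge0 // exprn_ge0 // ltW.
  rewrite ler_pdivrMr; last by rewrite mulr_gt0 // exprn_gt0.
  rewrite mulrA mulVf ?expf_neq0 ?gt_eqF // mul1r -natrX ler_nat ltnW // ltn_mod expn_gt0 ltnW //.
rewrite -(subrK (expsum d n) (_ / _)) -addrA mulr2n mulrDl mul1r.
apply: le_trans (ler_normD _ _) _; apply: lerD => //.
by rewrite distrC.
Qed.

End Expansion.

(** * Limits of discrete lines *)

Section Lines.
Variables (R : realType) (M : nat) (A : {set 'I_M * 'I_M}).
Hypothesis M_gt1 : (1 < M)%N.
Local Notation m := (M%:R : R).

Let m0 : 0 < m. Proof. by rewrite ltr0n ltnW. Qed.

(** The integers are closed and the bounds tend to 0. *)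
Lemma near_int_int (y C : R) :
  (forall j, exists z : int, `|y - z%:~R| <= C * (m ^+ j)^-1) -> exists z : int, y = z%:~R.
Proof.
move=> H; exists (Num.floor y); apply/eqP; rewrite -subr_eq0; apply: contraT => d0.
have fy : (Num.floor y)%:~R <= y by exact: floor_le.
have yf : y < (Num.floor y + 1)%:~R by exact: floorD1_gt.
set f := Num.floor y in d0 fy yf *.
have dp : 0 < y - f%:~R by rewrite lt_neqAle eq_sym d0 subr_ge0.
have dm : 0 < (f + 1)%:~R - y by rewrite subr_gt0.
pose e := Num.min (y - f%:~R) ((f + 1)%:~R - y).
have e0 : 0 < e by rewrite lt_min dp dm.
have far (z : int) : e <= `|y - z%:~R|.
  have [zf|fz] := leP z f.
    apply: le_trans (ler_norm _); rewrite ge_min; apply/orP; left.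
    by rewrite lerD2l lerN2 ler_int.
  rewrite distrC; apply: le_trans (ler_norm _); rewrite ge_min; apply/orP; right.
  by rewrite lerD2r ler_int; lia.
pose j := Num.bound (C / e).
have [z zj] := H j.
have : e * m ^+ j <= C.
  by rewrite -ler_pdivlMr ?exprn_gt0 //; apply: le_trans (far z) zj.
rewrite -ler_pdivlMl // mulrC leNgt => /negP[].
have [C0|C0] := leP 0 (C / e); last by apply: lt_trans C0 _; rewrite exprn_gt0.
apply: lt_le_trans (archi_boundP C0) _; rewrite -natrX ler_nat.
by apply: ltnW; apply: ltn_expl.
Qed.

Lemma digit_ok_in (a b : 'I_M) : digit_ok A a b -> (a, b) \in A.
Proof.
by case/existsP => -[x y] /= /and3P[xyA /eqP/val_inj <- /eqP/val_inj <-].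
Qed.

(** An ultrafilter replaces the extraction of a subsequence along which all the
    leading digits converge. *)
Lemma digits_limit (G : set_system nat) (k : nat -> nat) (x : nat -> nat * nat) :
  UltraFilter G -> exists d : nat -> 'I_M * 'I_M, forall j, G [set n | forall i, (i < j)%N ->
    (topdig M_gt1 (k n) (x n).1 i, topdig M_gt1 (k n) (x n).2 i) = d i].
Proof.
move=> GU.
have /choice[d dP] := fun i => ultra_finType
  (fun n => (topdig M_gt1 (k n) (x n).1 i, topdig M_gt1 (k n) (x n).2 i)) GU.
exists d; elim=> [|j IHj]; first by apply: filterS filterT.
apply: filterS2 IHj (dP j) => n /= H Hj i.
by rewrite ltnS leq_eqVlt => /orP[/eqP->|/H].
Qed.

Lemma mod1_eq (x y : R) (z : int) : x - y = z%:~R -> mod1 x = mod1 y.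
Proof.
move=> /(canRL (subrK _)) ->; rewrite /mod1 [z%:~R + y]addrC floorDrz ?intr_int // intrKfloor.
rewrite [(_ + _)%:~R]rmorphD /= opprD addrACA subrr addr0 //.
Qed.

Lemma mod1_range (x : R) : 0 <= mod1 x < 1.
Proof.
rewrite /mod1 subr_ge0 floor_le /= ltrBlDl.
by have := floorD1_gt x; rewrite intrD.
Qed.

Lemma mod1_int (x : R) : exists z : int, mod1 x = x + z%:~R.
Proof. by exists (- Num.floor x); rewrite /mod1 mulrNz. Qed.

Lemma floor_dist (y : R) : `|y - (Num.floor y)%:~R| <= 1.
Proof.
have h1 := floor_le y; have h2 := floorD1_gt y; rewrite intrD in h2.
by rewrite ger0_norm ?subr_ge0 // lerBlDl ltW.
Qed.

Lemma combine_errors (xq yq Ed Ee tv sv iq e c z : R) : yq - xq = - z + sv + iq ->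
  `|xq - Ed| <= 2 * e -> `|yq - Ee| <= 2 * e -> `|tv - sv| <= c * e -> `|iq| <= e ->
  `|tv + Ed - Ee - z| <= (5 + c) * e.
Proof.
move=> E; rewrite !ler_norml mulrDl => /andP[? ?] /andP[? ?] /andP[? ?] /andP[? ?].
by apply/andP; split; lra.
Qed.

(** If discrete lines of direction [v] stay in arbitrarily thin neighbourhoods of
    [X_k], rescale them by [M ^ -k] and pass to the limit along an ultrafilter: the
    base points converge to [p], and for each [t] the nearby points of [X_k]
    converge digit by digit to a point of the Cantor set, which is [p + t v] up to
    integers. *)
Theorem no_line_escape (v : int * int) :
  ~ (exists p, torus2 p /\ torus_line (v.1%:~R, v.2%:~R) p `<=` cantor_set R A) ->
  escape A v.
Proof.
move=> noline; apply: contrapT => nesc; apply: noline.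
have /choice [w wP] : forall n : nat, exists w : nat * nat * (int * int),
    [/\ (n <= w.1.1)%N, (w.1.2 * M ^ n <= M ^ w.1.1)%N &
     forall s : int, exists i j : nat, [/\ (i <= w.1.2)%N, (j <= w.1.2)%N &
       cantor_int A w.1.1 (w.2.1 + s * v.1 + i%:Z, w.2.2 + s * v.2 + j%:Z)]].
  move=> n; apply: contrapT => H; apply: nesc; exists n, (M ^ n)%N => k D nk DM p.
  apply: contrapT => nos; apply: H; exists (k, D, p); split=> //= s.
  apply: contrapT => noij; apply: nos; exists s => i j iD jD.
  by apply/negP => c; apply: noij; exists i, j.
pose k n := (w n).1.1; pose D n := (w n).1.2; pose p n := (w n).2.
have kn n : (n <= k n)%N by have [] := wP n.
have DM n : (D n * M ^ n <= M ^ k n)%N by have [] := wP n.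
have pP n s : exists i j : nat, [/\ (i <= D n)%N, (j <= D n)%N &
       cantor_int A (k n) ((p n).1 + s * v.1 + i%:Z, (p n).2 + s * v.2 + j%:Z)].
  by have [_ _] := wP n; apply.
clearbody k D p; clear w wP nesc.
have [G [GU ooG]] := @ultraFilterLemma nat \oo _.
have Gge j : G [set n | (j <= n)%N] by apply: ooG; exact: nbhs_infty_ge.
have /choice[x xP] : forall n, exists x : nat * nat, [/\ (x.1 < M ^ k n)%N, (x.2 < M ^ k n)%N,
    ((M ^ k n)%N%:Z %| x.1%:Z - (p n).1)%Z & ((M ^ k n)%N%:Z %| x.2%:Z - (p n).2)%Z].
  move=> n; have [x1 _ d1] := lo_ordz M_gt1 (k n) (p n).1.
  have [x2 _ d2] := lo_ordz M_gt1 (k n) (p n).2.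
  by exists (val x1, val x2); split=> //; apply: ltn_ord.
have [d dP] := digits_limit k x GU.
pose q : R * R := (expansion R (fun j => (d j).1), expansion R (fun j => (d j).2)).
exists (mod_Z2 q); split; first by rewrite /torus2 /= !mod1_range.
move=> _ [t _ <-].
(* The step of the discrete line whose rescaled position is t. *)
pose s n := Num.floor (t * m ^+ k n).
have /choice[y yP] : forall n, exists y : nat * nat, [/\ (y.1 < M ^ k n)%N, (y.2 < M ^ k n)%N,
    cantor_digits A (k n) y & exists i j : nat, [/\ (i <= D n)%N, (j <= D n)%N,
    ((M ^ k n)%N%:Z %| y.1%:Z - ((p n).1 + s n * v.1 + i%:Z))%Z &
    ((M ^ k n)%N%:Z %| y.2%:Z - ((p n).2 + s n * v.2 + j%:Z))%Z]].
  move=> n; have [i [j [iD jD c]]] := pP n (s n).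
  have [x1 e1 d1] := lo_ordz M_gt1 (k n) ((p n).1 + s n * v.1 + i%:Z).
  have [x2 e2 d2] := lo_ordz M_gt1 (k n) ((p n).2 + s n * v.2 + j%:Z).
  exists (val x1, val x2); split; [exact: ltn_ord|exact: ltn_ord| |by exists i, j].
  by move: c; rewrite /cantor_int /= e1 e2.
have [e eP] := digits_limit k y GU.
exists e.
  move=> j; have [n [/= jn en]] := filter_ex (filterI (Gge j.+1) (eP j.+1)).
  rewrite -(en j) //; apply: digit_ok_in; have [_ _ /cantor_digitsP c _] := yP n.
  have jk : (j < k n)%N by apply: leq_trans jn (kn n).
  by apply: c; lia.
have key (pr : nat * nat -> nat) (prz : int * int -> int) (prd : 'I_M * 'I_M -> 'I_M) :
   (forall n, (pr (x n) < M ^ k n)%N) -> (forall n, (pr (y n) < M ^ k n)%N) ->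
   (forall n, ((M ^ k n)%N%:Z %| (pr (x n))%:Z - prz (p n))%Z) ->
   (forall n, exists2 i, (i <= D n)%N & ((M ^ k n)%N%:Z %| (pr (y n))%:Z - (prz (p n) + s n * prz v + i%:Z))%Z) ->
   (forall n i, prd (topdig M_gt1 (k n) (x n).1 i, topdig M_gt1 (k n) (x n).2 i) = topdig M_gt1 (k n) (pr (x n)) i) ->
   (forall n i, prd (topdig M_gt1 (k n) (y n).1 i, topdig M_gt1 (k n) (y n).2 i) = topdig M_gt1 (k n) (pr (y n)) i) ->
   mod1 (t * (prz v)%:~R + mod1 (expansion R (fun j => prd (d j)))) =
   mod1 (expansion R (fun j => prd (e j))).
  move=> xk yk xp yp tx ty.
  have [z0 ->] := mod1_int (expansion R (fun j => prd (d j))).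
  set Ed := expansion R _; set Ee := expansion R _.
  suff [z zE] : exists z : int, t * (prz v)%:~R + Ed - Ee = z%:~R.
    apply: (@mod1_eq _ _ (z + z0)); by rewrite intrD -zE; ring.
  apply: (@near_int_int _ (5 + `|(prz v)%:~R|)) => j.
  have [n [[/= jn dn] en]] := filter_ex (filterI (filterI (Gge j) (dP j)) (eP j)).
  have jk := leq_trans jn (kn n).
  have hx : `|(pr (x n))%:R / m ^+ k n - Ed| <= 2 * (m ^+ j)^-1.
    by apply: topdig_bound => // i ij; rewrite -tx dn.
  have hy : `|(pr (y n))%:R / m ^+ k n - Ee| <= 2 * (m ^+ j)^-1.
    by apply: topdig_bound => // i ij; rewrite -ty en.
  have [i iD /dvdzP[z2 z2E]] := yp n; have /dvdzP[z1 z1E] := xp n.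
  have N0 : 0 < m ^+ k n by rewrite exprn_gt0.
  have hs : `|t * (prz v)%:~R - (s n)%:~R * (prz v)%:~R / m ^+ k n| <= `|(prz v)%:~R| * (m ^+ j)^-1.
    have -> : t * (prz v)%:~R - (s n)%:~R * (prz v)%:~R / m ^+ k n =
       (prz v)%:~R * ((t * m ^+ k n - (s n)%:~R) / m ^+ k n) :> R.
      by field; rewrite gt_eqF.
    rewrite normrM ler_wpM2l // normrM [`|(m ^+ _)^-1|]gtr0_norm ?invr_gt0 //.
    apply: le_trans (_ : 1 * (m ^+ k n)^-1 <= _).
      apply: ler_wpM2r; first by rewrite invr_ge0 ltW.
      exact: floor_dist.
    by rewrite mul1r lef_pV2 ?posrE ?exprn_gt0 // ler_weXn2l // ler1n ltnW.
  have hi : `|i%:R / m ^+ k n| <= (m ^+ j)^-1 :> R.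
    rewrite ger0_norm; last by rewrite divr_ge0 // ltW.
    rewrite ler_pdivrMr // mulrC ler_pdivlMr ?exprn_gt0 // -!natrX -natrM ler_nat.
    apply: leq_trans (DM n); apply: leq_mul => //; by rewrite leq_exp2l.
  exists (z1 - z2)%R.
  have E : ((pr (y n))%:R - (pr (x n))%:R : R) =
      (z2 - z1)%:~R * m ^+ k n + ((s n)%:~R * (prz v)%:~R + i%:R).
    have : (pr (y n))%:Z - (pr (x n))%:Z = (z2 - z1) * (M ^ k n)%N%:Z + (s n * prz v + i%:Z).
      by move: z1E z2E; lia.
    move/(congr1 (fun z : int => z%:~R : R)).
    by rewrite !(intrD, intrM, mulrNz, rmorphN) -natrX.
  apply: combine_errors hx hy hs hi.
  by rewrite -mulrBl E mulrDl mulfK ?gt_eqF // mulrDl addrA -rmorphN /= opprB.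
rewrite /mod_Z2 /=; congr (_, _).
  apply: (key fst fst fst) => // n; [by have [] := xP n|by have [] := yP n|by have [] := xP n|].
  by have [_ _ _ [i [j [h1 _ h2 _]]]] := yP n; exists i.
apply: (key snd snd snd) => // n; [by have [] := xP n|by have [] := yP n|by have [] := xP n|].
by have [_ _ _ [i [j [_ h1 _ h2]]]] := yP n; exists j.
Qed.

Lemma nolines_escape : ~ has_orthogonal_lines (cantor_set R A) ->
  forall a b, coprimez a b -> escape A (a, b) \/ escape A (- b, a).
Proof.
move=> nl a b cab; apply: contrapT => /not_orP[e1 e2].
have [p [p1 p2]] : exists p, torus2 p /\ torus_line (a%:~R, b%:~R) p `<=` cantor_set R A.
  by apply: contrapT => H; apply: e1; apply: no_line_escape.
have [q [q1 q2]] : exists p, torus2 p /\ torus_line ((- b)%:~R, a%:~R) p `<=` cantor_set R A.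
  by apply: contrapT => H; apply: e2; apply: no_line_escape.
apply: nl; exists (a%:~R, b%:~R), p, q; split=> //.
  apply: contraTneq cab => -[/eqP + /eqP]; rewrite !intr_eq0 => /eqP -> /eqP ->.
  by rewrite /coprimez gcdz0.
by rewrite /perp /= -mulrNz.
Qed.

End Lines.

(** * Roots of unity in different fields *)

Local Close Scope classical_set_scope.

Section Transfer.
Variables (L : numFieldType) (N : nat) (zeta : algC) (zeta' : L).
Hypotheses (zP : N.-primitive_root zeta) (zP' : N.-primitive_root zeta').

Lemma primitive_root_Cyclotomic : root (map_poly intr 'Phi_N) zeta'.
Proof.
have N0 := prim_order_gt0 zP'.
have /rootP : root (map_poly (intr : int -> L) ('X^N - 1)) zeta'.
  apply/rootP; rewrite rmorphB /= map_polyXn rmorph1 !hornerE.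
  by rewrite (prim_expr_order zP') subrr.
rewrite -prod_Cyclotomic // rmorph_prod /= horner_prod => /eqP.
rewrite prodf_seq_eq0 => /hasP[d]; rewrite -dvdn_divisors // => dN /= /eqP d0.
have d_gt0 : (0 < d)%N by apply: dvdn_gt0 dN.
have : (map_poly (intr : int -> L) ('X^d - 1)).[zeta'] = 0.
  rewrite -prod_Cyclotomic // rmorph_prod /= horner_prod.
  by rewrite (big_rem d) /= ?d0 ?mul0r // -dvdn_divisors.
rewrite rmorphB /= map_polyXn rmorph1 !hornerE => /eqP.
rewrite subr_eq0 -(prim_order_dvd zP') => Nd.
have <- : d = N by apply/eqP; rewrite eqn_dvd dN Nd.
exact/rootP.
Qed.

(** The cyclotomic polynomial is the minimal polynomial of [zeta] over the
    rationals, so a polynomial not vanishing at [zeta] is prime to it, and Bezout's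
    relation can be evaluated at [zeta']. *)
Lemma int_poly_neq0_transfer (P : {poly int}) :
  (map_poly intr P).[zeta] != 0 -> (map_poly intr P).[zeta'] != 0.
Proof.
move=> P0; have [p [pE pmon proot]] := minCpolyP zeta.
have mE : minCpoly zeta = map_poly intr 'Phi_N.
  by rewrite (minCpoly_cyclotomic zP) -(Cintr_Cyclotomic zP).
have pPhi : p = map_poly intr 'Phi_N.
  apply: (map_inj_poly (fmorph_inj (ratr : {rmorphism rat -> algC}))); first by rewrite rmorph0.
  rewrite -pE mE -map_poly_comp; apply: eq_map_poly => x /=; by rewrite ratr_int.
have ratrE (F : numFieldType) (Q : {poly int}) :
    map_poly (ratr : rat -> F) (map_poly intr Q) = map_poly intr Q.
  by rewrite -map_poly_comp; apply: eq_map_poly => x /=; rewrite ratr_int.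
have cop : coprimep (map_poly intr P) p.
  rewrite coprimep_def; set g := gcdp _ _.
  have p0 : p != 0 by rewrite monic_neq0.
  have /dvdpP[h hE] : g %| p by apply: dvdp_gcdr.
  have : root (map_poly ratr (h * g)) zeta by rewrite proot -hE dvdpp.
  rewrite rmorphM rootM !proot => /orP[ph|pg].
    have h0 : h != 0 by apply: contra_neq p0 => h0; rewrite hE h0 mul0r.
    have g0 : g != 0 by apply: contra_neq p0 => g0; rewrite hE g0 mulr0.
    have := dvdp_leq h0 ph; rewrite {1}hE size_mul //.
    move: h0 g0; rewrite -!size_poly_gt0; case: (size g) => [|[|n]] //.
    by case: (size h) => [|m] // _ _; rewrite !addSn !addnS /= ltnNge leq_addr.
  have : p %| map_poly intr P by apply: dvdp_trans pg (dvdp_gcdl _ _).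
  by rewrite -proot ratrE => /rootP e; rewrite e eqxx in P0.
have [[u v] /= uv] := Bezout_eq1_coprimepP _ _ cop.
apply/eqP => P'0.
have := congr1 (fun q => (map_poly (ratr : rat -> L) q).[zeta']) uv.
rewrite rmorphD !rmorphM rmorph1 /= hornerD !hornerM hornerC ratrE P'0 pPhi ratrE.
have /rootP -> := primitive_root_Cyclotomic.
by rewrite !mulr0 addr0 => /esym/eqP; rewrite oner_eq0.
Qed.

(** Injectivity says that some maximal minor is nonzero, and minors are integer
    polynomials in the root of unity. *)
Lemma injective_transfer (I J : finType) (e : I -> J -> nat) :
  (forall F : J -> algC, (forall i, \sum_j F j * zeta ^+ e i j = 0) -> forall j, F j = 0) ->
  forall F : J -> L, (forall i, \sum_j F j * zeta' ^+ e i j = 0) -> forall j, F j = 0.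
Proof.
move=> inj F FZ.
pose T : 'M[{poly int}]_(#|I|, #|J|) := \matrix_(i, j) 'X^(e (enum_val i) (enum_val j)).
pose S (K : fieldType) (z : K) : 'M[K]_(#|I|, #|J|) := \matrix_(i, j) (z ^+ e (enum_val i) (enum_val j)).
have full : row_full (S _ zeta).
  rewrite -col_leq_rank -mxrank_tr row_leq_rank; apply: inj_row_free => v vS.
  apply/rowP => j; rewrite mxE.
  pose F0 (j : J) := v 0 (enum_rank j).
  suff : F0 (enum_val j) = 0 by rewrite /F0 enum_valK.
  apply: inj => i; have /rowP/(_ (enum_rank i)) := vS; rewrite !mxE => vi.
  rewrite -[RHS]vi (reindex (@enum_val _ {: J})) /=; last first.
    by exists enum_rank => x _; rewrite ?enum_valK ?enum_rankK.
  by apply: eq_bigr => l _; rewrite !mxE /F0 enum_valK enum_rankK.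
pose f := fullrankfun full.
have detE (K : fieldType) (z : K) : \det (rowsub f (S K z)) = (map_poly intr (\det (rowsub f T))).[z].
  rewrite -det_map_mx -horner_evalE -det_map_mx; congr (\det _).
  by apply/matrixP => i j; rewrite !mxE /= map_polyXn /horner_eval hornerXn.
have : rowsub f (S L zeta') \in unitmx.
  rewrite unitmxE unitfE detE; apply: int_poly_neq0_transfer; rewrite -detE.
  by rewrite -unitfE -unitmxE fullrowsub_unit.
move=> U j.
pose c : 'cV[L]_(#|J|) := \col_j F (enum_val j).
have Sc : rowsub f (S L zeta') *m c = 0.
  apply/colP => i; rewrite !mxE; rewrite -[RHS](FZ (enum_val (f i))).
  rewrite [RHS](reindex (@enum_val _ {: J})) /=; last first.
    by exists enum_rank => x _; rewrite ?enum_valK ?enum_rankK.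
  by apply: eq_bigr => l _; rewrite !mxE mulrC.
have : c = 0 by rewrite -(mulKmx U c) Sc mulmx0.
by move/colP/(_ (enum_rank j)); rewrite !mxE enum_rankK.
Qed.

End Transfer.

(** * Squared moduli and the discrete Fourier transform *)

Local Open Scope complex_scope.

Section SquaredModulus.
Variable R : realType.
Local Notation C := R[i].
Implicit Types (x y z : C).

(** Squared moduli are real valued, and avoid square roots in the estimates. *)
Definition sqn z : R := complex.Re z ^+ 2 + complex.Im z ^+ 2.

Lemma sqn_ge0 z : 0 <= sqn z. Proof. by rewrite addr_ge0 ?sqr_ge0. Qed.
Lemma sqn0 : sqn 0 = 0. Proof. by rewrite /sqn /= expr0n addr0. Qed.
Lemma sqn1 : sqn 1 = 1. Proof. by rewrite /sqn /= expr0n addr0 expr1n. Qed.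
Lemma sqnM x y : sqn (x * y) = sqn x * sqn y.
Proof. by case: x y => [a b] [c d]; rewrite /sqn /=; ring. Qed.
Lemma sqnX x n : sqn (x ^+ n) = sqn x ^+ n.
Proof. by elim: n => [|n IHn]; rewrite ?expr0 ?sqn1 // !exprS sqnM IHn. Qed.
Lemma sqn_conj x : sqn x^*%C = sqn x.
Proof. by case: x => a b; rewrite /sqn /= sqrrN. Qed.
Lemma sqnC x : (sqn x)%:C = x * x^*%C.
Proof. by case: x => a b; apply/eqP; rewrite eq_complex /sqn /=; apply/andP; split; apply/eqP; ring. Qed.
Lemma sqn_eq0 x : (sqn x == 0) = (x == 0).
Proof. by rewrite /sqn paddr_eq0 ?sqr_ge0 // !sqrf_eq0 eq_complex. Qed.
Lemma sqn_real (a : R) : sqn a%:C = a ^+ 2.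
Proof. by rewrite /sqn /= expr0n addr0. Qed.
Lemma sqn_natV n : sqn (n%:R^-1) = (n%:R ^+ 2)^-1.
Proof.
have -> : (n%:R^-1 : C) = (n%:R^-1)%:C by rewrite fmorphV rmorph_nat.
by rewrite sqn_real exprVn.
Qed.

Section Vectors.
Variable I : finType.
Implicit Types u v w : I -> C.

Definition N2 u : R := \sum_i sqn (u i).

Lemma N2_ge0 u : 0 <= N2 u. Proof. by apply: sumr_ge0 => i _; exact: sqn_ge0. Qed.

Lemma sqn_sum u : sqn (\sum_i u i) = \sum_i \sum_j complex.Re (u i * (u j)^*%C).
Proof.
rewrite -[LHS]/(complex.Re (sqn (\sum_i u i))%:C) sqnC rmorph_sum /= mulr_suml raddf_sum.
by apply: eq_bigr => i _; rewrite mulr_sumr raddf_sum.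
Qed.

Lemma cauchy_schwarz u v : sqn (\sum_i u i * v i) <= N2 u * N2 v.
Proof.
rewrite -subr_ge0; have -> : N2 u * N2 v - sqn (\sum_i u i * v i) =
    2^-1 * \sum_i \sum_j sqn (u i * (v j)^*%C - u j * (v i)^*%C).
  have E1 : \sum_i \sum_j sqn (u i) * sqn (v j) = N2 u * N2 v.
    by rewrite mulr_suml; apply: eq_bigr => i _; rewrite mulr_sumr.
  have E2 : \sum_i \sum_j sqn (u j) * sqn (v i) = N2 u * N2 v by rewrite exchange_big E1.
  have -> : \sum_i \sum_j sqn (u i * (v j)^*%C - u j * (v i)^*%C) =
     \sum_i \sum_j sqn (u i) * sqn (v j) + \sum_i \sum_j sqn (u j) * sqn (v i)
     - 2 * \sum_i \sum_j complex.Re (u i * v i * (u j * v j)^*%C).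
    rewrite mulr_sumr -sumrN -!big_split; apply: eq_bigr => i _ /=.
    rewrite mulr_sumr -sumrN -!big_split; apply: eq_bigr => j _ /=.
    by case: (u i) (u j) (v i) (v j) => a b [c d] [e f] [g h]; rewrite /sqn /=; ring.
  have E3 : sqn (\sum_i u i * v i) = \sum_i \sum_j complex.Re (u i * v i * (u j * v j)^*%C).
    exact: sqn_sum.
  by rewrite E1 E2 E3; field.
rewrite mulr_ge0 // ?invr_ge0 // sumr_ge0 // => i _; rewrite sumr_ge0 // => j _; exact: sqn_ge0.
Qed.

Lemma sqn_sum_le u (P : pred I) : sqn (\sum_(i | P i) u i) <= #|P|%:R * \sum_(i | P i) sqn (u i).
Proof.
pose o (i : I) : C := if P i then 1 else 0; pose w (i : I) : C := if P i then u i else 0.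
have A1 : N2 o = #|P|%:R.
  rewrite -sumr_const big_mkcond; apply: eq_bigr => i _; rewrite /o.
  change (i \in P) with (P i).
  by case: ifP => _; rewrite ?sqn1 ?sqn0.
have A2 : N2 w = \sum_(i | P i) sqn (u i).
  rewrite [RHS]big_mkcond; apply: eq_bigr => i _; rewrite /w.
  by case: ifP => _; rewrite ?sqn0.
have A3 : \sum_i o i * w i = \sum_(i | P i) u i.
  rewrite [RHS]big_mkcond; apply: eq_bigr => i _; rewrite /o /w.
  by case: ifP => _; rewrite ?mul1r ?mul0r.
by rewrite -A1 -A2 -A3; apply: cauchy_schwarz.
Qed.

Lemma N2_le u v : (forall i, sqn (u i) <= sqn (v i)) -> N2 u <= N2 v.
Proof. by move=> H; apply: ler_sum => i _; apply: H. Qed.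

Definition cut (P : pred I) u : I -> C := fun i => if P i then u i else 0.

Lemma N2_cut P u : N2 (cut P u) = \sum_(i | P i) sqn (u i).
Proof.
rewrite [RHS]big_mkcond; apply: eq_bigr => i _; rewrite /cut.
by case: ifP; rewrite ?sqn0.
Qed.

Lemma N2_cut_le P u : N2 (cut P u) <= N2 u.
Proof. by apply: N2_le => i; rewrite /cut; case: ifP; rewrite ?sqn0 ?sqn_ge0. Qed.

Lemma N2_split P u : N2 u = N2 (cut P u) + N2 (cut (predC P) u).
Proof. by rewrite !N2_cut /N2 (bigID P). Qed.

Lemma sqnD_le x y : sqn (x + y) <= 2 * sqn x + 2 * sqn y.
Proof.
case: x y => [a b] [c d]; rewrite /sqn /= -subr_ge0.
have -> : 2 * (a ^+ 2 + b ^+ 2) + 2 * (c ^+ 2 + d ^+ 2) - ((a + c) ^+ 2 + (b + d) ^+ 2) =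
  (a - c) ^+ 2 + (b - d) ^+ 2 by ring.
by rewrite addr_ge0 ?sqr_ge0.
Qed.

Lemma N2D_le u v : N2 (fun i => u i + v i) <= 2 * N2 u + 2 * N2 v.
Proof.
by rewrite !mulr_sumr -big_split; apply: ler_sum => i _; exact: sqnD_le.
Qed.

(** The pairing is bilinear, not sesquilinear: the Fourier transform is symmetric
    for it. *)
Definition bil u v : C := \sum_i u i * v i.

End Vectors.

Lemma expiD (s t : R) : expi (s + t) = expi s * expi t.
Proof. by rewrite /expi cosD sinD; apply/eqP; rewrite eq_complex /= eqxx addrC eqxx. Qed.
Lemma expi0 : expi 0 = 1 :> C. Proof. by rewrite /expi cos0 sin0. Qed.
Lemma expiN (t : R) : expi (- t) = (expi t)^*%C.
Proof. by rewrite /expi cosN sinN. Qed.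
Lemma sqn_expi (t : R) : sqn (expi t) = 1. Proof. exact: cos2Dsin2. Qed.
Lemma expiX (t : R) n : expi t ^+ n = expi (t * n%:R).
Proof.
elim: n => [|n IHn]; first by rewrite mulr0 expi0.
by rewrite exprS IHn -expiD -natr1 mulrDr mulr1 addrC.
Qed.
Lemma expi2pi : expi (2 * pi) = 1 :> C.
Proof. by rewrite /expi mulrC mulr_natr cos2pi sin2pi. Qed.

Lemma expi_neq1 (t : R) : 0 < t -> t < 2 * pi -> expi t != 1.
Proof.
move=> t0 t2; apply/eqP => /(congr1 (@complex.Re _)) /= c1.
have s0 : 0 < sin (t / 2) by apply: sin_gt0_pi; apply/andP; split; [lra|rewrite ltr_pdivrMr // mulrC].
have : cos (t / 2 *+ 2) = 1 by rewrite (_ : t / 2 *+ 2 = t) ?c1 //; lra.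
rewrite cos_mulr2n cos2sin2 => e.
have : sin (t / 2) ^+ 2 = 0 by move: e; lra.
by move/eqP; rewrite sqrf_eq0 gt_eqF.
Qed.

Lemma prim_root_expi (N : nat) : (0 < N)%N -> N.-primitive_root (expi (- (2 * pi / N%:R)) : C).
Proof.
move=> N0; have Nr : 0 < N%:R :> R by rewrite ltr0n.
rewrite /primitive_root_of_unity N0; apply/forallP => i; apply/eqP.
rewrite unity_rootE expiX mulNr expiN.
have [iN|iN] := eqVneq i.+1 N.
  rewrite iN (_ : 2 * pi / N%:R * N%:R = 2 * pi) ?expi2pi ?conjc1 ?eqxx //.
  by rewrite mulfVK // gt_eqF.
apply/negbTE; have iN' : (i.+1 < N)%N by rewrite ltn_neqAle iN ltn_ord.
have e1 : expi (2 * pi / N%:R * i.+1%:R) != 1 :> C.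
  have pi0 := @pi_gt0 R; apply: expi_neq1.
    by rewrite mulr_gt0 ?ltr0n // divr_gt0 // mulr_gt0.
  rewrite -mulrA gtr_pMr ?mulr_gt0 // mulrC ltr_pdivrMr // mul1r ltr_nat //.
by apply: contra_neq e1 => e; rewrite -[LHS]conjcK e conjc1.
Qed.

Section DFT.
Variable N : nat.
Local Notation I := ('I_N * 'I_N)%type.
Implicit Types (u v : I -> C) (zeta : C).

Definition dotp (x y : I) : nat := (x.1 * y.1 + x.2 * y.2)%N.

Lemma dotpC (x y : I) : dotp x y = dotp y x.
Proof. by rewrite /dotp mulnC [(x.2 * _)%N]mulnC. Qed.

Definition dft zeta u (xi : I) : C := N%:R^-1 * \sum_x u x * zeta ^+ dotp x xi.

Lemma dft_bil zeta u v : bil (dft zeta u) v = bil u (dft zeta v).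
Proof.
rewrite /bil /dft.
under eq_bigr => i _ do rewrite -mulrA mulr_suml mulr_sumr.
under [RHS]eq_bigr => i _ do rewrite mulrCA mulr_sumr mulr_sumr.
rewrite exchange_big; apply: eq_bigr => i _; apply: eq_bigr => j _.
by rewrite dotpC; ring.
Qed.

Variable zeta : C.
Hypothesis zP : N.-primitive_root zeta.

Lemma sqn_zeta : sqn zeta = 1.
Proof.
have N0 := prim_order_gt0 zP.
have : sqn zeta ^+ N = 1 by rewrite -sqnX (prim_expr_order zP) sqn1.
by move/eqP; rewrite pexpr_eq1 ?sqn_ge0 // => /eqP.
Qed.

Lemma zeta_conj : zeta^*%C = zeta^-1.
Proof.
have z0 : zeta != 0 by rewrite -sqn_eq0 sqn_zeta oner_eq0.
by apply: (mulfI z0); rewrite divff // -sqnC sqn_zeta.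
Qed.

Lemma orth1 (a b : 'I_N) : \sum_(j < N) zeta ^+ (a * j) * zeta^-1 ^+ (b * j) = (a == b)%:R * N%:R.
Proof.
have z0 : zeta != 0 by rewrite -sqn_eq0 sqn_zeta oner_eq0.
have [->|ab] := eqVneq a b.
  rewrite mul1r (eq_bigr (fun=> 1)) ?sumr_const ?card_ord // => j _.
  by rewrite exprVn divff // expf_neq0.
rewrite mul0r; pose w := zeta ^+ a / zeta ^+ b.
rewrite (eq_bigr (fun j : 'I_N => w ^+ j)); last first.
  by move=> j _; rewrite /w expr_div_n -!exprM exprVn.
have w1 : w - 1 != 0.
  rewrite subr_eq0; apply: contra_neq ab => /divr1_eq /eqP.
  by rewrite (eq_prim_root_expr zP) !modn_small // => /eqP/val_inj.
apply: (mulfI w1); rewrite -subrX1 mulr0 /w expr_div_n -!exprM ![(_ * N)%N]mulnC !exprM.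
by rewrite (prim_expr_order zP) !expr1n divr1 subrr.
Qed.

Lemma orth2 (a b : I) : \sum_(j : I) zeta ^+ dotp a j * zeta^-1 ^+ dotp b j = (a == b)%:R * (N%:R * N%:R).
Proof.
have -> : \sum_(j : I) zeta ^+ dotp a j * zeta^-1 ^+ dotp b j =
   \sum_(j1 < N) \sum_(j2 < N) (zeta ^+ (a.1 * j1) * zeta^-1 ^+ (b.1 * j1)) * (zeta ^+ (a.2 * j2) * zeta^-1 ^+ (b.2 * j2)).
  by rewrite pair_bigA; apply: eq_bigr => -[j1 j2] _ /=; rewrite /dotp /= !exprD mulrACA.
rewrite -big_distrlr /= !orth1 mulrACA; congr (_ * _); rewrite -natrM mulnb.
by case: a b => a1 a2 [b1 b2].
Qed.

Lemma dftK u : dft zeta^-1 (dft zeta u) =1 u.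
Proof.
move=> x; have N0 : (N%:R : C) != 0 by rewrite pnatr_eq0 -lt0n (prim_order_gt0 zP).
rewrite /dft.
under eq_bigr => xi _ do rewrite -mulrA mulr_suml.
rewrite -mulr_sumr exchange_big /=.
under eq_bigr => y _.
  under eq_bigr => xi _ do rewrite -mulrA [dotp xi x]dotpC.
  rewrite -mulr_sumr orth2.
over.
rewrite (bigD1 x) //= big1 => [|y yx]; last by rewrite (negPf yx) mul0r mulr0.
by rewrite eqxx addr0 mul1r; field.
Qed.

Lemma dft_conj u xi : (dft zeta u xi)^*%C = dft zeta^-1 (fun x : I => (u x)^*%C) xi.
Proof.
rewrite /dft rmorphM rmorph_sum /= fmorphV rmorph_nat; congr (_ * _).
by apply: eq_bigr => x _; rewrite rmorphM rmorphXn /= zeta_conj.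
Qed.

Lemma dft_isometry u : N2 (dft zeta u) = N2 u.
Proof.
apply: complexI.
have E v : ((N2 v)%:C)%C = bil v (fun i => (v i)^*%C).
  by rewrite /N2 rmorph_sum; apply: eq_bigr => i _; exact: sqnC.
rewrite !E; under [X in bil _ X]funext => i do rewrite dft_conj.
by rewrite -dft_bil /bil; apply: eq_bigr => i _; rewrite dftK.
Qed.

End DFT.

End SquaredModulus.

(** * Submultiplicativity of the uncertainty principle *)

Lemma join_mod a u v : (u < a)%N -> ((u + a * v) %% a = u)%N.
Proof. by move=> ua; rewrite addnC mulnC modnMDl modn_small. Qed.
Lemma join_div a u v : (u < a)%N -> ((u + a * v) %/ a = v)%N.
Proof.
move=> ua; have a0 : (0 < a)%N by apply: leq_ltn_trans ua.
by rewrite addnC mulnC divnMDl // divn_small // addn0.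
Qed.

Section Join.
Variables (a b n : nat) (E : (n = a * b)%N).

Fact join_ord_subproof (x : 'I_a) (y : 'I_b) : (x + a * y < n)%N.
Proof.
rewrite E; apply: leq_trans (_ : a * y.+1 <= _)%N; last by rewrite leq_mul2l ltn_ord orbT.
by rewrite mulnS ltn_add2r.
Qed.
Definition join_ord x y : 'I_n := Ordinal (join_ord_subproof x y).
(** A pair of integers below [a * b] from its low parts and its high parts, in both
    coordinates. *)
Definition join2 (x : 'I_a * 'I_a) (y : 'I_b * 'I_b) : 'I_n * 'I_n :=
  (join_ord x.1 y.1, join_ord x.2 y.2).

Lemma join2_inj x y x' y' : join2 x y = join2 x' y' -> x = x' /\ y = y'.
Proof.
have inj1 (u u' : 'I_a) (v v' : 'I_b) : (u + a * v = u' + a * v')%N -> u = u' /\ v = v'.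
  move=> e; split; apply: val_inj => /=.
    by rewrite -(join_mod v (ltn_ord u)) e join_mod.
  by rewrite -(join_div v (ltn_ord u)) e join_div.
case: x y x' y' => [x1 x2] [y1 y2] [x1' x2'] [y1' y2'] [/inj1 [-> ->] /inj1 [-> ->]] //.
Qed.

Lemma sum_join2 (V : nmodType) (f : 'I_n * 'I_n -> V) :
  \sum_z f z = \sum_x \sum_y f (join2 x y).
Proof.
rewrite pair_bigA /= (reindex (fun p : ('I_a * 'I_a) * ('I_b * 'I_b) => join2 p.1 p.2)) //=.
apply: onW_bij; apply: inj_card_bij.
  by move=> [x y] [x' y'] /= /join2_inj [-> ->].
by rewrite !card_prod !card_ord E mulnACA.
Qed.

Lemma sum_join2_cond (V : nmodType) (P : pred ('I_n * 'I_n)) (f : 'I_n * 'I_n -> V)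
    (Q : pred ('I_a * 'I_a)) (S : pred ('I_b * 'I_b)) :
  (forall x y, P (join2 x y) = Q x && S y) ->
  \sum_(z | P z) f z = \sum_(x | Q x) \sum_(y | S y) f (join2 x y).
Proof.
move=> H; rewrite big_mkcond sum_join2 [RHS]big_mkcond; apply: eq_bigr => x _.
case: ifP => Qx; last by rewrite big1 // => y _; rewrite H Qx.
by rewrite [RHS]big_mkcond; apply: eq_bigr => y _; rewrite H Qx.
Qed.

End Join.

Section FUP.
Variables (R : realType) (M : nat) (A : {set 'I_M * 'I_M}).
Hypothesis M_gt1 : (1 < M)%N.
Local Notation C := R[i].

Let M0 : (0 < M)%N. Proof. exact: ltnW. Qed.
Let expM0 k : (0 < M ^ k)%N. Proof. by rewrite expn_gt0 M0. Qed.

Definition zetaN (N : nat) : C := expi (- (2 * pi / N%:R)).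

Lemma zetaN_prim k : (M ^ k)%N.-primitive_root (zetaN (M ^ k)%N).
Proof. exact: prim_root_expi. Qed.

Lemma zetaN_mul a b : (0 < b)%N -> zetaN (a * b) ^+ b = zetaN a.
Proof.
move=> b0; rewrite /zetaN expiX; congr (expi _); rewrite mulNr; congr (- _).
by rewrite natrM invfM mulrA mulfVK // pnatr_eq0 -lt0n.
Qed.

Definition cantor_pred k : pred (ord_pair M k) := fun x => cantor_digits A k (val2 x).

(** The squared norm of [1_X F 1_X] is at most [r], where [X] is the discrete Cantor
    set of level [k]. *)
Definition FUP k (r : R) := forall u : ord_pair M k -> C,
  (forall x, ~~ cantor_pred x -> u x = 0) ->
  \sum_(x | cantor_pred x) sqn (dft (zetaN (M ^ k)) u x) <= r * N2 u.

Lemma cantor_join k l (E : (M ^ (k + l) = M ^ k * M ^ l)%N) x y :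
  @cantor_pred (k + l) (join2 E x y) = cantor_pred x && cantor_pred y.
Proof.
rewrite /cantor_pred cantor_digits_cat //= /val2 /=.
by rewrite !join_mod ?ltn_ord // !join_div ?ltn_ord.
Qed.

(** As in the fast Fourier transform, the transform of size [M ^ (k + l)] is a
    transform in the high digits, a multiplication by phases, and a transform in the
    low digits; digits of position and of frequency are in reverse order. *)
Lemma FUP_mul k l (r s : R) : 0 <= r -> FUP k r -> FUP l s -> FUP (k + l) (r * s).
Proof.
move=> r0 Fk Fl u uX.
have E : (M ^ (k + l) = M ^ k * M ^ l)%N by rewrite expnD.
have E' : (M ^ (k + l) = M ^ l * M ^ k)%N by rewrite expnD mulnC.
set N := (M ^ (k + l))%N in E E' *; pose z := zetaN N.
have zk : z ^+ (M ^ l) = zetaN (M ^ k) by rewrite /z E zetaN_mul.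
have zl : z ^+ (M ^ k) = zetaN (M ^ l) by rewrite /z E' zetaN_mul.
have zN : z ^+ N = 1 by apply: (prim_expr_order (zetaN_prim (k + l))).
pose g (x1 : ord_pair M k) := dft (zetaN (M ^ l)) (fun x2 => u (join2 E x1 x2)).
pose hh xi2 x1 := z ^+ ((val (x1 : ord_pair M k).1) * val (xi2 : ord_pair M l).1 + (val x1.2) * val xi2.2)%N * g x1 xi2.
have key xi1 xi2 : dft z u (join2 E' xi2 xi1) = dft (zetaN (M ^ k)) (hh xi2) xi1.
  have NE : (N%:R^-1 : C) = (M ^ k)%:R^-1 * (M ^ l)%:R^-1 by rewrite E natrM invfM.
  rewrite /dft (sum_join2 E) NE -mulrA; congr (_ * _).
  rewrite mulr_sumr; apply: eq_bigr => x1 _.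
  rewrite /hh /g /dft -!mulrA [in RHS]mulrCA; congr (_ * _).
  rewrite mulr_suml mulr_sumr; apply: eq_bigr => x2 _.
  rewrite mulrCA -!mulrA; congr (_ * _).
  rewrite -zk -zl -!exprM mulrCA -!exprD /dotp /=.
  set a := (M ^ k)%N; set b := (M ^ l)%N.
  have -> : ((x1.1 + a * x2.1) * (xi2.1 + b * xi1.1) + (x1.2 + a * x2.2) * (xi2.2 + b * xi1.2) =
    N * (x2.1 * xi1.1 + x2.2 * xi1.2) +
    (a * (x2.1 * xi2.1 + x2.2 * xi2.2) + (x1.1 * xi2.1 + x1.2 * xi2.2 + b * (x1.1 * xi1.1 + x1.2 * xi1.2))))%N.
    by rewrite E -/a -/b; ring.
  by rewrite [in LHS]exprD exprM zN expr1n mul1r addnCA.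
rewrite (sum_join2_cond (E := E') _ (Q := @cantor_pred l) (S := @cantor_pred k)); last first.
  move=> x y; rewrite /cantor_pred.
  have := @cantor_join l k; rewrite addnC => H; exact: H.
apply: le_trans (_ : \sum_(xi2 | cantor_pred xi2) r * N2 (hh xi2) <= _).
  apply: ler_sum => xi2 _; under eq_bigr => xi1 _ do rewrite key.
  apply: Fk => x1 nx1; rewrite /hh /g /dft big1 ?mulr0 // => x2 _.
  by rewrite uX ?mul0r // cantor_join (negPf nx1).
rewrite -mulr_sumr -mulrA ler_wpM2l // exchange_big /=.
rewrite /N2 (sum_join2 E) mulr_sumr; apply: ler_sum => x1 _.
apply: le_trans (_ : \sum_(xi2 | cantor_pred xi2) sqn (g x1 xi2) <= _).
  apply: ler_sum => xi2 _; rewrite /hh sqnM sqnX (sqn_zeta (zetaN_prim (k + l))).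
  by rewrite expr1n mul1r.
by apply: Fl => x2 nx2; rewrite uX // cantor_join (negPf nx2) andbF.
Qed.

End FUP.

(** * A gain at one scale *)

Section Gain.
Variables (R : realType) (M : nat) (A : {set 'I_M * 'I_M}).
Hypothesis M_gt1 : (1 < M)%N.
Local Notation C := R[i].

Let M0 : (0 < M)%N. Proof. exact: ltnW. Qed.
Let expM0 k : (0 < M ^ k)%N. Proof. by rewrite expn_gt0 M0. Qed.

Lemma FUP_one k : FUP A k (1 : R).
Proof.
move=> u _; rewrite mul1r -N2_cut -(dft_isometry (zetaN_prim R M_gt1 k) u).
exact: N2_cut_le.
Qed.

(** An injective matrix has a one-sided inverse, and [c] is the squared
    Hilbert-Schmidt norm of that inverse. *)
Lemma left_inverse_bound (K : realType) (m n : nat) (X : 'M[K[i]]_(m, n)) :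
  (forall v : 'rV_m, v *m X = 0 -> v = 0) ->
  exists2 c : K, 0 <= c & forall v : 'rV_m,
    \sum_i sqn (v 0 i) <= c * \sum_j sqn ((v *m X) 0 j).
Proof.
move=> /inj_row_free /row_freeP[B XB].
exists (\sum_i \sum_j sqn (B j i)).
  by apply: sumr_ge0 => i _; apply: sumr_ge0 => j _; exact: sqn_ge0.
move=> v; rewrite mulr_suml; apply: ler_sum => i _.
have -> : v 0 i = \sum_j (v *m X) 0 j * B j i.
  by rewrite -{1}(mulmx1 v) -XB mulmxA mxE.
by apply: le_trans (cauchy_schwarz _ _) _; rewrite mulrC.
Qed.

Lemma no_concentration k : (forall zeta : algC, (M ^ k)%N.-primitive_root zeta ->
    forall F : ord_pair M k -> algC, phase_localized A zeta F -> forall x, F x = 0) ->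
  forall u : ord_pair M k -> C, (forall x, ~~ cantor_pred A x -> u x = 0) ->
  (forall x, ~~ cantor_pred A x -> dft (zetaN R (M ^ k)) u x = 0) -> forall x, u x = 0.
Proof.
move=> H; have [z zP] := C_prim_root_exists (expM0 k).
pose X : {pred ord_pair M k} := fun x => cantor_pred A x.
pose Y : {pred ord_pair M k} := fun x => ~~ cantor_pred A x.
pose e (i : {x in Y}) (j : {x in X}) := dotp (val j) (val i).
have inj : forall F : {x in X} -> algC,
    (forall i, \sum_j F j * z ^+ e i j = 0) -> forall j, F j = 0.
  move=> F FZ j; pose F' x := if insub x is Some j then F j else 0.
  have F'E (j' : {x in X}) : F' (val j') = F j' by rewrite /F' valK.
  have F'out x : x \notin X -> F' x = 0 by move=> nx; rewrite /F' insubN.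
  rewrite -F'E; apply: (H z zP); split=> [x|x].
    by apply: contraNT => nx; rewrite F'out // eqxx.
  apply: contraNT => nx; apply/eqP.
  have <- := FZ (exist _ x nx : {x in Y}).
  rewrite /fhat (bigID (mem X)) /= [X in _ + X]big1 ?addr0 => [|y ny]; last by rewrite F'out ?mul0r.
  rewrite big_sub; apply: eq_bigr => l _; rewrite F'E; congr (_ * _).
  by rewrite /pt /= -!exprnP -!exprM -exprD.
move=> u uX dX.
have := injective_transfer zP (zetaN_prim R M_gt1 k) inj => /(_ (fun j => u (val j))) T x.
have [xX|nx] := boolP (x \in X); last exact: uX.
apply: (T _ (exist _ x xX : {x in X})) => i.
have /eqP := dX (val i) (valP i).
rewrite /dft mulf_eq0 invr_eq0 pnatr_eq0 gtn_eqF //= => /eqP e0.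
rewrite -[RHS]e0 [RHS](bigID (mem X)) /= [X in _ + X]big1 ?addr0 => [|y ny]; last by rewrite uX ?mul0r.
by rewrite [RHS]big_sub.
Qed.

(** The map sending [u] to the restrictions of [u] and of its transform to the
    complement of the Cantor set is injective, hence bounded below. *)
Lemma FUP_base : A \proper [set: 'I_M * 'I_M]%SET ->
  (forall a b, coprimez a b -> escape A (a, b) \/ escape A (- b, a)) ->
  exists (k : nat) (r : R), [/\ (0 < k)%N, 0 <= r, r < 1 & FUP A k r].
Proof.
move=> Ap esc; have [k k0 /no_concentration inj] := no_phase_localized M_gt1 Ap esc.
exists k; pose I := ord_pair M k.
pose z : C := zetaN R (M ^ k).
pose K (x : I) (c : I + I) : C := match c with
  | inl y => ((x == y) && ~~ cantor_pred A y)%:R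
  | inr xi => if cantor_pred A xi then 0 else (M ^ k)%:R^-1 * z ^+ dotp x xi end.
pose X : 'M[C]_(#|{: I}|, #|{: I + I}|) := \matrix_(i, j) K (enum_val i) (enum_val j).
pose tov (u : I -> C) : 'rV[C]_#|{: I}| := \row_i u (enum_val i).
have KE u c : (tov u *m X) 0 (enum_rank c) = \sum_x u x * K x c.
  rewrite !mxE [RHS](reindex (@enum_val _ {: I})) /=; last first.
    by exists enum_rank => x _; rewrite ?enum_valK ?enum_rankK.
  by apply: eq_bigr => i _; rewrite !mxE enum_rankK.
have Kl u y : \sum_x u x * K x (inl y) = if cantor_pred A y then 0 else u y.
  case: ifPn => [yX|nyX]; first by rewrite big1 // => x _; rewrite /K yX andbF mulr0.
  rewrite (bigD1 y) //= big1 => [|x xy]; first by rewrite eqxx nyX mulr1 addr0.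
  by rewrite (negPf xy) mulr0.
have Kr u xi : \sum_x u x * K x (inr xi) = if cantor_pred A xi then 0 else dft z u xi.
  case: ifPn => [yX|nyX]; first by rewrite big1 // => x _; rewrite /K yX mulr0.
  by rewrite /dft mulr_sumr; apply: eq_bigr => x _; rewrite /K (negPf nyX) mulrCA.
have [v vX|c c0 cP] := @left_inverse_bound R _ _ X.
  pose u x := v 0 (enum_rank x).
  have vE : v = tov u by apply/rowP => i; rewrite mxE /u enum_valK.
  have Z c : \sum_x u x * K x c = 0 by rewrite -KE -vE vX mxE.
  rewrite vE; apply/rowP => i; rewrite !mxE; apply: inj => x nx.
    by have := Z (inl x); rewrite Kl (negPf nx).
  by have := Z (inr x); rewrite Kr (negPf nx).
pose r := 1 - (c + 1)^-1.
have c1 : 0 < c + 1 by rewrite ltr_wpDl.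
have r0 : 0 <= r by rewrite subr_ge0 invf_le1 // lerDr.
exists r; split=> //; first by rewrite ltrBlDr ltrDl invr_gt0.
move=> u uX.
have bound : N2 u <= c * N2 (cut (predC (@cantor_pred M A k)) (dft z u)).
  have := cP (tov u).
  have -> : \sum_i sqn (tov u 0 i) = N2 u.
    rewrite /N2 [RHS](reindex (@enum_val _ {: I})) /=; last first.
      by exists enum_rank => x _; rewrite ?enum_valK ?enum_rankK.
    by apply: eq_bigr => i _; rewrite mxE.
  suff -> : \sum_j sqn ((tov u *m X) 0 j) = N2 (cut (predC (@cantor_pred M A k)) (dft z u)) by [].
  rewrite (reindex (@enum_rank {: I + I})) /=; last first.
    by exists enum_val => x _; rewrite ?enum_valK ?enum_rankK.
  rewrite big_sumType /= big1 ?add0r => [|y _]; last first.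
    by rewrite KE Kl; case: ifPn => [_|/uX ->]; rewrite sqn0.
  by apply: eq_bigr => xi _; rewrite KE Kr /cut /=; case: (cantor_pred A xi).
rewrite -N2_cut.
have := N2_split (@cantor_pred M A k) (dft z u).
rewrite (dft_isometry (zetaN_prim R M_gt1 k)) => E.
move: bound E; set b := N2 (cut _ _); set a := N2 (cut _ _) => bound E.
have b0 : 0 <= b by exact: N2_ge0.
have h : (c + 1)^-1 * N2 u <= b.
  by rewrite ler_pdivrMl // mulrDl mul1r; apply: le_trans bound _; rewrite lerDl.
rewrite -/z -/a /r mulrBl mul1r lerBrDr; apply: le_trans (_ : a + b <= _).
  by rewrite lerD2l.
by rewrite E.
Qed.

Lemma FUP_power k (r : R) : 0 <= r -> FUP A k r -> forall n, FUP A n (r ^+ (n %/ k)).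
Proof.
move=> r0 Fk n; rewrite {1}(divn_eq n k).
elim: (n %/ k)%N => [|q IHq]; first by rewrite mul0n add0n expr0; exact: FUP_one.
by rewrite mulSn -addnA exprS; apply: FUP_mul.
Qed.

End Gain.

(** * Thickened Cantor sets *)

Section Thick.
Variables (R : realType) (M : nat) (A : {set 'I_M * 'I_M}).
Hypothesis M_gt1 : (1 < M)%N.
Local Notation C := R[i].

Let M0 : (0 < M)%N. Proof. exact: ltnW. Qed.
Let expM0 k : (0 < M ^ k)%N. Proof. by rewrite expn_gt0 M0. Qed.

Section Shift.
Variables (N : nat) (z : C).
Hypothesis zP : N.-primitive_root z.
Local Notation I := ('I_N * 'I_N)%type.

Let N0 : (0 < N)%N. Proof. exact: prim_order_gt0 zP. Qed.

Definition cyc1 (t : nat) (x : 'I_N) : 'I_N := Ordinal (ltn_pmod (x + t) N0).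
Definition cyc (t : nat * nat) (x : I) : I := (cyc1 t.1 x.1, cyc1 t.2 x.2).

Lemma cyc_inj t : injective (cyc t).
Proof.
have inj1 s : injective (cyc1 s).
  move=> x y /(congr1 val) /= /eqP; rewrite eqn_modDr !modn_small // => /eqP; exact: val_inj.
move=> [x1 x2] [y1 y2] e.
have /= e1 := inj1 _ _ _ (congr1 fst e); have /= e2 := inj1 _ _ _ (congr1 snd e).
by rewrite e1 e2.
Qed.

(** A translation of the frequency is a modulation, and a translation of the
    argument is a phase. *)
Lemma sqn_dft_cyc u t s eta : sqn (dft z u (cyc s eta)) =
  sqn (dft z (fun y => u (cyc t y) * z ^+ (y.1 * s.1 + y.2 * s.2)) eta).
Proof.
pose c := z ^+ (t.1 * (eta.1 + s.1) + t.2 * (eta.2 + s.2)).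
have sz n : sqn (z ^+ n) = 1 by rewrite sqnX (sqn_zeta zP) expr1n.
rewrite -[RHS]mul1r -(sz (t.1 * (eta.1 + s.1) + t.2 * (eta.2 + s.2))%N) -sqnM; congr sqn.
rewrite /dft mulrCA; congr (_ * _).
rewrite (reindex_inj (@cyc_inj t)) mulr_sumr; apply: eq_bigr => y _.
rewrite mulrCA -!mulrA; congr (_ * _); rewrite -!exprD.
apply/eqP; rewrite (eq_prim_root_expr zP); apply/eqP; rewrite /dotp /=.
rewrite -modnDm !modnMm modnDm; congr (_ %% N)%N; ring.
Qed.
End Shift.

Lemma FUP_sign k (r : R) : FUP A k r -> forall u : ord_pair M k -> C,
  (forall x, ~~ cantor_pred A x -> u x = 0) ->
  \sum_(x | cantor_pred A x) sqn (dft (zetaN R (M ^ k))^-1 u x) <= r * N2 u.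
Proof.
move=> F u uX.
have zP := zetaN_prim R M_gt1 k.
have -> : N2 u = N2 (fun x => (u x)^*%C) by apply: eq_bigr => x _; rewrite sqn_conj.
apply: le_trans (F _ _); last by move=> x /uX ->; rewrite conjc0.
rewrite le_eqVlt; apply/orP; left; apply/eqP/eq_bigr => x _; rewrite -[RHS]sqn_conj dft_conj //; congr sqn.
by congr dft; apply/funext => y; rewrite conjcK.
Qed.

(** The thick set is covered by [(2c+1)^2] translates of the Cantor set, and the
    uncertainty principle is invariant under translations in position and frequency. *)
Lemma FUP_thick k (r : R) (c : nat) (T : pred (ord_pair M k)) (z : C) :
  0 <= r -> FUP A k r -> (z = zetaN R (M ^ k) \/ z = (zetaN R (M ^ k))^-1) ->
  (forall x, T x -> exists y : ord_pair M k, cantor_pred A y /\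
     [/\ (x.1 <= y.1 + c)%N, (y.1 <= x.1 + c)%N, (x.2 <= y.2 + c)%N & (y.2 <= x.2 + c)%N]) ->
  forall u : ord_pair M k -> C, (forall x, ~~ T x -> u x = 0) ->
  N2 (cut T (dft z u)) <= ((2 * c + 1) ^ 4)%:R * r * N2 u.
Proof.
move=> r0 F zz TX u uT.
have zP : (M ^ k)%N.-primitive_root z.
  have zP := zetaN_prim R M_gt1 k; case: zz => ->; first exact: zP.
  rewrite /primitive_root_of_unity expM0; apply/forallP => i; apply/eqP.
  rewrite unity_rootE exprVn invr_eq1 -unity_rootE.
  by move: zP; rewrite /primitive_root_of_unity => /andP[_ /forallP/(_ i)/eqP].
have F' (v : ord_pair M k -> C) : (forall x, ~~ cantor_pred A x -> v x = 0) ->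
    \sum_(x | cantor_pred A x) sqn (dft z v x) <= r * N2 v.
  by case: zz => -> vX; [exact: F|exact: FUP_sign].
pose J := ('I_(2 * c + 1) * 'I_(2 * c + 1))%type.
pose N := (M ^ k)%N.
(* Translation by s - (c, c), made nonnegative by a multiple of N. *)
pose sh (s : J) := ((s.1 + N * c - c)%N, (s.2 + N * c - c)%N).
have Nc : (c <= N * c)%N by apply: leq_pmull; apply: expM0.
have /choice[sg sgP] : forall x, exists s : J, T x ->
    exists2 y, cantor_pred A y & x = cyc zP (sh s) y.
  have J0 : (0 < 2 * c + 1)%N by rewrite addn1.
  move=> x; have [Tx|nTx] := boolP (T x); last by exists (Ordinal J0, Ordinal J0).
  have [y [yX [h1 h2 h3 h4]]] := TX x Tx.
  have l1 : (x.1 + c - y.1 < 2 * c + 1)%N by move: h1 h2; clear; lia.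
  have l2 : (x.2 + c - y.2 < 2 * c + 1)%N by move: h3 h4; clear; lia.
  exists (Ordinal l1, Ordinal l2) => _; exists y => //.
  have e (a b : 'I_N) : (a <= b + c)%N -> (b <= a + c)%N ->
      ((b + (a + c - b + N * c - c)) %% N = a)%N.
    move=> p1 p2; have -> : (b + (a + c - b + N * c - c) = c * N + a)%N.
      by move: p1 p2 Nc; rewrite [(N * c)%N]mulnC; clear; lia.
    by rewrite modnMDl modn_small.
  rewrite [LHS]surjective_pairing; congr (_, _); apply: val_inj => /=; rewrite e //.
pose us (s : J) := cut (fun x => T x && (sg x == s)) u.
have uE x : u x = \sum_s us s x.
  rewrite (bigD1 (sg x)) //= big1 => [|s ss]; last by rewrite /us /cut eq_sym (negPf ss) andbF.
  by rewrite addr0 /us /cut eqxx andbT; case: ifPn => // /uT.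
have dE xi : dft z u xi = \sum_s dft z (us s) xi.
  rewrite /dft -mulr_sumr exchange_big /=; congr (_ * _).
  by apply: eq_bigr => x _; rewrite uE mulr_suml.
have cJ : #|{: J}|%:R = ((2 * c + 1) ^ 2)%:R :> R by rewrite card_prod card_ord mulnn.
have piece s s' : \sum_(xi | T xi && (sg xi == s')) sqn (dft z (us s) xi) <= r * N2 (us s).
  apply: le_trans (_ : \sum_(eta | cantor_pred A eta) sqn (dft z (us s) (cyc zP (sh s') eta)) <= _).
    rewrite -(big_imset (h := cyc zP (sh s')) (fun xi => sqn (dft z (us s) xi))) /=; last first.
      by move=> x y _ _; exact: cyc_inj.
    rewrite [X in X <= _]big_mkcond [X in _ <= X]big_mkcond; apply: ler_sum => xi _.
    case: ifP => [/andP[Txi /eqP e]|_]; last by case: ifP => _ //; exact: sqn_ge0.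
    have [y yX ->] := sgP xi Txi; rewrite e.
    by rewrite imset_f.
  under eq_bigr => eta _ do rewrite (sqn_dft_cyc zP _ (sh s)).
  apply: le_trans (F' _ _) _.
    move=> y nyX; rewrite /us /cut; case: ifP => [/andP[Tx /eqP e]|_]; last by rewrite mul0r.
    have [y' y'X] := sgP _ Tx; rewrite e => /cyc_inj yy'.
    by rewrite yy' y'X in nyX.
  rewrite ler_wpM2l // /N2 [X in _ <= X](reindex_inj (@cyc_inj _ _ zP (sh s))) /=.
  by apply: ler_sum => y _; rewrite sqnM sqnX (sqn_zeta zP) expr1n mulr1.
rewrite N2_cut.
apply: le_trans (_ : \sum_(xi | T xi) #|{: J}|%:R * \sum_s sqn (dft z (us s) xi) <= _).
  apply: ler_sum => xi _; rewrite dE; exact: (@sqn_sum_le _ _ _ xpredT).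
rewrite -mulr_sumr exchange_big /=.
have N2E : \sum_s N2 (us s) = N2 u.
  rewrite exchange_big; apply: eq_bigr => x _ /=.
  rewrite (bigD1 (sg x)) //= big1 => [|s ss]; last by rewrite /us /cut eq_sym (negPf ss) andbF sqn0.
  by rewrite addr0 /us /cut eqxx andbT; case: ifPn => // /uT ->.
apply: le_trans (_ : #|{: J}|%:R * \sum_s (#|{: J}|%:R * (r * N2 (us s))) <= _).
  rewrite ler_wpM2l ?ler0n //; apply: ler_sum => s _.
  rewrite (partition_big sg xpredT) //=.
  apply: le_trans (_ : \sum_(s' : J) r * N2 (us s) <= _); first by apply: ler_sum => s' _; exact: piece.
  by rewrite sumr_const -[X in X <= _]mulr_natl.
by rewrite -!mulr_sumr N2E cJ !mulrA -natrM -expnD.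
Qed.

End Thick.

(** * Finite differences of the cutoff *)

Local Close Scope complex_scope.
Local Open Scope classical_set_scope.
Local Open Scope ring_scope.

Section Differences.
Variable R : realType.

Definition diff (h : R) (f : R -> R) : R -> R := fun t => f (t + h) - f t.

Lemma is_derive_shift (f : R -> R) (s h df : R) :
  is_derive (s + h) (1 : R) f df -> is_derive s (1 : R) (fun t => f (t + h)) df.
Proof.
move=> [d dE].
have E : (fun k : R => k^-1 *: (((fun t => f (t + h)) \o shift s) (k *: (1 : R)) - f (s + h)))
   = (fun k : R => k^-1 *: ((f \o shift (s + h)) (k *: (1 : R)) - f (s + h))).
  by apply/funext => k /=; rewrite addrA.
by apply: DeriveDef; [rewrite /derivable E|rewrite /derive E].
Qed.

(** The mean value theorem, applied to the sequence of the successive derivatives. *)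
Lemma diff_iter_bound (phi : nat -> R -> R) (h B : R) L : 0 <= h ->
  (forall i t, is_derive t (1 : R) (phi i) (phi i.+1 t)) ->
  (forall t, `|phi L t| <= B) -> forall t, `|iter L (diff h) (phi 0%N) t| <= B * h ^+ L.
Proof.
move=> h0; elim: L phi B => [|L IHL] phi B dphi bd t; first by rewrite expr0 mulr1; apply: bd.
rewrite iterSr exprSr mulrA mulrAC.
apply: (IHL (fun i => diff h (phi i)) (B * h)) => [i s|s].
  rewrite /diff.
  have d1 : is_derive s (1 : R) (fun t0 => phi i (t0 + h)) (phi i.+1 (s + h)).
    exact: is_derive_shift.
  exact: is_deriveB.
rewrite /diff mulrC.
have [->|hn0] := eqVneq h 0; first by rewrite addr0 subrr normr0 mul0r.
have hp : 0 < h by rewrite lt_neqAle eq_sym hn0.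
have [||c _ ->] := @MVT_segment R (phi L) (phi L.+1) s (s + h).
- by rewrite lerDl.
- by apply: derivable_within_continuous => x _; have [] := dphi L x.
by rewrite [s + h - s]addrC addKr normrM [X in X <= _]mulrC (ger0_norm h0) ler_wpM2l.
Qed.

End Differences.

Section Cutoff.
Variables (R : realType) (chi : R * R -> R).
Hypothesis chiP : is_cutoff chi.

Lemma cutoff_range z : 0 <= chi z <= 1. Proof. by have [_ /(_ z)] := chiP. Qed.

Local Notation S := (closure [set z | chi z != 0]).

Lemma in_support z : chi z != 0 -> S z.
Proof. by move=> cz; apply: (@subset_closure _ [set z | chi z != 0]). Qed.

Lemma cutoff_out z : ~~ ((0 < z.1 < 1) && (0 < z.2 < 1)) -> chi z = 0.
Proof.
move=> nz; apply/eqP; apply: contraT => cz; have [_ _ _ /(_ z)] := chiP.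
by move=> /(_ (in_support cz)) /=; rewrite (negPf nz).
Qed.

Definition dir_deriv (e : R * R) (i : nat) : R * R -> R := iter i (fun f z => 'D_e f z) chi.

Lemma dir_deriv_Cn (e : R * R) : e = (1, 0) \/ e = (0, 1) -> forall i n, Cn n (dir_deriv e i).
Proof.
have H n : Cn n chi by have [H _ _ _] := chiP; exact: H.
case=> ->; (elim=> [|i IHi] n; first exact: H); case: (IHi n.+1) => _ [_ _ h1 h2];
  rewrite /dir_deriv iterS; [exact: h1|exact: h2].
Qed.

Lemma dir_deriv_derivable (e : R * R) : e = (1, 0) \/ e = (0, 1) ->
  forall i z, derivable (dir_deriv e i) z e.
Proof.
move=> ee i z; have [_ [h1 h2 _ _]] := dir_deriv_Cn ee i 1.
case: ee h1 h2 => -> h1 h2; [exact: h1|exact: h2].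
Qed.

Lemma dir_deriv_out (e : R * R) : e != 0 -> forall i z, ~ S z -> dir_deriv e i z = 0.
Proof.
move=> e0; elim=> [|i IHi] z nz.
  by apply/eqP; apply: contra_notT nz => cz; exact: in_support.
rewrite /dir_deriv iterS -/(dir_deriv e i).
have op : open (~` S) by apply: closed_openC; exact: closed_closure.
rewrite (@near_eq_derive _ _ _ _ (cst 0)) ?derive_cst //.
by have := open_nbhs_nbhs (conj op nz); apply: filterS => y; exact: IHi.
Qed.

Lemma dir_deriv_bounded (e : R * R) : e = (1, 0) \/ e = (0, 1) -> forall i,
  exists B, forall z, `|dir_deriv e i z| <= B.
Proof.
move=> ee i.
have e0 : e != 0 by case: ee => ->; apply/eqP => -[] /eqP; rewrite ?oner_eq0.
have [_ _ cS _] := chiP.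
have cf : continuous (dir_deriv e i) by have [] := dir_deriv_Cn ee i 0%N.
have [B [Br BP]] : bounded_set (dir_deriv e i @` S).
  by apply: compact_bounded; apply: continuous_compact => //; exact: continuous_subspaceT.
exists (Num.max (B + 1) 0) => z; rewrite le_max.
have [Sz|nSz] := pselect (S z); last by rewrite dir_deriv_out // normr0 lexx orbT.
by rewrite (BP (B + 1)) ?ltrDl //; exists z.
Qed.

Lemma cutoff_diff (e : R * R) : e = (1, 0) \/ e = (0, 1) -> forall L, exists B, 0 <= B /\
  forall h z t, 0 <= h -> `|iter L (diff h) (fun s => chi (z + s *: e)) t| <= B * h ^+ L.
Proof.
move=> ee L; have [B BP] := dir_deriv_bounded ee L.
exists B; split=> [|h z t h0]; first exact: le_trans (normr_ge0 _) (BP 0).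
apply: (@diff_iter_bound _ (fun i s => dir_deriv e i (z + s *: e))) => // i s.
have d := @dir_deriv_derivable e ee i (z + s *: e).
have E : (fun h0 : R => h0^-1 *: ((fun s0 => dir_deriv e i (z + s0 *: e)) (h0 *: (1 : R) + s) - dir_deriv e i (z + s *: e)))
   = (fun h0 : R => h0^-1 *: ((dir_deriv e i \o shift (z + s *: e)) (h0 *: e) - dir_deriv e i (z + s *: e))).
  apply/funext => h1 /=; congr (_ *: (dir_deriv e i _ - _)).
  by rewrite scalerDl addrCA [h1 *: 1]mulr1.
apply: DeriveDef; first by rewrite /derivable E.
by rewrite /derive E.
Qed.

(** The support is compact in the open square. *)
Lemma cutoff_margin : exists2 c : R, 0 < c & forall z, chi z != 0 ->
  [/\ c <= z.1, c <= z.2, z.1 <= 1 - c & z.2 <= 1 - c].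
Proof.
have [_ _ cS inS] := chiP.
have [S0|/set0P/negP/negbNE/eqP S0] := pselect (S !=set0); last first.
  by exists 1 => // z cz; have := in_support cz; rewrite S0.
have pos (f : R * R -> R) : continuous f -> (forall z, S z -> 0 < f z) ->
    exists2 c : R, 0 < c & forall z, S z -> c <= f z.
  move=> cf fp.
  have cI : compact (f @` S) by apply: continuous_compact => //; exact: continuous_subspaceT.
  have [||z zS zmin] := @compact_EVT_min _ R f S _ cS; first by [].
    exact: continuous_subspaceT.
  exists (f z); first by apply: fp; rewrite inE in zS.
  by move=> y Sy; apply: zmin; rewrite inE.
have S_in z : S z -> (0 < z.1 < 1) && (0 < z.2 < 1) by move=> /inS.
have cf1 : continuous (fun z : R * R => z.1) by move=> z; exact: cvg_fst.
have cf2 : continuous (fun z : R * R => z.2) by move=> z; exact: cvg_snd.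
have [c1 c10 h1] : exists2 c : R, 0 < c & forall z, S z -> c <= z.1.
  by apply: pos => // z /S_in /andP[/andP[]].
have [c2 c20 h2] : exists2 c : R, 0 < c & forall z, S z -> c <= z.2.
  by apply: pos => // z /S_in /andP[_ /andP[]].
have [c3 c30 h3] : exists2 c : R, 0 < c & forall z, S z -> c <= 1 - z.1.
  apply: pos => [z|z /S_in /andP[/andP[_ +] _]]; last by rewrite subr_gt0.
  by apply: continuousB; [exact: cst_continuous|exact: cf1].
have [c4 c40 h4] : exists2 c : R, 0 < c & forall z, S z -> c <= 1 - z.2.
  apply: pos => [z|z /S_in /andP[_ /andP[_ +]]]; last by rewrite subr_gt0.
  by apply: continuousB; [exact: cst_continuous|exact: cf2].
exists (Num.min (Num.min c1 c2) (Num.min c3 c4)); first by rewrite !lt_min c10 c20 c30 c40.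
move=> z /in_support Sz; have e1 := h1 z Sz; have e2 := h2 z Sz.
have e3 := h3 z Sz; have e4 := h4 z Sz.
have le d : d = Num.min (Num.min c1 c2) (Num.min c3 c4) -> [/\ d <= c1, d <= c2, d <= c3 & d <= c4].
  by move=> ->; rewrite !ge_min !lexx ?orbT.
have [l1 l2 l3 l4] := le _ erefl; set d := Num.min _ _ in l1 l2 l3 l4 *.
by split; [exact: le_trans l1 e1|exact: le_trans l2 e2| |];
  rewrite lerBrDl -lerBrDr; [exact: le_trans l3 e3|exact: le_trans l4 e4].
Qed.
End Cutoff.

(** * The baker's map as a block Fourier operator *)

Local Open Scope complex_scope.
Local Close Scope classical_set_scope.

Section Baker.
Variables (R : realType) (M : nat) (A : {set 'I_M * 'I_M}) (chi : R * R -> R) (k : nat).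
Hypothesis M_gt1 : (1 < M)%N.
Hypothesis chi01 : forall z, 0 <= chi z <= 1.
Local Notation C := R[i].
Local Notation N := (M ^ k.+1)%N.
Local Notation N' := (M ^ k)%N.
Local Notation I := ('I_N * 'I_N)%type.
Local Notation I' := ('I_N' * 'I_N')%type.
Implicit Types (u v : I -> C).

Let M0 : (0 < M)%N. Proof. exact: ltnW. Qed.
Let expM0 j : (0 < M ^ j)%N. Proof. by rewrite expn_gt0 M0. Qed.

Lemma block_eq : (N = N' * M)%N. Proof. exact: expnSr. Qed.
Local Notation join := (join2 block_eq).

Fact hi_subproof (i : 'I_N) : (i %/ N' < M)%N.
Proof. by rewrite ltn_divLR // -expnS. Qed.
Definition hiP (i : I) : 'I_M * 'I_M := (Ordinal (hi_subproof i.1), Ordinal (hi_subproof i.2)).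
Definition loP (i : I) : I' := (Ordinal (ltn_pmod i.1 (expM0 k)), Ordinal (ltn_pmod i.2 (expM0 k))).

Lemma join_lohi i : join (loP i) (hiP i) = i.
Proof.
case: i => i1 i2; congr (_, _); apply: val_inj => /=.
  by rewrite addnC mulnC -divn_eq.
by rewrite addnC mulnC -divn_eq.
Qed.

Lemma lo_join j a : loP (join j a) = j.
Proof.
by case: j => j1 j2; congr (_, _); apply: val_inj => /=; rewrite join_mod ?ltn_ord.
Qed.

Lemma hi_join j a : hiP (join j a) = a.
Proof.
by case: a => a1 a2; congr (_, _); apply: val_inj => /=; rewrite join_div ?ltn_ord.
Qed.

Local Notation z := (zetaN R N).
Local Notation z' := (zetaN R N').

Lemma zP : N.-primitive_root z. Proof. exact: zetaN_prim. Qed.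
Lemma z'P : N'.-primitive_root z'. Proof. exact: zetaN_prim. Qed.

Lemma prim_inv n (w : C) : n.-primitive_root w -> n.-primitive_root w^-1.
Proof.
rewrite /primitive_root_of_unity => /andP[n0 /forallP H]; rewrite n0.
apply/forallP => i; have := H i; by rewrite !unity_rootE exprVn invr_eq1.
Qed.
Lemma zVP : N.-primitive_root z^-1. Proof. exact/prim_inv/zP. Qed.

Definition chiN (y : I') : C := (chi (y.1%:R / N'%:R, y.2%:R / N'%:R))%:C.

(** The part of the baker's map preceding the inverse transform: block by block, a
    cutoff, a transform of size [M ^ k], and a cutoff. *)
Definition Dop u (i : I) : C :=
  if hiP i \in A then
    chiN (loP i) * dft z' (fun y => chiN y * u (join y (hiP i))) (loP i)
  else 0.

Definition Bop u := dft z^-1 (Dop u).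

Lemma fourier_dft n (f : l2 R n) : fourier R n f =1 dft (zetaN R n) f.
Proof.
move=> xi; rewrite fourierE /dft; congr (_ * _); apply: eq_bigr => x _; congr (_ * _).
by rewrite /zetaN expiX mulNr.
Qed.

Lemma adjoint_fourier_dft n (n0 : (0 < n)%N) (v : l2 R n) : adjoint_op (fourier R n) v =1 dft (zetaN R n)^-1 v.
Proof.
move=> i; rewrite adjoint_opE /inner /dft mulr_sumr; apply: eq_bigr => j _.
rewrite mulrCA; congr (_ * _); rewrite fourier_dft.
have -> : dft (zetaN R n) (l2_delta R i) j = n%:R^-1 * zetaN R n ^+ dotp i j.
  rewrite /dft; congr (_ * _); rewrite (bigD1 i) //= big1 => [|x xi].
    by rewrite ffunE eqxx mul1r addr0.
  by rewrite ffunE (negPf xi) mul0r.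
have zc : (zetaN R n)^*%C = (zetaN R n)^-1 := zeta_conj (prim_root_expi R n0).
rewrite rmorphM fmorphV rmorph_nat; congr (_ * _).
by rewrite dotpC -zc; exact: (rmorphXn (@conjc R)).
Qed.

Lemma block_join (a : 'I_M * 'I_M) (j : I') : (block_index a.1 j.1, block_index a.2 j.2) = join j a.
Proof. by congr (_, _); apply: val_inj => /=; rewrite mulnC. Qed.

Lemma adjoint_Pi (a : 'I_M * 'I_M) (w : l2 R N') (i : I) :
  adjoint_op (Pi_op R k a) w i = if hiP i == a then w (loP i) else 0.
Proof.
rewrite adjoint_opE /inner; case: eqP => [<-|ne].
  rewrite (bigD1 (loP i)) //= big1 => [|j ji].
    by rewrite Pi_opE block_join join_lohi ffunE eqxx rmorph1 mulr1 addr0.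
  rewrite Pi_opE block_join ffunE; case: eqP => [e|_]; last by rewrite rmorph0 mulr0.
  by case/eqP: ji; rewrite -e lo_join.
apply: big1 => j _; rewrite Pi_opE block_join ffunE.
by case: eqP => [e|_]; [case: ne; rewrite -e hi_join|rewrite rmorph0 mulr0].
Qed.

Lemma baker_Bop (u : l2 R N) : baker A chi k u =1 Bop u.
Proof.
move=> x; rewrite /baker sum_lfunE sum_ffunE.
under eq_bigr => a _ do rewrite !comp_lfunE adjoint_fourier_dft //.
rewrite /Bop /dft -mulr_sumr exchange_big /=; congr (_ * _); apply: eq_bigr => i _.
rewrite -mulr_suml; congr (_ * _); rewrite /Dop.
under eq_bigr => a _ do rewrite adjoint_Pi.
case: ifPn => [iA|niA]; last first.
  by apply: big1 => a aA; case: eqP => // e; rewrite e aA in niA.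
rewrite (bigD1 (hiP i)) //= big1 ?addr0 => [|a /andP[_ ai]]; last by rewrite eq_sym (negPf ai).
rewrite eqxx cutoff_opE fourier_dft; congr (_ * _).
rewrite /dft; congr (_ * _); apply: eq_bigr => y _; congr (_ * _).
by rewrite cutoff_opE Pi_opE block_join.
Qed.

Lemma bil_Dop u v : bil (Dop u) v = bil u (Dop v).
Proof.
have sumD u' v' : bil (Dop u') v' = \sum_(a in A)
    bil (dft z' (fun y => chiN y * u' (join y a))) (fun y => chiN y * v' (join y a)).
  rewrite /bil (sum_join2 block_eq) exchange_big /= [RHS]big_mkcond; apply: eq_bigr => a _.
  case: ifPn => aA; last by apply: big1 => y _; rewrite /Dop hi_join (negPf aA) mul0r.
  by apply: eq_bigr => y _; rewrite /Dop hi_join aA lo_join mulrAC mulrC mulrA.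
rewrite sumD [RHS](_ : _ = bil (Dop v) u); last by apply: eq_bigr => i _; rewrite mulrC.
rewrite sumD; apply: eq_bigr => a _.
by rewrite dft_bil; apply: eq_bigr => y _; rewrite mulrC.
Qed.

Lemma sqn_chiN y : sqn (chiN y) <= 1.
Proof.
rewrite sqn_real; have /andP[h0 h1] := chi01 (y.1%:R / N'%:R, y.2%:R / N'%:R).
by rewrite expr2 mulr_ile1.
Qed.

Lemma N2_Dop u : N2 (Dop u) <= N2 u.
Proof.
rewrite /N2 (sum_join2 block_eq) [X in _ <= X](sum_join2 block_eq).
rewrite exchange_big [X in _ <= X]exchange_big /=; apply: ler_sum => a _.
have le1 (f : I' -> C) : N2 (fun y => chiN y * f y) <= N2 f.
  by apply: N2_le => y; rewrite sqnM ler_piMl ?sqn_ge0 ?sqn_chiN.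
have [aA|naA] := boolP (a \in A); last first.
  rewrite big1; last by move=> y _; rewrite /Dop hi_join (negPf naA) sqn0.
  by apply: sumr_ge0 => y _; exact: sqn_ge0.
apply: le_trans (le1 (fun y => u (join y a))).
rewrite -(dft_isometry z'P); apply: le_trans (le1 _).
by apply: ler_sum => y _; rewrite /Dop hi_join aA lo_join.
Qed.

Lemma N2_Bop u : N2 (Bop u) <= N2 u.
Proof. by rewrite (dft_isometry zVP) N2_Dop. Qed.

Lemma N2_iterB j u : N2 (iter j Bop u) <= N2 u.
Proof. by elim: j => //= j IHj; apply: le_trans (N2_Bop _) IHj. Qed.

(** The transpose of [Bop], which is also its conjugate by the Fourier transform. *)
Definition Bop' u := Dop (dft z^-1 u).

Lemma dftK' u : dft z (dft z^-1 u) =1 u.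
Proof. by move=> x; rewrite -{1}[z]invrK; apply: (dftK zVP). Qed.

Lemma Dop_ext u v : u =1 v -> Dop u =1 Dop v.
Proof. by move=> /funext ->. Qed.

(** This is why an eigenfunction satisfies the same propagation estimates in
    position and in frequency. *)
Lemma dft_Bop u : dft z (Bop u) =1 Bop' (dft z u).
Proof.
move=> x; rewrite /Bop dftK' /Bop'; apply: Dop_ext => y.
by rewrite (dftK zP).
Qed.

Lemma dft_iterB j u : dft z (iter j Bop u) =1 iter j Bop' (dft z u).
Proof.
elim: j => // j IHj x; rewrite !iterS dft_Bop.
by congr Bop'; apply/funext.
Qed.

Lemma bil_iterB j u v : bil (iter j Bop' u) v = bil u (iter j Bop v).
Proof.
elim: j v => // j IHj v; rewrite iterS iterSr -IHj /Bop' bil_Dop.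
by rewrite dft_bil.
Qed.

Lemma DopD u v x : Dop (fun i => u i + v i) x = Dop u x + Dop v x.
Proof.
rewrite /Dop; case: ifP => _; last by rewrite addr0.
rewrite -mulrDr; congr (_ * _); rewrite /dft -mulrDr -big_split; congr (_ * _).
by apply: eq_bigr => y _ /=; rewrite mulrDr mulrDl.
Qed.

Lemma dftD n (w : C) (u v : 'I_n * 'I_n -> C) x : dft w (fun i => u i + v i) x = dft w u x + dft w v x.
Proof.
rewrite /dft -mulrDr -big_split; congr (_ * _).
by apply: eq_bigr => y _ /=; rewrite mulrDl.
Qed.

Lemma BopD u v : Bop (fun i => u i + v i) = (fun x => Bop u x + Bop v x).
Proof.
apply/funext => x; rewrite /Bop -dftD; congr (dft _ _ x); apply/funext => i; exact: DopD.
Qed.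

Lemma iterBD j u v : iter j Bop (fun i => u i + v i) = (fun x => iter j Bop u x + iter j Bop v x).
Proof. by elim: j => //= j ->; rewrite BopD. Qed.

Lemma cutD (P : pred I) u : u = (fun x => cut P u x + cut (predC P) u x).
Proof. by apply/funext => x; rewrite /cut /=; case: (P x); rewrite ?addr0 ?add0r. Qed.

End Baker.

(** * Summation by parts *)

Section Phase.
Variable R : realType.
Local Notation C := R[i].

Lemma sqn_1sub (w : C) : sqn w = 1 -> sqn (1 - w) = 2 - 2 * complex.Re w.
Proof.
case: w => a b; rewrite /sqn /= => e; rewrite sub0r sqrrN.
have -> : (1 - a) ^+ 2 + b ^+ 2 = 1 - 2 * a + (a ^+ 2 + b ^+ 2) by ring.
by rewrite e; ring.
Qed.

Lemma sqn_1subX (w : C) q : sqn w = 1 -> sqn (1 - w ^+ q) <= q%:R ^+ 2 * sqn (1 - w).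
Proof.
move=> w1; rewrite -opprB subrX1 -opprB mulNr opprK sqnM mulrC ler_wpM2r ?sqn_ge0 //.
apply: le_trans (sqn_sum_le _ _) _; rewrite card_ord expr2 ler_wpM2l ?ler0n //.
rewrite (eq_bigr (fun=> 1)) ?sumr_const ?card_ord // => i _.
by rewrite sqnX w1 expr1n.
Qed.

Lemma cos_le0 (x : R) : pi / 2 <= x -> x <= 3 * (pi / 2) -> cos x <= 0.
Proof.
move=> h1 h2; rewrite -[x](subrK pi) cosDpi oppr_le0.
by apply: cos_ge0_pihalf; apply/andP; split; lra.
Qed.

(** Some power [q <= N / m] turns the angle into the left half plane, where [1 - w ^
    q] is large, while [1 - w ^ q] is at most [q] times [1 - w]. *)
Lemma sqn_1sub_half (N m : nat) : (0 < m)%N -> (2 * m <= N)%N ->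
  m%:R ^+ 2 <= N%:R ^+ 2 * sqn (1 - zetaN R N ^+ m).
Proof.
move=> m0 mN; have N0 : (0 < N)%N by lia.
pose q := (N %/ (4 * m)).+1.
have q1 : (N <= 4 * m * q)%N by have := divn_eq N (4 * m); have : (N %% (4 * m) < 4 * m)%N; [rewrite ltn_mod; lia|rewrite /q; nia].
have q2 : (4 * m * q <= N + 4 * m)%N by have := divn_eq N (4 * m); rewrite /q; nia.
have s1 : sqn (zetaN R N ^+ m) = 1 by rewrite sqnX sqn_expi expr1n.
have s2 : sqn (zetaN R N ^+ (m * q)) = 1 by rewrite sqnX sqn_expi expr1n.
have := sqn_1subX q s1; rewrite -exprM (sqn_1sub s2).
have -> : complex.Re (zetaN R N ^+ (m * q)) = cos (2 * pi / N%:R * (m * q)%:R).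
  by rewrite /zetaN expiX mulNr expiN.
have pi0 := pi_gt0 R; have Nr : 0 < N%:R :> R by rewrite ltr0n.
have q1r : N%:R <= 4 * (m * q)%:R :> R by rewrite -natrM ler_nat; lia.
have q2r : 4 * (m * q)%:R <= 3 * N%:R :> R by rewrite -!natrM ler_nat; lia.
have c0 : cos (2 * pi / N%:R * (m * q)%:R : R) <= 0.
  have -> : 2 * pi / N%:R * (m * q)%:R = pi / 2 * (4 * (m * q)%:R / N%:R) :> R.
    by field; rewrite lt0r_neq0.
  have X1 : 1 <= 4 * (m * q)%:R / N%:R :> R by rewrite ler_pdivlMr // mul1r.
  have X3 : 4 * (m * q)%:R / N%:R <= 3 :> R by rewrite ler_pdivrMr.
  have p2 : 0 <= pi / 2 :> R by lra.
  by apply: cos_le0; [rewrite ler_peMr|rewrite mulrC ler_wpM2r].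
move=> H.
set s := sqn _ in H *.
have s0 : 0 <= s by exact: sqn_ge0.
have H1 : 1 <= q%:R ^+ 2 * s by apply: le_trans H; lra.
have mq : (m * q <= N)%N by lia.
apply: le_trans (_ : m%:R ^+ 2 * (q%:R ^+ 2 * s) <= _); first by rewrite ler_peMr // sqr_ge0.
by rewrite mulrA ler_wpM2r // -exprMn -natrM ler_pXn2r ?nnegrE ?ler0n // ler_nat.
Qed.

Lemma sqn_1sub_zeta (N W m : nat) : (0 < W)%N -> (W <= m)%N -> (m + W <= N)%N ->
  W%:R ^+ 2 <= N%:R ^+ 2 * sqn (1 - zetaN R N ^+ m).
Proof.
move=> W0 Wm mN.
have Wle l : (W <= l)%N -> (W%:R : R) ^+ 2 <= l%:R ^+ 2.
  by move=> ?; rewrite ler_pXn2r ?nnegrE ?ler0n // ler_nat.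
have [h|h] := leqP (2 * m) N.
  by apply: le_trans (Wle _ Wm) (sqn_1sub_half _ h); lia.
have -> : sqn (1 - zetaN R N ^+ m) = sqn (1 - zetaN R N ^+ (N - m)).
  have N0 : (0 < N)%N by lia.
  have zP := prim_root_expi R N0.
  have s1 := sqn_zeta zP.
  have z0 : zetaN R N != 0 by rewrite -sqn_eq0 s1 oner_eq0.
  rewrite -[LHS](mul1r) -[X in X * _](_ : sqn (zetaN R N ^+ (N - m)) = 1); last by rewrite sqnX s1 expr1n.
  rewrite -sqnM mulrBr mulr1 -exprD subnK; last by lia.
  by rewrite (prim_expr_order zP) -opprB -[RHS]mul1r -[X in X * _](_ : sqn (-1) = 1) -?sqnM ?mulN1r // /sqn /= oppr0 expr0n addr0 sqrrN expr1n.
by apply: le_trans (Wle (N - m)%N _) (sqn_1sub_half _ _); lia.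
Qed.

Definition nabla (g : nat -> R) (j : nat) : R := g j.+1 - g j.

Lemma nabla_sum (g : nat -> R) (w : C) K : g 0%N = 0 -> g K = 0 ->
  w * (\sum_(j < K) (nabla g j)%:C * w ^+ j) = (1 - w) * \sum_(j < K) (g j)%:C * w ^+ j.
Proof.
move=> g0 gK.
suff H n : w * (\sum_(j < n) (nabla g j)%:C * w ^+ j) =
    (1 - w) * (\sum_(j < n) (g j)%:C * w ^+ j) + (g n)%:C * w ^+ n - (g 0%N)%:C.
  by rewrite H gK g0 !rmorph0 mul0r subr0 addr0.
elim: n => [|n IHn]; first by rewrite !big_ord0 !mulr0 add0r expr0 mulr1 subrr.
rewrite !big_ord_recr /= !mulrDr IHn /nabla rmorphB /= exprS; ring.
Qed.

Lemma nabla_start l (g : nat -> R) : (forall j, (j <= l)%N -> g j = 0) -> iter l nabla g 0%N = 0.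
Proof.
elim: l g => [|l IHl] g H; first exact: H.
rewrite iterSr; apply: IHl => j jl; rewrite /nabla !H ?subrr //; lia.
Qed.

Lemma nabla_end l (g : nat -> R) K : (forall j, (K <= j)%N -> g j = 0) ->
  forall j, (K <= j)%N -> iter l nabla g j = 0.
Proof.
elim: l => // l IHl H j Kj; rewrite iterS /nabla !IHl ?subrr //; lia.
Qed.

(** Each step exchanges a factor [1 - w] for a difference of the coefficients; the
    zeros of [g] at both ends remove the boundary terms. *)
Lemma summation_by_parts L (g : nat -> R) (w : C) K (D : R) : sqn w = 1 ->
  (forall j, (j <= L)%N -> g j = 0) -> (forall j, (K <= j)%N -> g j = 0) ->
  (forall j, `|iter L nabla g j| <= D) ->
  sqn (1 - w) ^+ L * sqn (\sum_(j < K) (g j)%:C * w ^+ j) <= (K%:R * D) ^+ 2.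
Proof.
move=> w1 gL gK gD.
have -> : sqn (1 - w) ^+ L * sqn (\sum_(j < K) (g j)%:C * w ^+ j) =
    sqn (\sum_(j < K) (iter L nabla g j)%:C * w ^+ j).
  have H l : (l <= L)%N -> w ^+ l * (\sum_(j < K) (iter l nabla g j)%:C * w ^+ j) =
      (1 - w) ^+ l * \sum_(j < K) (g j)%:C * w ^+ j.
    elim: l => [_|l IHl lL]; first by rewrite !expr0 !mul1r.
    have h0 : iter l nabla g 0%N = 0 by apply: nabla_start => j jl; apply: gL; lia.
    rewrite exprSr -mulrA /= (nabla_sum w h0 (nabla_end l gK (leqnn K))).
    by rewrite mulrCA IHl ?(ltnW lL) // exprS mulrA.
  have := congr1 (@sqn R) (H L (leqnn L)); rewrite !sqnM !sqnX w1 expr1n mul1r => <- //.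
apply: le_trans (sqn_sum_le _ _) _.
rewrite card_ord exprMn expr2 -mulrA ler_wpM2l ?ler0n //.
apply: le_trans (_ : \sum_(j < K) D ^+ 2 <= _); last first.
  by rewrite sumr_const card_ord mulr_natl.
apply: ler_sum => j _; rewrite sqnM sqnX w1 expr1n mulr1 sqn_real.
have D0 : 0 <= D by apply: le_trans (gD 0%N).
by rewrite -real_normK ?num_real // ler_pXn2r ?nnegrE.
Qed.

End Phase.

(** * Decay of the kernel *)

Section Oscillatory.
Variables (R : realType) (chi : R * R -> R).
Hypothesis chiP : is_cutoff chi.
Local Notation C := R[i].

Lemma nabla_diff (f : R -> R) (h s0 : R) l j :
  iter l (@nabla R) (fun j => f (j%:R * h + s0)) j = iter l (diff h) f (j%:R * h + s0).
Proof.
elim: l j => // l IHl j; rewrite !iterS /nabla /diff !IHl.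
by rewrite -natr1 mulrDl mul1r addrAC.
Qed.

(** The coefficients are shifted by [L] so that [L] successive differences still
    start at 0. *)
Lemma line_sum (e : R * R) : e = (1, 0) \/ e = (0, 1) -> forall L, exists B, 0 <= B /\
  forall n z (w : C), (0 < n)%N -> sqn w = 1 ->
    (forall s, s <= 0 \/ 1 <= s -> chi (z + s *: e) = 0) ->
    sqn (1 - w) ^+ L * sqn (\sum_(j < n) (chi (z + (j%:R / n%:R) *: e))%:C * w ^+ j)
      <= ((L + n)%:R * (B * n%:R^-1 ^+ L)) ^+ 2.
Proof.
move=> ee L; have [B [B0 HB]] := cutoff_diff chiP ee L; exists B; split=> // n z w n0 w1 out.
pose f s := chi (z + s *: e).
pose s0 : R := - (L%:R * n%:R^-1).
pose g j := f (j%:R * n%:R^-1 + s0).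
have nr : 0 < n%:R :> R by rewrite ltr0n.
have g0 j : (j <= L)%N -> g j = 0.
  by move=> jL; apply: out; left; rewrite /s0 -mulrBl pmulr_lle0 ?invr_gt0 // subr_le0 ler_nat.
have g1 j : (L + n <= j)%N -> g j = 0.
  by move=> jL; apply: out; right; rewrite /s0 -mulrBl ler_pdivlMr // mul1r lerBrDl -natrD ler_nat.
have gB j : `|iter L (@nabla R) g j| <= B * n%:R^-1 ^+ L.
  by rewrite nabla_diff; apply: HB; rewrite invr_ge0 ltW.
have := summation_by_parts w1 g0 g1 gB; rewrite big_split_ord /= big1 ?add0r; last first.
  by move=> i _; rewrite g0 ?rmorph0 ?mul0r // ltnW.
rewrite (eq_bigr (fun j : 'I_n => w ^+ L * ((chi (z + (j%:R / n%:R) *: e))%:C * w ^+ j))).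
  by rewrite -mulr_sumr sqnM sqnX w1 expr1n mul1r.
move=> j _; rewrite exprD mulrCA; congr (_ * (_ * _)).
by rewrite /g /f /s0 natrD mulrDl addrAC subrr add0r.
Qed.

Definition osc n (w1 w2 : C) : C :=
  \sum_(j : 'I_n * 'I_n) (chi (j.1%:R / n%:R, j.2%:R / n%:R))%:C * (w1 ^+ j.1 * w2 ^+ j.2).

(** Summation by parts in one variable, and the trivial bound in the other one. *)
Lemma osc_bound L : exists B, 0 <= B /\ forall n (w1 w2 : C), (0 < n)%N -> sqn w1 = 1 -> sqn w2 = 1 ->
  sqn (1 - w1) ^+ L * sqn (osc n w1 w2) <= n%:R ^+ 2 * ((L + n)%:R * (B * n%:R^-1 ^+ L)) ^+ 2 /\
  sqn (1 - w2) ^+ L * sqn (osc n w1 w2) <= n%:R ^+ 2 * ((L + n)%:R * (B * n%:R^-1 ^+ L)) ^+ 2.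
Proof.
have [B1 [B10 H1]] := line_sum (or_introl erefl) L.
have [B2 [B20 H2]] := line_sum (or_intror erefl) L.
pose B := Num.max B1 B2; exists B; split=> [|n w1 w2 n0 u1 u2]; first by rewrite le_max B10.
have mono B' : 0 <= B' -> B' <= B -> ((L + n)%:R * (B' * n%:R^-1 ^+ L)) ^+ 2 <= ((L + n)%:R * (B * n%:R^-1 ^+ L)) ^+ 2.
  move=> B'0 B'B; have p0 : 0 <= (n%:R^-1 : R) ^+ L by rewrite exprn_ge0 // invr_ge0 ler0n.
  have nn x : 0 <= x -> 0 <= (L + n)%:R * (x * n%:R^-1 ^+ L) :> R by move=> x0; rewrite !mulr_ge0 ?ler0n.
  apply: lerXn2r; rewrite ?nnegrE ?nn ?(le_trans B'0 B'B) //.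
  by rewrite ler_wpM2l ?ler0n // ler_wpM2r.
have outer D (G : 'I_n -> C) (w : C) (x : R) : 0 <= x -> sqn w = 1 -> (forall j, x * sqn (G j) <= D) ->
    x * sqn (\sum_(j < n) G j * w ^+ j) <= n%:R ^+ 2 * D.
  move=> x0 w_1 GD; apply: le_trans (ler_wpM2l x0 (sqn_sum_le _ _)) _.
  rewrite card_ord mulrCA expr2 -mulrA ler_wpM2l ?ler0n // mulr_sumr.
  apply: le_trans (_ : \sum_(j < n) D <= _); last by rewrite sumr_const card_ord mulr_natl.
  by apply: ler_sum => j _; rewrite sqnM sqnX w_1 expr1n mulr1.
split.
- have -> : osc n w1 w2 = \sum_(j2 < n) (\sum_(j1 < n)
      (chi ((0, j2%:R / n%:R) + (j1%:R / n%:R) *: ((1, 0) : R * R)))%:C * w1 ^+ j1) * w2 ^+ j2.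
    rewrite /osc -(pair_bigA _ (fun j1 j2 : 'I_n => (chi (j1%:R / n%:R, j2%:R / n%:R))%:C * (w1 ^+ j1 * w2 ^+ j2))) /=.
    rewrite exchange_big; apply: eq_bigr => j2 _; rewrite mulr_suml; apply: eq_bigr => j1 _.
    rewrite mulrA; congr (_%:C * _ * _); congr chi; congr (_, _) => /=.
      by rewrite add0r -[RHS]/(_ * 1) mulr1.
    by rewrite -[RHS]/(_ + _ * 0) mulr0 addr0.
  apply: outer => //; first by rewrite exprn_ge0 ?sqn_ge0.
  move=> j2; apply: le_trans (H1 _ _ _ n0 u1 _) (mono _ B10 _); last by rewrite le_max lexx.
  move=> s hs; apply: (cutoff_out chiP) => /=.
  by rewrite add0r -[s *: _]/(s * 1) mulr1; case: hs => /le_gtF ->; rewrite ?andbF.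
- have -> : osc n w1 w2 = \sum_(j1 < n) (\sum_(j2 < n)
      (chi ((j1%:R / n%:R, 0) + (j2%:R / n%:R) *: ((0, 1) : R * R)))%:C * w2 ^+ j2) * w1 ^+ j1.
    rewrite /osc -(pair_bigA _ (fun j1 j2 : 'I_n => (chi (j1%:R / n%:R, j2%:R / n%:R))%:C * (w1 ^+ j1 * w2 ^+ j2))) /=.
    apply: eq_bigr => j1 _; rewrite mulr_suml; apply: eq_bigr => j2 _.
    rewrite -mulrA; congr (_%:C * _); last by rewrite mulrC.
    congr chi; congr (_, _) => /=.
      by rewrite -[RHS]/(_ + _ * 0) mulr0 addr0.
    by rewrite add0r -[RHS]/(_ * 1) mulr1.
  apply: outer => //; first by rewrite exprn_ge0 ?sqn_ge0.
  move=> j2; apply: le_trans (H2 _ _ _ n0 u2 _) (mono _ B20 _); last by rewrite le_max lexx orbT.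
  move=> s hs; apply: (cutoff_out chiP) => /=.
  by rewrite add0r -[s *: (1 : R)]/(s * 1) mulr1; case: hs => /le_gtF ->; rewrite ?andbF.
Qed.

End Oscillatory.

Section Kernel.
Variables (R : realType) (M : nat) (A : {set 'I_M * 'I_M}) (chi : R * R -> R) (k : nat).
Hypothesis M_gt1 : (1 < M)%N.
Hypothesis chiP : is_cutoff chi.
Local Notation C := R[i].
Local Notation N := (M ^ k.+1)%N.
Local Notation N' := (M ^ k)%N.
Local Notation I := ('I_N * 'I_N)%type.
Implicit Types (u v : I -> C).
Local Notation z := (zetaN R N).
Local Notation z' := (zetaN R N').
Local Notation loP := (loP M_gt1).
Local Notation hiP := (hiP M_gt1).
Local Notation chiN := (@chiN R M chi k).

Definition kern (x i : I) : C :=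
  if hiP i \in A then
    chiN (loP i) * (N%:R^-1 * N'%:R^-1 * \sum_j chiN j * (z' ^+ dotp (loP i) j * z^-1 ^+ dotp (join2 (block_eq M k) j (hiP i)) x))
  else 0.

Lemma Bop_kern v x : Bop A chi M_gt1 v x = \sum_i kern x i * v i.
Proof.
rewrite /Bop /dft (sum_join2 (block_eq M k)) [RHS](sum_join2 (block_eq M k)) exchange_big [RHS]exchange_big /=.
rewrite mulr_sumr; apply: eq_bigr => a _.
rewrite /kern /Dop; under [RHS]eq_bigr => y _ do rewrite hi_join lo_join.
under [in LHS]eq_bigr => y _ do rewrite hi_join lo_join.
case: (a \in A); last first.
  rewrite [RHS]big1 => [|y _]; last by rewrite mul0r.
  by rewrite big1 ?mulr0 // => y _; rewrite mul0r.
rewrite mulr_sumr.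
transitivity (\sum_(j : 'I_N' * 'I_N') \sum_(y : 'I_N' * 'I_N') chiN y * v (join2 (block_eq M k) y a) * z' ^+ dotp y j *
    (chiN j * N'%:R^-1 * N%:R^-1 * z^-1 ^+ dotp (join2 (block_eq M k) j a) x)).
  apply: eq_bigr => j _; rewrite -mulr_suml /dft; set S := \sum_(y : _) _.
  by set c := chiN j; set e := _ ^+ _; ring.
rewrite exchange_big; apply: eq_bigr => y _ /=.
rewrite mulr_sumr mulr_sumr mulr_suml; apply: eq_bigr => j _.
by set c := chiN j; set c' := chiN y; set e := z^-1 ^+ _; set e' := z' ^+ _; ring.
Qed.

Lemma BopZ (l : C) v : Bop A chi M_gt1 (fun x => l * v x) = (fun x => l * Bop A chi M_gt1 v x).
Proof.
apply/funext => x; rewrite !Bop_kern mulr_sumr.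
by apply: eq_bigr => j _; rewrite mulrCA.
Qed.

(** The high part of the index contributes only a phase. *)
Lemma kern_osc x i : hiP i \in A ->
  sqn (kern x i) = sqn (chiN (loP i)) * (N%:R^-1 ^+ 2 * N'%:R^-1 ^+ 2 *
    sqn (osc chi N' (z' ^+ (loP i).1 * z^-1 ^+ x.1) (z' ^+ (loP i).2 * z^-1 ^+ x.2))).
Proof.
move=> iA; rewrite /kern iA !sqnM !sqn_natV -!exprVn; congr (_ * (_ * _)).
have s1 : sqn (z^-1 ^+ (N' * ((hiP i).1 * x.1 + (hiP i).2 * x.2))) = 1.
  rewrite sqnX; have -> : sqn z^-1 = 1; last by rewrite expr1n.
  exact/(@sqn_zeta _ N)/prim_inv/zetaN_prim.
rewrite -[RHS]mul1r -s1 -sqnM; congr sqn; rewrite /osc mulr_sumr; apply: eq_bigr => j _.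
rewrite [RHS]mulrCA; congr (_ * _).
have -> : dotp (join2 (block_eq M k) j (hiP i)) x = (N' * ((hiP i).1 * x.1 + (hiP i).2 * x.2) + (x.1 * j.1 + x.2 * j.2))%N.
  by rewrite /dotp /=; ring.
rewrite exprD mulrCA; congr (_ * _).
by rewrite !exprMn -!exprM /dotp !exprD mulrACA.
Qed.

(** The phase [z' ^ y * z^-1 ^ x] is a root of unity of angle [2 pi (x - M y) / N],
    which is far from 0 both when [x] is far from [M y] and when there is no
    wraparound modulo [N]. *)
Lemma phase_gap (W x y : nat) : (0 < W)%N ->
  (W <= x - M * y)%N || (W <= M * y - x)%N -> (x + W <= N + M * y)%N -> (M * y + W <= N + x)%N ->
  (W%:R : R) ^+ 2 <= N%:R ^+ 2 * sqn (1 - z' ^+ y * z^-1 ^+ x).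
Proof.
move=> W0 far h1 h2.
have zz : z' = z ^+ M by rewrite (block_eq M k) zetaN_mul // ltnW.
have zP : N.-primitive_root z by exact: zetaN_prim.
have z0 : z != 0 by rewrite -sqn_eq0 (sqn_zeta zP) oner_eq0.
rewrite zz -exprM; case: (leqP x (M * y)) => [le|/ltnW le].
  rewrite -{1}(subnK le) exprD exprVn mulfK ?expf_neq0 //.
  by apply: sqn_1sub_zeta => //; lia.
have -> : z ^+ (M * y) * z^-1 ^+ x = (z ^+ (x - M * y))^*%C.
  have -> : (z ^+ (x - M * y))^*%C = z^-1 ^+ (x - M * y).
    by rewrite -(zeta_conj zP); exact: (rmorphXn (@conjc R)).
  by rewrite -{1}(subnK le) exprD mulrCA -exprMn divff // expr1n mulr1.
have -> : 1 - (z ^+ (x - M * y))^*%C = (1 - z ^+ (x - M * y))^*%C by rewrite (rmorphB (@conjc R)) rmorph1.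
by rewrite sqn_conj; apply: sqn_1sub_zeta => //; lia.
Qed.

End Kernel.

(** The absolute difference of [a] and [b] is at least [W]. *)
Definition far (a b W : nat) := (W <= a - b)%N || (W <= b - a)%N.

(** The support of the cutoff keeps [M y] away from 0 and [N], which excludes the
    wraparound in [phase_gap]. *)
Lemma kern_bound (R : realType) (M : nat) (A : {set 'I_M * 'I_M}) (chi : R * R -> R) (c : R)
  (M_gt1 : (1 < M)%N) : is_cutoff chi ->
  (forall z, chi z != 0 -> [/\ c <= z.1, c <= z.2, z.1 <= 1 - c & z.2 <= 1 - c]) ->
  forall L, exists K : R, 0 <= K /\ forall k W (x i : 'I_(M ^ k.+1) * 'I_(M ^ k.+1)),
    (0 < W)%N -> W%:R <= c * (M ^ k.+1)%:R ->
    far x.1 (M * (loP M_gt1 i).1)%N W || far x.2 (M * (loP M_gt1 i).2)%N W ->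
    W%:R ^+ (2 * L) * sqn (kern A chi M_gt1 x i) <= K.
Proof.
move=> chiP marg L; have [B [B0 HB]] := osc_bound chiP L.
exists (((L.+1)%:R * B * M%:R ^+ L) ^+ 2); split=> [|k W x i W0 Wc bad]; first exact: sqr_ge0.
set N := (M ^ k.+1)%N in x i Wc bad *.
have M0 : (0 < M)%N by apply: ltnW.
have n0 : (0 < M ^ k)%N by rewrite expn_gt0 M0.
have n0r : 0 < (M ^ k)%:R :> R by rewrite ltr0n.
have NE : N = (M ^ k * M)%N by exact: expnSr.
have N0 : 0 < N%:R :> R by rewrite ltr0n expn_gt0 M0.
have [iA|niA] := boolP (hiP M_gt1 i \in A); last by rewrite /kern (negPf niA) sqn0 mulr0 sqr_ge0.
rewrite kern_osc //.
set y := loP M_gt1 i in bad *.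
have [c0|cn0] := eqVneq (chi (y.1%:R / (M ^ k)%:R, y.2%:R / (M ^ k)%:R)) 0.
  by rewrite /chiN c0 sqn0 mul0r mulr0 sqr_ge0.
have [/= m1 m2 m3 m4] := marg _ cn0.
have gap (a : nat) (b : nat) : (b < N)%N -> c <= a%:R / (M ^ k)%:R -> a%:R / (M ^ k)%:R <= 1 - c ->
    (b + W <= N + M * a)%N /\ (M * a + W <= N + b)%N.
  move=> bN l1 l2.
  have MaN : (M * a)%:R = N%:R * (a%:R / (M ^ k)%:R) :> R.
    by rewrite NE !natrM; field; rewrite lt0r_neq0.
  have e1 : c * N%:R <= (M * a)%:R by rewrite MaN [leRHS]mulrC ler_pM2r.
  have e2 : (M * a)%:R <= N%:R - c * N%:R.
    by rewrite MaN [leLHS]mulrC -[X in X - _]mul1r -mulrBl ler_pM2r.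
  split.
    by apply: leq_add (ltnW bN) _; rewrite -(ler_nat R); apply: le_trans e1.
  apply: leq_trans (leq_addr _ _); rewrite -(ler_nat R) natrD.
  by rewrite -lerBrDr; apply: le_trans e2 _; rewrite lerD2l lerN2.
set w1 := (_ * _ ^+ x.1); set w2 := (_ * _ ^+ x.2).
have unit_w a b : sqn (zetaN R (M ^ k) ^+ a * (zetaN R N)^-1 ^+ b) = 1.
  rewrite sqnM !sqnX (sqn_zeta (zetaN_prim R M_gt1 k)).
  by rewrite (sqn_zeta (prim_inv (zetaN_prim R M_gt1 k.+1))) !expr1n mul1r.
have [h1 h2] := HB _ _ _ n0 (unit_w y.1 x.1) (unit_w y.2 x.2).
have main (w : R[i]) : (W%:R : R) ^+ 2 <= N%:R ^+ 2 * sqn (1 - w) ->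
    sqn (1 - w) ^+ L * sqn (osc chi (M ^ k) w1 w2) <=
      (M ^ k)%:R ^+ 2 * ((L + M ^ k)%:R * (B * (M ^ k)%:R^-1 ^+ L)) ^+ 2 ->
    W%:R ^+ (2 * L) * (N%:R^-1 ^+ 2 * (M ^ k)%:R^-1 ^+ 2 * sqn (osc chi (M ^ k) w1 w2)) <=
      (L.+1%:R * B * M%:R ^+ L) ^+ 2.
  move=> Ww ow.
  set S := sqn (osc _ _ _ _) in ow *.
  have S0 : 0 <= S by exact: sqn_ge0.
  set n := (M ^ k)%N in n0 n0r NE ow *.
  have H1 : W%:R ^+ (2 * L) * S <= N%:R ^+ (2 * L) * (n%:R ^+ 2 * ((L + n)%:R * (B * n%:R^-1 ^+ L)) ^+ 2).
    apply: le_trans (_ : N%:R ^+ (2 * L) * (sqn (1 - w) ^+ L * S) <= _); last first.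
      by rewrite ler_wpM2l // exprn_ge0 // ltW.
    rewrite mulrA ler_wpM2r // !exprM -exprMn.
    by apply: lerXn2r => //; rewrite nnegrE ?sqr_ge0 ?mulr_ge0 ?sqr_ge0 ?sqn_ge0.
  rewrite mulrCA; apply: le_trans (ler_wpM2l _ H1) _.
    by rewrite mulr_ge0 // exprn_ge0 // invr_ge0 ltW.
  have -> : N%:R^-1 ^+ 2 * n%:R^-1 ^+ 2 * (N%:R ^+ (2 * L) * (n%:R ^+ 2 * ((L + n)%:R * (B * n%:R^-1 ^+ L)) ^+ 2)) =
    ((L + n)%:R / N%:R * (B * M%:R ^+ L)) ^+ 2 :> R.
    rewrite [X in X%:R ^+ (2 * L)]NE natrM [(2 * L)%N]mulnC exprM exprMn !exprVn.
    have nL : (n%:R : R) ^+ L != 0 by rewrite expf_neq0 // lt0r_neq0.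
    by field; rewrite nL !lt0r_neq0.
  apply: lerXn2r; rewrite ?nnegrE ?mulr_ge0 ?exprn_ge0 ?ler0n ?invr_ge0 ?ler0n //.
  rewrite -[leRHS]mulrA; apply: ler_wpM2r; first by rewrite mulr_ge0 ?exprn_ge0 ?ler0n.
  rewrite ler_pdivrMr // -natrM ler_nat NE mulnA.
  apply: leq_trans (leq_pmulr _ M0); rewrite mulSn addnC leq_add2l leq_pmulr //.
rewrite mulrCA; apply: le_trans (_ : _ <= 1 * (L.+1%:R * B * M%:R ^+ L) ^+ 2) _; last by rewrite mul1r.
apply: ler_pM; rewrite ?sqn_ge0 ?mulr_ge0 ?exprn_ge0 ?invr_ge0 ?ler0n ?sqn_ge0 ?(sqn_chiN (cutoff_range chiP)) //.
case/orP: bad => bad.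
  have [g1 g2] := gap y.1 x.1 (ltn_ord _) m1 m3.
  by apply: main h1; apply: phase_gap.
have [g1 g2] := gap y.2 x.2 (ltn_ord _) m2 m4.
by apply: main h2; apply: phase_gap.
Qed.

(** * Propagation *)

Section Propagation.
Variables (R : realType) (M : nat) (A : {set 'I_M * 'I_M}) (chi : R * R -> R) (k : nat).
Hypothesis M_gt1 : (1 < M)%N.
Hypothesis chi01 : forall z, 0 <= chi z <= 1.
Local Notation C := R[i].
Local Notation N := (M ^ k.+1)%N.
Local Notation I := ('I_N * 'I_N)%type.
Implicit Types (u v : I -> C).
Local Notation hiP := (@hiP M k M_gt1).
Local Notation loP := (@loP M k M_gt1).
Local Notation Bop := (Bop A chi M_gt1).
Local Notation Bop' := (Bop' A chi M_gt1).
Local Notation kern := (kern A chi M_gt1).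

Lemma N2_kern (T P : pred I) (d : R) v : 0 <= d ->
  (forall x i, T x -> P i -> sqn (kern x i) <= d) ->
  N2 (cut T (Bop (cut P v))) <= N%:R ^+ 4 * d * N2 v.
Proof.
move=> d0 H; rewrite N2_cut.
have Nd : N%:R ^+ 4 * d * N2 v = \sum_(x : I) ((\sum_(i : I) d) * N2 v).
  have S (e : R) : \sum_(i : I) e = N%:R ^+ 2 * e.
    by rewrite sumr_const card_prod card_ord -[LHS]mulr_natl natrM expr2.
  by rewrite !S; set X := N%:R; ring.
rewrite Nd big_mkcond; apply: ler_sum => x _; case: ifP => Tx; last first.
  by rewrite mulr_ge0 ?N2_ge0 // sumr_ge0.
rewrite (Bop_kern A chi M_gt1).
have -> : \sum_i kern x i * cut P v i = \sum_i cut P (kern x) i * v i.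
  by apply: eq_bigr => i _; rewrite /cut; case: ifP; rewrite ?mulr0 ?mul0r.
apply: le_trans (cauchy_schwarz _ _) _; rewrite ler_wpM2r ?N2_ge0 //.
by apply: ler_sum => i _; rewrite /cut; case: ifP => Pi; rewrite ?sqn0 //; apply: H.
Qed.

Variable W : nat.
Definition near (a b : nat) := ~~ far a b W.

(** The points from which one step of the expanding map [x |-> M x], allowed on the
    blocks in [A], leads to the [W]-neighbourhood of [S].  The kernel is small for
    all other inputs. *)
Definition back (S : pred I) : pred I := fun x => (hiP x \in A) &&
  [exists x' : I, [&& S x', near x'.1 (M * (loP x).1) & near x'.2 (M * (loP x).2)]].
Definition reach (i : nat) : pred I := iter i back predT.

Section Decay.
Variable d : R.
Hypothesis d0 : 0 <= d.
Hypothesis small : forall x i : I, far x.1 (M * (loP i).1) W || far x.2 (M * (loP i).2) W ->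
  sqn (kern x i) <= d.

Lemma N2_step i v : N2 (cut (reach i) (Bop (cut (predC (reach i.+1)) v))) <= N%:R ^+ 4 * d * N2 v.
Proof.
apply: N2_kern => // x y rx; rewrite /reach iterS /= /back negb_and => /orP[niA|/existsPn/(_ x)].
  by rewrite /kern (negPf niA) sqn0.
rewrite -/(reach i) rx /= -negb_or negbK; exact: small.
Qed.

(** The error obeys [eps (i + 1) = 2 * eps i + 2 * delta], where [delta] is the
    error of one step, and starts at 0. *)
Definition eps i : R := (2 ^+ i.+1 - 2) * (N%:R ^+ 4 * d).

Lemma eps_ge0 i : 0 <= eps i.
Proof.
rewrite mulr_ge0 ?mulr_ge0 ?exprn_ge0 ?ler0n // subr_ge0 exprS ler_peMr //.
by rewrite exprn_ege1 // ler1n.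
Qed.

(** A function off [reach (i + 1)] is mapped, up to a small error, to a function off
    [reach i]. *)
Lemma N2_off i v : (forall x, reach i x -> v x = 0) -> N2 (iter i Bop v) <= eps i * N2 v.
Proof.
elim: i v => [|i IHi] v Hv.
  rewrite /eps expr1 subrr !mul0r /=.
  by rewrite /N2 big1 // => x _; rewrite Hv ?sqn0.
have vE : v = cut (predC (reach i.+1)) v.
  by apply/funext => x; rewrite /cut; case: ifP => // /negbFE /Hv.
rewrite iterSr [Bop v](cutD (reach i)) iterBD; apply: le_trans (N2D_le _ _) _.
have h1 : N2 (iter i Bop (cut (reach i) (Bop v))) <= N%:R ^+ 4 * d * N2 v.
  by apply: le_trans (N2_iterB A M_gt1 chi01 i _) _; rewrite {1}vE; apply: N2_step.
have h2 : N2 (iter i Bop (cut (predC (reach i)) (Bop v))) <= eps i * N2 v.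
  apply: le_trans (IHi _ _) _; first by move=> x rx; rewrite /cut /= rx.
  apply: (ler_wpM2l (eps_ge0 i)); apply: le_trans (N2_cut_le _ _) _; exact: N2_Bop.
apply: le_trans (lerD (ler_wpM2l _ h1) (ler_wpM2l _ h2)) _ => //.
by rewrite /eps [2 ^+ i.+2]exprS le_eqVlt; apply/orP; left; apply/eqP; ring.
Qed.

(** Duality with [N2_off]: the transposed map only produces functions concentrated
    on the reachable set. *)
Lemma N2_off_dual i v : N2 (cut (predC (reach i)) (iter i Bop' v)) <= eps i * N2 v.
Proof.
set y := iter i Bop' v; set T' := predC (reach i).
pose g x := (cut T' y x)^*%C.
have Ng : N2 g = N2 (cut T' y) by apply: eq_bigr => x _; rewrite sqn_conj.
have e1 : ((N2 (cut T' y))%:C)%C = bil y g.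
  rewrite /N2 rmorph_sum; apply: eq_bigr => x _; apply: (etrans (sqnC _)); rewrite /g /cut.
  by case: ifP; rewrite ?mul0r // rmorph0 mulr0.
have q0 := N2_ge0 (cut T' y).
have : N2 (cut T' y) ^+ 2 <= N2 v * (eps i * N2 (cut T' y)).
  rewrite -sqn_real e1 /y bil_iterB; apply: le_trans (cauchy_schwarz _ _) _.
  apply: ler_wpM2l; rewrite ?N2_ge0 // -Ng; apply: N2_off => x rx.
  by rewrite /g /cut /T' /= rx rmorph0.
move: q0; set q := N2 _; rewrite le_eqVlt => /orP[/eqP <- _|q0].
  by rewrite mulr_ge0 ?eps_ge0 ?N2_ge0.
by rewrite mulrCA mulrA expr2 ler_pM2r.
Qed.

(** Apply [B ^ i] to [B ^ i u]: up to a small error, the outer [B ^ i] only sees the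
    part of [B ^ i u] on the reachable set, while by [dft_iterB] the transform of [B
    ^ i u] is concentrated on the same set.  The uncertainty principle then bounds
    [B ^ (2 i) u]. *)
Lemma eigen_bound i (rho : R) u (l : C) : 0 <= rho ->
  (forall v, (forall x, ~~ reach i x -> v x = 0) ->
     N2 (cut (reach i) (dft (zetaN R N)^-1 v)) <= rho * N2 v) ->
  N2 u = 1 -> Bop u = (fun x => l * u x) ->
  sqn l ^+ (2 * i) <= 4 * rho + 6 * eps i.
Proof.
move=> rho0 fup u1 Bu.
have Bi j v a : Bop v = (fun x => a * v x) -> iter j Bop v = (fun x => a ^+ j * v x).
  move=> Bv; elim: j => [|j IHj]; first by apply/funext => x; rewrite expr0 mul1r.
  by rewrite iterS IHj BopZ Bv; apply/funext => x; rewrite exprSr mulrA.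
set w := iter i Bop u.
have wE : N2 (iter i Bop w) = sqn l ^+ (2 * i).
  rewrite /w -ssrnat.iterD (Bi _ _ _ Bu) -[RHS]mulr1 -u1 /N2 mulr_sumr; apply: eq_bigr => x _.
  by rewrite sqnM sqnX addnn mul2n.
have w1 : N2 w <= 1 by rewrite -u1; apply: N2_iterB.
rewrite -wE [w](cutD (reach i)) iterBD; apply: le_trans (N2D_le _ _) _.
have h2 : N2 (iter i Bop (cut (predC (reach i)) w)) <= eps i.
  apply: le_trans (N2_off _) _; first by move=> x rx; rewrite /cut /= rx.
  by rewrite ler_piMr ?eps_ge0 //; apply: le_trans w1; exact: N2_cut_le.
have h1 : N2 (iter i Bop (cut (reach i) w)) <= 2 * rho + 2 * eps i.
  apply: le_trans (N2_iterB A M_gt1 chi01 i _) _.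
  pose F := dft (zetaN R N) w; pose G : (I -> C) -> I -> C := dft (zetaN R N)^-1.
  have FE : N2 F <= 1 by rewrite (dft_isometry (zP R k M_gt1)).
  have -> : cut (reach i) w = (fun x => cut (reach i) (G (cut (reach i) F)) x + cut (reach i) (G (cut (predC (reach i)) F)) x).
    apply/funext => x; rewrite /cut; case: ifP => rx; last by rewrite addr0.
    rewrite -/(cut (reach i) F) -/(cut (predC (reach i)) F) -dftD -cutD.
    by rewrite /G /F (dftK (zP R k M_gt1)).
  apply: le_trans (N2D_le _ _) _; apply: lerD; apply: ler_wpM2l => //.
    apply: le_trans (fup _ _) _; first by move=> x /negPf nr; rewrite /cut nr.
    by rewrite ler_piMr //; apply: le_trans FE; exact: N2_cut_le.
  apply: le_trans (N2_cut_le _ _) _; rewrite (dft_isometry (zVP R k M_gt1)).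
  have -> : F = iter i Bop' (dft (zetaN R N) u) by apply/funext => x; rewrite /F /w dft_iterB.
  apply: le_trans (N2_off_dual _ _) _.
  by rewrite (dft_isometry (zP R k M_gt1)) u1 mulr1.
apply: le_trans (lerD (ler_wpM2l _ h1) (ler_wpM2l _ h2)) _ => //.
by rewrite le_eqVlt; apply/orP; left; apply/eqP; ring.
Qed.

End Decay.
End Propagation.

(** * The reachable set *)

Local Close Scope complex_scope.

(** One coordinate of the inductive step: going back one step divides the errors by
    [M], so that [2 W] is preserved. *)
Lemma block_step (M m W a lo x' d p n : nat) : (2 <= M)%N -> (0 < W)%N ->
  n = (M * m)%N -> ~~ far x' (M * lo) W ->
  (d * n <= x' + 2 * W)%N -> (x' <= d * n + n + 2 * W)%N ->
  ((a * p + d) * m <= a * (p * m) + lo + 2 * W)%N /\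
  (a * (p * m) + lo <= (a * p + d) * m + m + 2 * W)%N.
Proof.
move=> M2 W0 -> nf h1 h2.
have {nf} [f1 f2] : (x' < M * lo + W)%N /\ (M * lo < x' + W)%N by move: nf; rewrite /far; lia.
have e1 : (M * (d * m) < M * lo + M * (2 * W))%N by nia.
have e2 : (M * lo < M * (d * m) + M * m + M * (2 * W))%N by nia.
have {e1} : (d * m < lo + 2 * W)%N by rewrite -(ltn_pmul2l (m := M)) ?mulnDr //; lia.
have {e2} : (lo < d * m + m + 2 * W)%N by rewrite -(ltn_pmul2l (m := M)) ?mulnDr //; lia.
by rewrite mulnDl mulnA; lia.
Qed.

Lemma block_lt (M m a d : nat) : (a < M)%N -> (d < m)%N -> (a * m + d < M * m)%N.
Proof. by move=> aM dm; nia. Qed.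

Section Reach.
Variables (M : nat) (A : {set 'I_M * 'I_M}) (k : nat).
Hypothesis M_gt1 : (1 < M)%N.
Local Notation N := (M ^ k.+1)%N.
Local Notation I := ('I_N * 'I_N)%type.
Variable W : nat.
Hypothesis W0 : (0 < W)%N.
Let expM0 j : (0 < M ^ j)%N. Proof. by rewrite expn_gt0 ltnW. Qed.

(** A point that can make [i] steps inside the blocks of [A] has its [i] leading
    digits in [A], up to an error of size [W]. *)
Lemma reach_digits i (x : I) : (i <= k.+1)%N -> reach A M_gt1 W i x ->
  exists d : nat * nat, [/\ (d.1 < M ^ i)%N, (d.2 < M ^ i)%N, cantor_digits A i d,
    (d.1 * M ^ (k.+1 - i) <= x.1 + 2 * W)%N /\ (x.1 <= d.1 * M ^ (k.+1 - i) + M ^ (k.+1 - i) + 2 * W)%N &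
    (d.2 * M ^ (k.+1 - i) <= x.2 + 2 * W)%N /\ (x.2 <= d.2 * M ^ (k.+1 - i) + M ^ (k.+1 - i) + 2 * W)%N].
Proof.
elim: i x => [|i IHi] x ik.
  move=> _; exists (0, 0)%N; rewrite subn0 /= !mul0n expn0; split=> //.
  - by apply/cantor_digitsP.
  - by have := ltn_ord x.1; split; lia.
  - by have := ltn_ord x.2; split; lia.
rewrite /reach iterS /= /back -/(reach A M_gt1 W i) => /andP[hA /existsP[x' /and3P[rx' n1 n2]]].
have [[d1 d2] /= [l1 l2 dA [a1 b1] [a2 b2]]] := IHi x' (ltnW ik) rx'.
have nE : (M ^ (k.+1 - i) = M * M ^ (k.+1 - i.+1))%N by rewrite -expnS; congr (_ ^ _)%N; lia.
have NE : (M ^ i * M ^ (k.+1 - i.+1) = M ^ k)%N by rewrite -expnD; congr (_ ^ _)%N; lia.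
have xE (y : 'I_N) : (y %/ M ^ k * (M ^ i * M ^ (k.+1 - i.+1)) + y %% M ^ k = y)%N.
  by rewrite NE -divn_eq.
have [s1 t1] := block_step (hiP M_gt1 x).1 (M ^ i) M_gt1 W0 nE n1 a1 b1.
have [s2 t2] := block_step (hiP M_gt1 x).2 (M ^ i) M_gt1 W0 nE n2 a2 b2.
rewrite /= !xE in s1 t1 s2 t2.
exists ((hiP M_gt1 x).1 * M ^ i + d1, (hiP M_gt1 x).2 * M ^ i + d2)%N; split=> //=.
- by rewrite [X in (_ < X)%N]expnS; apply: block_lt => //; exact: (ltn_ord (hiP M_gt1 x).1).
- by rewrite [X in (_ < X)%N]expnS; apply: block_lt => //; exact: (ltn_ord (hiP M_gt1 x).2).
rewrite -addn1 cantor_digits_cat //= !modnMDl (modn_small l1) (modn_small l2) dA /=.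
rewrite !divnMDl // (divn_small l1) (divn_small l2) !addn0; apply/cantor_digitsP => j; rewrite ltnS leqn0 => /eqP ->.
rewrite /= expn0 !divn1 !modn_small ?(ltn_ord (hiP M_gt1 x).1) ?(ltn_ord (hiP M_gt1 x).2) //.
by apply/exists_inP; exists (hiP M_gt1 x); rewrite ?eqxx.
Qed.

Lemma some_digits (a : 'I_M * 'I_M) : a \in A -> forall w, exists e : nat * nat,
  [/\ (e.1 < M ^ w)%N, (e.2 < M ^ w)%N & cantor_digits A w e].
Proof.
move=> aA; elim=> [|w [[e1 e2] /= [l1 l2 eA]]].
  by exists (0, 0)%N; split=> //; apply/cantor_digitsP.
exists (a.1 * M ^ w + e1, a.2 * M ^ w + e2)%N; split=> /=.
- by rewrite [X in (_ < X)%N]expnS; apply: block_lt => //; exact: (ltn_ord a.1).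
- by rewrite [X in (_ < X)%N]expnS; apply: block_lt => //; exact: (ltn_ord a.2).
rewrite -addn1 cantor_digits_cat //= !modnMDl (modn_small l1) (modn_small l2) eA /=.
rewrite !divnMDl // (divn_small l1) (divn_small l2) !addn0; apply/cantor_digitsP => j; rewrite ltnS leqn0 => /eqP ->.
rewrite /= expn0 !divn1 !modn_small ?(ltn_ord a.1) ?(ltn_ord a.2) //.
by apply/exists_inP; exists a; rewrite ?eqxx.
Qed.

End Reach.

(** The missing low digits can be completed by any word over [A]. *)
Lemma reach_near (M : nat) (A : {set 'I_M * 'I_M}) (k w : nat) (M_gt1 : (1 < M)%N) (a : 'I_M * 'I_M) :
  a \in A -> (w <= k.+1)%N -> forall x : ord_pair M k.+1, reach A M_gt1 (M ^ w) (k.+1 - w) x ->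
  exists y : ord_pair M k.+1, cantor_pred A y /\
     [/\ (x.1 <= y.1 + 3 * M ^ w)%N, (y.1 <= x.1 + 3 * M ^ w)%N,
         (x.2 <= y.2 + 3 * M ^ w)%N & (y.2 <= x.2 + 3 * M ^ w)%N].
Proof.
move=> aA wk x rx.
have W0 : (0 < M ^ w)%N by rewrite expn_gt0 ltnW.
have [[d1 d2] /= [l1 l2 dA]] := reach_digits W0 (leq_subr w k.+1) rx.
rewrite subKn // => -[p1 q1] [p2 q2].
have [[e1 e2] /= [f1 f2 eA]] := some_digits M_gt1 aA w.
have NE : (M ^ k.+1 = M ^ (k.+1 - w) * M ^ w)%N by rewrite -expnD subnK.
have y1 : (d1 * M ^ w + e1 < M ^ k.+1)%N.
  by rewrite NE; apply: block_lt.
have y2 : (d2 * M ^ w + e2 < M ^ k.+1)%N.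
  by rewrite NE; apply: block_lt.
exists (Ordinal y1, Ordinal y2); split=> /=.
  rewrite /cantor_pred /val2 /= -{1}(subnKC wk) cantor_digits_cat //=.
  by rewrite !modnMDl !modn_small // eA /= !divnMDl // !divn_small // !addn0.
move: (M ^ w)%N f1 f2 p1 q1 p2 q2 => W f1 f2 p1 q1 p2 q2.
clear -f1 f2 p1 q1 p2 q2; split; lia.
Qed.

(** * Choice of the scales *)

Local Open Scope classical_set_scope.
Local Open Scope ring_scope.

Section Scales.
Variables (R : realType) (M : nat).
Hypothesis M_gt1 : (1 < M)%N.
Let M0 : (0 < M)%N. Proof. exact: ltnW. Qed.
Let Mr : 0 < M%:R :> R. Proof. by rewrite ltr0n. Qed.

Lemma expr_small (r e : R) : 0 <= r -> r < 1 -> 0 < e -> exists q, r ^+ q <= e.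
Proof.
move=> r0 r1 e0.
have rc : (fun n : nat => r ^+ n) @ \oo --> (0 : R) by apply: cvg_expr; rewrite ger0_norm.
have /cvgrPdist_le/(_ e e0)[q _ H] := rc; exists q.
by have := H q (leqnn q); rewrite /= sub0r normrN ger0_norm // exprn_ge0.
Qed.

(** The level [m0] is chosen so that every [m0] digits gain a factor [M ^ -8], which
    absorbs the factor [W ^ 4] of the thickening and leaves [W ^ -4]. *)
Lemma fup_scale (A : {set 'I_M * 'I_M}) k0 (r : R) : (0 < k0)%N -> 0 <= r -> r < 1 -> FUP A k0 r ->
  exists2 m0, (2 <= m0)%N & forall n, exists rho : R, [/\ 0 <= rho, FUP A n rho &
     rho * (M ^ (n %/ m0))%:R ^+ 8 <= 1].
Proof.
move=> k00 r0 r1 F.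
have e0 : 0 < (M%:R ^+ 8)^-1 :> R by rewrite invr_gt0 exprn_gt0.
have [q0 rq0] := expr_small r0 r1 e0.
pose q := (q0 + 2)%N.
have rq : r ^+ q * M%:R ^+ 8 <= 1.
  rewrite -ler_pdivlMr ?exprn_gt0 // mul1r; apply: le_trans rq0.
  by apply: ler_wiXn2l; rewrite ?(ltW r1) // /q leq_addr.
exists (k0 * q)%N; first by rewrite /q; nia.
move=> n; exists (r ^+ (n %/ k0)); split; rewrite ?exprn_ge0 //; first exact: FUP_power.
set w := (n %/ (k0 * q))%N.
have wq : (w * q <= n %/ k0)%N by rewrite leq_divRL // -mulnA [(q * k0)%N]mulnC /w leq_divM.
apply: le_trans (_ : r ^+ (w * q) * (M ^ w)%:R ^+ 8 <= _).
  by rewrite ler_wpM2r ?exprn_ge0 ?ler0n //; apply: ler_wiXn2l => //; exact: ltW.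
rewrite natrX -!exprM mulnC [(w * 8)%N]mulnC !exprM -exprMn exprn_ile1 //.
by rewrite mulr_ge0 ?exprn_ge0 ?ler0n.
Qed.

(** If [s > mu ^ 2], then [s ^ (2 * K)] is at least [1 / (M * W)] because [K <= m0 *
    (w + 1)], and this is larger than [C * W ^ -4]. *)
Lemma rate_bound (mu s C : R) m0 w K : 0 < mu -> mu <= 1 -> mu ^+ (4 * m0) = M%:R^-1 -> 0 <= s ->
  (K <= m0 * w.+1)%N -> (0 < K)%N -> s ^+ (2 * K) * (M ^ w)%:R ^+ 4 <= C ->
  C * M%:R < (M ^ w)%:R -> s <= mu ^+ 2.
Proof.
move=> mu0 mu1 muM s0 Km K0 sC CW; rewrite leNgt; apply/negP => h.
set W : R := (M ^ w)%:R in sC CW.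
have W1 : 1 <= W by rewrite ler1n expn_gt0 M0.
have H1 : (M%:R * W)^-1 <= s ^+ (2 * K).
  apply: le_trans (_ : (mu ^+ 2) ^+ (2 * K) <= _); last by apply: lerXn2r; rewrite ?nnegrE ?sqr_ge0 // ltW.
  rewrite -exprM (_ : 2 * (2 * K) = 4 * K)%N; last by lia.
  apply: le_trans (_ : mu ^+ (4 * (m0 * w.+1)) <= _); last first.
    by apply: ler_wiXn2l; rewrite ?(ltW mu0) // leq_mul2l.
  by rewrite mulnA exprM muM /W natrX -exprS exprVn.
have H2 : W ^+ 4 <= C * M%:R * W.
  have W0 : 0 < W by apply: lt_le_trans W1.
  rewrite -mulrA -ler_pdivrMr ?(mulr_gt0 Mr W0) //.
  by apply: le_trans sC; rewrite mulrC ler_wpM2r // exprn_ge0 // (le_trans ler01).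
have H3 : C * M%:R * W < W * W by rewrite ltr_pM2r // (lt_le_trans ltr01).
have : W ^+ 4 < W ^+ 2 by apply: le_lt_trans H2 _; rewrite expr2.
by rewrite ltNge ler_weXn2l.
Qed.

(** As [N <= W ^ (2 m0)], the order [5 m0 + 2] of the summation by parts beats the
    factor [N ^ 5]. *)
Lemma eps_bound (d B : R) m0 k w K : 0 <= B -> (K <= k.+1)%N -> (k.+1 <= 2 * (w * m0))%N ->
  (M ^ w)%:R ^+ (2 * (5 * m0 + 2)) * d = B ->
  eps M k d K * (M ^ w)%:R ^+ 4 <= 2 * B.
Proof.
move=> B0 Kk kw dB.
set W : R := (M ^ w)%:R in dB *.
have W0 : 0 < W by rewrite ltr0n expn_gt0 M0.
have d0 : 0 <= d by rewrite -(pmulr_rge0 _ (exprn_gt0 (2 * (5 * m0 + 2)) W0)) dB.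
have N0 : 0 <= (M ^ k.+1)%:R :> R by rewrite ler0n.
rewrite /eps; apply: le_trans (_ : 2 * (M ^ k.+1)%:R * ((M ^ k.+1)%:R ^+ 4 * d) * W ^+ 4 <= _).
  rewrite ler_wpM2r ?exprn_ge0 ?(ltW W0) // ler_wpM2r ?mulr_ge0 ?exprn_ge0 //.
  rewrite exprS lerBlDr ler_wpDr // ler_wpM2l // natrX.
  apply: le_trans (_ : 2 ^+ k.+1 <= _); first by apply: ler_weXn2l; rewrite ?ler1n.
  by apply: lerXn2r; rewrite ?nnegrE ?ler0n // ler_nat.
have NW : (M ^ k.+1)%:R <= W ^+ (2 * m0) :> R.
  rewrite /W -natrX ler_nat -expnM leq_pexp2l //; lia.
have -> : 2 * (M ^ k.+1)%:R * ((M ^ k.+1)%:R ^+ 4 * d) * W ^+ 4 = 2 * ((M ^ k.+1)%:R ^+ 5 * (d * W ^+ 4)).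
  by set X := (M ^ k.+1)%:R; ring.
rewrite ler_wpM2l // -dB.
apply: le_trans (_ : W ^+ (2 * m0) ^+ 5 * (d * W ^+ 4) <= _).
  by rewrite ler_wpM2r ?mulr_ge0 ?exprn_ge0 ?(ltW W0) //; apply: lerXn2r => //; rewrite nnegrE exprn_ge0 // ltW.
by rewrite mulrCA mulrC -exprM -exprD (_ : 2 * m0 * 5 + 4 = 2 * (5 * m0 + 2))%N //; lia.
Qed.

Lemma rho_bound (rho W : R) : 1 <= W -> 0 <= rho -> rho * W ^+ 8 <= 1 ->
  4 * ((7 * W) ^+ 4 * rho) * W ^+ 4 <= 4 * 7 ^+ 4.
Proof.
move=> W1 r0 h; have -> : 4 * ((7 * W) ^+ 4 * rho) * W ^+ 4 = 4 * 7 ^+ 4 * (rho * W ^+ 8) by ring.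
by rewrite ler_piMr // mulr_ge0 // exprn_ge0.
Qed.

Lemma eigen_small (A : {set 'I_M * 'I_M}) (a : 'I_M * 'I_M) m0 (mu : R) : a \in A -> (2 <= m0)%N ->
  (forall n, exists rho : R, [/\ 0 <= rho, FUP A n rho & rho * (M ^ (n %/ m0))%:R ^+ 8 <= 1]) ->
  0 < mu -> mu <= 1 -> mu ^+ (4 * m0) = M%:R^-1 ->
  forall chi, is_cutoff chi -> exists k1, forall k, (k1 <= k)%N ->
    forall (u : 'I_(M ^ k.+1) * 'I_(M ^ k.+1) -> R[i]) l, N2 u = 1 ->
      Bop A chi M_gt1 u = (fun x => l * u x) -> sqn l <= mu ^+ 2.
Proof.
move=> aA m2 fup mu0 mu1 muM chi chiP.
have m00 : (0 < m0)%N by apply: ltnW.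
have [c c0 marg] := cutoff_margin chiP.
have [B [B0 HB]] := kern_bound A M_gt1 chiP marg (5 * m0 + 2).
pose C := 4 * 7 ^+ 4 + 6 * (2 * B) : R.
have C0 : 0 <= C by rewrite addr_ge0 ?mulr_ge0 ?exprn_ge0.
(* From w0 on, W exceeds the constants of both estimates. *)
pose w0 := (Num.bound (C * M%:R) + Num.bound c^-1)%N.
exists (m0 * w0.+1)%N => k k1 u l u1 Bu.
pose w := (k.+1 %/ m0)%N.
have w0w : (w0 < w)%N by rewrite /w leq_divRL // mulnC; apply: leq_trans k1 (leqnSn _).
have w_gt0 : (0 < w)%N by apply: leq_ltn_trans w0w.
have wk : (m0 * w <= k.+1)%N by rewrite mulnC leq_divM.
have kw : (k.+1 < m0 * w.+1)%N by rewrite mulnC ltn_ceil.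
have wW : (w < M ^ w)%N by apply: ltn_expl.
set W := (M ^ w)%N in wW.
have W1 : (0 < W)%N by apply: leq_ltn_trans wW.
have W1r : 1 <= W%:R :> R by rewrite ler1n.
have CW : C * M%:R < W%:R.
  apply: lt_trans (archi_boundP (mulr_ge0 C0 (ltW Mr))) _; rewrite ltr_nat.
  by apply: leq_ltn_trans wW; apply: leq_trans (ltnW w0w); rewrite leq_addr.
have cW : c^-1 < W%:R.
  apply: lt_trans (archi_boundP _) _; first by rewrite invr_ge0 ltW.
  by rewrite ltr_nat; apply: leq_ltn_trans wW; apply: leq_trans (ltnW w0w); rewrite leq_addl.
have w2 : (w + w <= k.+1)%N by apply: leq_trans wk; nia.
have WcN : W%:R <= c * (M ^ k.+1)%:R.
  apply: le_trans (_ : c * (W * W)%:R <= _); last first.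
    by rewrite ler_wpM2l ?(ltW c0) // ler_nat -expnD leq_pexp2l.
  rewrite natrM mulrA ler_peMl ?ler0n // -ler_pdivrMl // mulr1; exact: ltW.
have [rho [rho0 F rhoW]] := fup k.+1.
pose d := B / W%:R ^+ (2 * (5 * m0 + 2)) : R.
have Wp e : 0 < W%:R ^+ e :> R by rewrite exprn_gt0 // ltr0n.
have d0 : 0 <= d by rewrite mulr_ge0 ?invr_ge0 // ltW.
have small (x i : 'I_(M ^ k.+1) * 'I_(M ^ k.+1)) :
    far x.1 (M * (loP M_gt1 i).1) W || far x.2 (M * (loP M_gt1 i).2) W -> sqn (kern A chi M_gt1 x i) <= d.
  by move=> xi; rewrite ler_pdivlMr // mulrC; apply: HB.
pose K := (k.+1 - w)%N.
have wkk : (w <= k.+1)%N by apply: leq_trans w2; rewrite leq_addr.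
have T := @reach_near M A k w M_gt1 a aA wkk.
have fupT (v : ord_pair M k.+1 -> R[i]) : (forall x, ~~ reach A M_gt1 W K x -> v x = 0) ->
    N2 (cut (reach A M_gt1 W K) (dft (zetaN R (M ^ k.+1))^-1 v)) <= ((2 * (3 * W) + 1) ^ 4)%:R * rho * N2 v.
  by move=> vT; apply: (@FUP_thick R M A M_gt1 k.+1 rho (3 * W)%N (reach A M_gt1 W K) _ rho0 F (or_intror erefl) T v vT).
have rho1 : 0 <= ((2 * (3 * W) + 1) ^ 4)%:R * rho by rewrite mulr_ge0 ?ler0n.
have key := eigen_bound (cutoff_range chiP) d0 small rho1 fupT u1 Bu.
apply: (rate_bound mu0 mu1 muM (sqn_ge0 l) (K := K) (w := w) (C := C)) => //.
- by apply: leq_trans (leq_subr _ _) (ltnW kw).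
- by rewrite subn_gt0; apply: leq_trans w2; rewrite -addn1 leq_add2l.
rewrite -/W; apply: le_trans (ler_wpM2r (ltW (Wp 4%N)) key) _.
rewrite mulrDl lerD //.
  apply: le_trans (rho_bound W1r rho0 rhoW); rewrite ler_wpM2r ?(ltW (Wp _)) // ler_wpM2l // ler_wpM2r //.
  rewrite -natrM -natrX ler_nat leq_exp2r //; clear -W1; lia.
rewrite -mulrA ler_wpM2l //; apply: (eps_bound (m0 := m0)) => //; first exact: leq_subr.
- apply: leq_trans (ltnW kw) _; rewrite [(w * m0)%N]mulnC mulnCA leq_mul2l mul2n -addnn -addn1.
  by rewrite leq_add2l w_gt0 orbT.
by rewrite -/W /d mulrC mulfVK // lt0r_neq0.
Qed.

End Scales.

(** * The spectral radius *)

Lemma spectral_radius_le (R : realType) (N : nat) (T : 'End(l2 R N)) (m : R) : 0 <= m ->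
  (forall (u : l2 R N) l, u != 0 -> T u = l *: u -> sqn l <= m ^+ 2) ->
  (spectral_radius T <= m%:E)%E.
Proof.
move=> m0 H; apply: ge_ereal_sup => _ [l Tl <-]; rewrite lee_fin.
have : sqn l <= m ^+ 2.
  have /(H _ l) : vpick (passmx.leigenspace T l) != 0 by rewrite vpick0.
  apply; have := memv_pick (passmx.leigenspace T l).
  rewrite memv_ker !lfun_simp /= subr_eq0 => /eqP //.
case: l {Tl} => a b; rewrite /sqn /= => ab.
by rewrite -(ger0_norm m0) -sqrtr_sqr ler_wsqrtr.
Qed.

Lemma limn_esup_le_near (R : realType) (u : nat -> \bar R) (c : \bar R) k1 :
  (forall k, (k1 <= k)%N -> (u k <= c)%E) -> (limn_esup u <= c)%E.
Proof.
move=> H; apply: (@le_trans _ _ (ereal_sup [set u k | k in [set k | (k1 <= k)%N]])).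
  apply: ereal_inf_lbound; exists [set k | (k1 <= k)%N] => //; by exists k1.
by apply: ge_ereal_sup => _ [k kk <-]; exact: H.
Qed.

Theorem theorem4 (R : realType) (M : nat) (A : {set 'I_M * 'I_M})
    (M_gt0 : (0 < M)%N) (A_proper : A \proper [set: 'I_M * 'I_M]%SET)
    (A_nolines : ~ has_orthogonal_lines (cantor_set R A)) :
  exists2 beta : R, 0 < beta &
    forall chi : R * R -> R, is_cutoff chi ->
      (limn_esup (fun k => spectral_radius (baker A chi k))
         <= (M%:R `^ (- beta))%:E)%E.
Proof.
(* An empty alphabet, which includes the case M = 1, gives the zero operator. *)
have [A0|/set0Pn[a aA]] := eqVneq A finset.set0.
  exists 1 => // chi _; apply: (@limn_esup_le_near _ _ _ 0%N) => k _.
  apply: spectral_radius_le; first exact: powR_ge0.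
  move=> u l u0; rewrite /baker A0 big_set0 zero_lfunE => /esym/eqP.
  by rewrite scaler_eq0 (negPf u0) orbF => /eqP ->; rewrite sqn0 sqr_ge0.
have M_gt1 : (1 < M)%N.
  rewrite ltn_neqAle M_gt0 andbT; apply/eqP => M1.
  subst M; have /properP[_ [b _ /negP]] := A_proper; apply.
  suff -> : b = a by [].
  by case: a b {aA} => [a1 a2] [b1 b2]; rewrite [a1]ord1 [a2]ord1 [b1]ord1 [b2]ord1.
have [k0 [r [k00 r0 r1 F]]] := FUP_base R M_gt1 A_proper (nolines_escape M_gt1 A_nolines).
have [m0 m2 fup] := fup_scale M_gt1 k00 r0 r1 F.
have n0 : 0 < (4 * m0)%:R :> R by rewrite ltr0n; lia.
(* The exponent for which 4 * m0 factors M `^ (- beta) make up one digit. *)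
exists (4 * m0)%:R^-1 => [|chi chiP]; first by rewrite invr_gt0.
set mu := _ `^ _.
have Mr1 : 1 <= M%:R :> R by rewrite ler1n.
have mu0 : 0 < mu by rewrite powR_gt0 // ltr0n.
have mu1 : mu <= 1 by rewrite -(powRr0 M%:R) ler_powR // oppr_le0 invr_ge0 ltW.
have muM : mu ^+ (4 * m0) = M%:R^-1.
  by rewrite -powR_mulrn ?powR_ge0 // -powRrM mulNr mulVf ?lt0r_neq0 // powR_inv1 ?ler0n.
have [k1 H] := eigen_small M_gt1 aA m2 fup mu0 mu1 muM chiP.
apply: (limn_esup_le_near (k1 := k1)) => k kk; apply: spectral_radius_le; first exact: ltW.
move=> u l u0 Tu.
have Nu : 0 < N2 u.
  rewrite lt0r N2_ge0 andbT; apply: contra u0 => /eqP e; apply/eqP/ffunP => x.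
  apply/eqP; rewrite ffunE -sqn_eq0; apply/eqP.
  by apply: (psumr_eq0P _ e) => // i _; exact: sqn_ge0.
pose s : R[i] := ((Num.sqrt (N2 u))^-1)%:C%C.
have ss : sqn s = (N2 u)^-1 by rewrite sqn_real exprVn sqr_sqrtr // ltW.
have B1 : Bop A chi M_gt1 u = (fun x => l * u x).
  by apply/funext => x; rewrite -baker_Bop Tu ffunE.
apply: (H k kk (fun x => s * u x)).
  rewrite /N2; under eq_bigr => x _ do rewrite sqnM ss.
  by rewrite -mulr_sumr mulVf // lt0r_neq0.
by rewrite BopZ B1; apply/funext => x; rewrite mulrCA.
Qed.
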